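(* Let $n\ge 2$, $1\le k<n$, $r\ge 1$ and $u\in S_n$. Then in $qH^*\mathbb{F}\ell_n$, $$\mathfrak{S}_u \ast p_r^q(x_1,\dotsc,x_k)\ =\ \sum (-1)^{\mathrm{ht}(wu^{-1})+1}\, q^\alpha\, \mathfrak{S}_w\,,$$ the sum over all minimal intervals $[u,q^\alpha w]_k^q$ in the quantum $k$-Bruhat order (with $w\in S_n$, $\alpha\in\mathbb{N}^{n-1}$) of rank $r$ such that $wu^{-1}$ is a single cycle.
   Context: Permutations are composed as functions, $(i,j)$ is a transposition, $[n]=\{1,\dots,n\}$, $\mathbb{N}=\{0,1,2,\dots\}$, $\ell(u)=\#\{i<j\mid u(i)>u(j)\}$. Quantum cohomology: $\mathbb{Z}[q]=\mathbb{Z}[q_1,\dots,q_{n-1}]$, $q^\alpha=q_1^{\alpha_1}\cdots q_{n-1}^{\alpha_{n-1}}$, and $q_{i,j}=q_iq_{i+1}\cdots q_{j-1}$ for $i<j$. $qH^*\mathbb{F}\ell_n$ is the small quantum cohomology ring of the manifold of complete flags in $\mathbb{C}^n$: it is a commutative associative $\mathbb{Z}[q]$-algebra, free as a $\mathbb{Z}[q]$-module with basis the Schubert classes $\{\mathfrak{S}_w\}_{w\in S_n}$ and unit $\mathfrak{S}_e$, whose product $\ast$ is determined by the quantum Monk formula, for $u\in S_n$, $1\le k<n$: $$\mathfrak{S}_u*\mathfrak{S}_{(k,k+1)}=\sum_{\substack{1\le i\le k<j\le n\\ \ell(u(i,j))=\ell(u)+1}}\mathfrak{S}_{u(i,j)}+\sum_{\substack{1\le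 i\le k<j\le n\\ \ell(u)+1=\ell(u(i,j))+2(j-i)}}q_{i,j}\,\mathfrak{S}_{u(i,j)}\,.$$ Quantum Schur polynomials and power sums: for a partition $\lambda=(\lambda_1\ge\dots\ge\lambda_k\ge0)$ with $\lambda_1\le n-k$ (that is, $\lambda\subseteq R_{k,n-k}$), $v(\lambda,k)\in S_n$ is the permutation with $v(i)=i+\lambda_{k+1-i}$ for $i\le k$ and $v(k+1)<\dots<v(n)$. The quantum Schur polynomial $s^q_\lambda(x_1,\dots,x_k)$ is the quantum Schubert polynomial of $v(\lambda,k)$; it represents the class $\mathfrak{S}_{v(\lambda,k)}$, so $\mathfrak{S}_u*s^q_\lambda(x_1,\dots,x_k)=\mathfrak{S}_u*\mathfrak{S}_{v(\lambda,k)}$. The quantum power sum is $$p^q_r(x_1,\dots,x_k)=s^q_{(r)}-s^q_{(r-1,1)}+\dots+(-1)^{r+1}s^q_{(1^r)}\qquad(\text{all in }x_1,\dots,x_k),$$ where $s^q_\lambda(x_1,\dots,x_k)$ is taken to be $0$ if $\lambda\not\subseteq R_{k,n-k}$; the product $\ast$ with it is extended linearly. Quantum $k$-Bruhat order $\le_k^q$ on $S_n[q]=\{q^\alpha u\mid u\in S_n,\ \alpha\in\mathbb{N}^{n-1}\}$: the partial order generated by the covers $u\lessdot_k^q u(i,j)$ if $i\le k<j$ and $\ell(u(i,j))=\ell(u)+1$; $u\lessdot_k^q q_{i,j}u(i,j)$ if $i\le k<j$ and $\ell(u)+1=\ell(u(i,j))+2(j-i)$; and extended $q$-multiplicatively ($q^\alpha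 u\le^q_k q^{\alpha+\beta}w$ iff $u\le_k^q q^\beta w$). It is graded by $\ell(q^\alpha u)=2\sum_i\alpha_i+\ell(u)$. For $u\le_k^q q^\alpha w$, $[u,q^\alpha w]_k^q$ is the interval, with rank $\ell(q^\alpha w)-\ell(u)$. For a permutation $\zeta\in S_n$: $\mathrm{supp}(\zeta)=\{i\mid\zeta(i)\ne i\}$, $\mathrm{ht}(\zeta)=\#\{i\in[n]\mid i<\zeta(i)\}$, and $s(\zeta)$ is the number of nontrivial cycles of $\zeta$. The interval $[u,q^\alpha w]_k^q$ is minimal if its rank equals $\#\mathrm{supp}(wu^{-1})-s(wu^{-1})$. *)

(* Defs.v *)
From mathcomp Require Import all_boot all_order all_fingroup all_algebra.
From mathcomp Require Import boolp classical_sets cardinality fsbigop.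
From mathcomp Require Import mpoly.
From Stdlib Require Import Relation_Operators.

Set Implicit Arguments.
Unset Strict Implicit.
Unset Printing Implicit Defensive.

Import GRing.Theory.
Local Open Scope ring_scope.

(* Indices are shifted to start at 0: [n] = {1, ..., n} becomes 'I_n, so that
   1 <= i <= k < j <= n reads (i < k <= j)%N for i, j : 'I_n, while k keeps
   its value.  The variable q_m is 'X_(m - 1).  Since (s * t)%g x = t (s x),
   the composite of functions u o (i, j) is (tperm i j * u)%g, and w o u^-1
   is (u^-1 * w)%g. *)

Definition len n (u : 'S_n) : nat :=
  #|[set p : 'I_n * 'I_n | (p.1 < p.2)%N && (u p.2 < u p.1)%N]|.

Definition Zq n := {mpoly int[n.-1]}.

(* The exponent of q_{i,j} = q_i q_{i+1} ... q_{j-1}. *)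
Definition qexp n (i j : nat) : 'X_{1..n.-1} :=
  [multinom nat_of_bool (i <= m < j)%N | m < n.-1].

Definition bruhat_step n (u : 'S_n) (i j : 'I_n) : bool :=
  len (tperm i j * u)%g == (len u).+1.

Definition quantum_step n (u : 'S_n) (i j : 'I_n) : bool :=
  (len u).+1 == (len (tperm i j * u)%g + 2 * (j - i))%N.

(* sch makes A a model of the small quantum cohomology ring, with sch w the
   Schubert class of w.  These properties determine (A, sch) up to a unique
   isomorphism.  In quantum_monk, the transposition (i, j) with j = i + 1 is
   the simple transposition (k, k + 1) for k = j. *)
Record is_quantum_cohomology n (A : comAlgType (Zq n)) (sch : 'S_n -> A) : Prop :=
  IsQuantumCohomology {
    schubert_span : forall a : A, exists c : 'S_n -> Zq n,
      a = \sum_w c w *: sch w;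
    schubert_free : forall c : 'S_n -> Zq n,
      \sum_w c w *: sch w = 0 -> forall w, c w = 0;
    schubert_unit : sch 1%g = 1;
    quantum_monk : forall (u : 'S_n) (i j : 'I_n), j = i.+1 :> nat ->
      sch u * sch (tperm i j) =
        \sum_(p : 'I_n * 'I_n | (p.1 < j <= p.2)%N && bruhat_step u p.1 p.2)
           sch (tperm p.1 p.2 * u)%g
      + \sum_(p : 'I_n * 'I_n | (p.1 < j <= p.2)%N && quantum_step u p.1 p.2)
           ('X_[qexp n p.1 p.2] : Zq n) *: sch (tperm p.1 p.2 * u)%g
  }.

(* Partitions are given by the sequence of their positive parts. *)
Definition in_rect (k m : nat) (la : seq nat) : bool :=
  (size la <= k)%N && all (fun p => p <= m)%N la.

Definition is_grassmannian n (la : seq nat) (k : nat) (v : 'S_n) : bool :=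
  [forall i : 'I_n, (i < k)%N ==> (v i == i + nth 0 la (k.-1 - i) :> nat)%N] &&
  [forall i : 'I_n, forall j : 'I_n, (k <= i < j)%N ==> (v i < v j)%N].

(* The permutation v(la, k); the default value is irrelevant for la contained
   in the k x (n - k) rectangle, see grassmannian_permP. *)
Definition grassmannian_perm n (la : seq nat) (k : nat) : 'S_n :=
  odflt 1%g [pick v | is_grassmannian la k v].

(* The class of s^q_la(x_1, ..., x_k). *)
Definition qschur n (A : comAlgType (Zq n)) (sch : 'S_n -> A) (k : nat)
    (la : seq nat) : A :=
  if in_rect k (n - k) la then sch (grassmannian_perm n la k) else 0.

Definition hook (r i : nat) : seq nat := (r - i)%N :: nseq i 1%N.

Definition qpower_sum n (A : comAlgType (Zq n)) (sch : 'S_n -> A) (k r : nat) : A :=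
  \sum_(i < r) (-1) ^+ i * qschur sch k (hook r i).

(* The pair (al, u) stands for q^al u in S_n[q]. *)
Definition Snq n := ('X_{1..n.-1} * 'S_n)%type.

Definition qlen n (x : Snq n) : nat := (2 * mdeg x.1 + len x.2)%N.

Definition qbruhat_cover n (k : nat) (x y : Snq n) : Prop :=
  exists i j : 'I_n, (i < k <= j)%N /\ y.2 = (tperm i j * x.2)%g /\
    (bruhat_step x.2 i j /\ y.1 = x.1 \/
     quantum_step x.2 i j /\ y.1 = (x.1 + qexp n i j)%MM).

Definition qbruhat_le n (k : nat) : Snq n -> Snq n -> Prop :=
  clos_refl_trans _ (@qbruhat_cover n k).

(* Truncated subtraction is harmless: qlen increases by 1 along each cover. *)
Definition rank n (x y : Snq n) : nat := (qlen y - qlen x)%N.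

Definition supp n (z : 'S_n) : {set 'I_n} := [set i | z i != i].

Definition ht n (z : 'S_n) : nat := #|[set i : 'I_n | (i < z i)%N]|.

Definition ncycles n (z : 'S_n) : nat := #|[set c in porbits z | (1 < #|c|)%N]|.

Definition minimal_interval n (k : nat) (u : 'S_n) (y : Snq n) : Prop :=
  let z := (u^-1 * y.2)%g in
  qbruhat_le k (0%MM, u) y /\ rank (0%MM, u) y = (#|supp z| - ncycles z)%N.

Definition MN_intervals n (k r : nat) (u : 'S_n) : set (Snq n) :=
  [set y | minimal_interval k u y /\ rank (0%MM, u) y = r /\
           ncycles (u^-1 * y.2)%g = 1%N]%classic.

Lemma grassmannian_permP n (la : seq nat) (k : nat) :
  (k <= n)%N -> sorted geq la -> in_rect k (n - k) la ->
  is_grassmannian la k (grassmannian_perm n la k).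
Proof.
move=> lekn sla /andP[_ la_le].
have lak i : (nth 0 la i <= n - k)%N.
  have [ilt|ige] := ltnP i (size la); last by rewrite nth_default.
  by move/allP: la_le; apply; apply: mem_nth.
have lamono i j : (i <= j)%N -> (nth 0 la j <= nth 0 la i)%N.
  move=> leij; have [jlt|jge] := ltnP j (size la); last by rewrite nth_default.
  have geq_trans : transitive geq by move=> a b c ba ac; apply: leq_trans ba.
  apply: (sorted_leq_nth geq_trans leqnn 0%N sla) => //.
  exact: leq_ltn_trans jlt.
pose f i := (i + nth 0 la (k.-1 - i))%N.
have fmono i j : (i < j)%N -> (f i < f j)%N.
  move=> ltij; rewrite /f -addSn leq_add // lamono //.
  by rewrite leq_sub2l // ltnW.
pose t := mkseq f k; pose t' := [seq x <- iota 0 n | x \notin t].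
have sizet : size t = k by rewrite size_mkseq.
have ut : uniq t.
  apply/mkseq_uniqP => i j _ _ eqf.
  by case: (ltngtP i j) => // /fmono; rewrite eqf ltnn.
have sub_t x : x \in t -> (x < n)%N.
  case/mapP=> i; rewrite mem_iota add0n => /= ltik ->.
  by rewrite -(subnKC lekn) /f -addSn leq_add.
have ps : perm_eq (t ++ t') (iota 0 n).
  apply: uniq_perm; rewrite ?iota_uniq // ?cat_uniq ?ut ?filter_uniq ?iota_uniq //.
    by rewrite andbT; apply/hasPn => x; rewrite mem_filter => /andP[].
  move=> x; rewrite mem_cat mem_filter mem_iota add0n /=.
  by case: (boolP (x \in t)) => //= /sub_t ->.
have us : uniq (t ++ t') by rewrite (perm_uniq ps) iota_uniq.
have ss : size (t ++ t') = n by rewrite (perm_size ps) size_iota.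
have lts (i : 'I_n) : (nth 0 (t ++ t') i < n)%N.
  have : nth 0%N (t ++ t') i \in t ++ t' by rewrite mem_nth ?ss.
  by rewrite (perm_mem ps) mem_iota add0n.
have injv : injective (fun i => Ordinal (lts i)).
  move=> i j /(congr1 val) /= /eqP.
  by rewrite nth_uniq ?ss // => /eqP /val_inj.
rewrite /grassmannian_perm; case: pickP => //= /(_ (perm injv)) /negP[].
apply/andP; split; apply/forallP => i.
  apply/implyP => ltik; rewrite permE /= nth_cat sizet ltik nth_mkseq //.
apply/forallP => j; apply/implyP => /andP[leki ltij].
have lekj : (k <= j)%N := leq_trans leki (ltnW ltij).
rewrite !permE /= !nth_cat sizet ![(_ < k)%N]ltnNge leki lekj /=.
have st' : sorted ltn t'.
  by apply: sorted_filter (iota_ltn_sorted 0 n); apply: ltn_trans.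
have szt' : size t' = (n - k)%N by rewrite -[in RHS]ss size_cat sizet addKn.
have in_t' (x : 'I_n) : (k <= x)%N -> (x - k)%N \in [pred m | m < size t']%N.
  by move=> lekx; rewrite inE szt' ltn_sub2r // (leq_ltn_trans lekx).
apply: (sorted_ltn_nth ltn_trans 0%N st'); rewrite ?in_t' //.
by rewrite ltn_sub2r // (leq_ltn_trans leki).
Qed.

(* \sum_(y \in D) F y is 0 by convention when F has infinite support in D;
   that case does not occur below. *)
Lemma finite_MN_intervals n (k r : nat) (u : 'S_n) :
  finite_set (MN_intervals k r u).
Proof.
pose N := (r + qlen ((0%MM, u) : Snq n)).+1.
pose T : finType := ('X_{1..n.-1 < N} * 'S_n)%type.
pose g (y : T) : Snq n := (bmnm y.1, y.2).
have fin : finite_set (g @` [set: T])%classic.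
  by apply: finite_image; exact: finite_finset.
apply: sub_finite_set fin => -[al w] [_ [rk _]].
have lt_al : (mdeg al < N)%N.
  rewrite ltnS addnC -leq_subLR -rk leq_sub2r // /qlen /=.
  by rewrite mul2n -addnn -addnA leq_addr.
by exists (BMultinom lt_al, w).
Qed.

(* Main.v *)
From HB Require Import structures.
From Stdlib Require Import Ncring Ncring_tac Relation_Operators.
Require Import Defs.
From mathcomp Require Import all_boot all_order all_fingroup all_algebra.
From mathcomp Require boolp classical_sets fsbigop.
From mathcomp Require Import mpoly zify ring.
Set Implicit Arguments.
Unset Strict Implicit.
Unset Printing Implicit Defensive.
Import GRing.Theory.
Local Open Scope ring_scope.

(** Notation: positions are numbered from 0, u(a,b) stands for
    [(tperm a b * u)%g], S_u for [sch u] and s_k for the simple transposition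
    (k, k + 1) of the classical numbering, with S_(s_0) = S_(s_n) = 0.

    For a < b let T_ab be the operator on the span of the Schubert classes that
    sends u to u(a,b), respectively to q_ab u(a,b), when this is a cover of the
    quantum Bruhat order, and to 0 otherwise; put T_ba = - T_ab.  Both kinds of
    covers obey one rule, invariant under cyclic rotation of the values: u(a,b)
    gives a cover exactly when no position strictly between a and b has a value
    cyclically between u a and u b ([bruhat_stepE], [quantum_stepE]).  It
    follows that the T_ab satisfy the relations of the quantum Fomin-Kirillov
    algebra ([bruhat_op_fk]): operators with disjoint indices commute, squares
    are scalars and T_ab T_bc + T_bc T_ca + T_ca T_ab = 0.  The Monk formula
    says that the Dunkl element theta_a, the sum of the T_ab over all b, is
    multiplication by S_(s_(a+1)) - S_(s_a) ([act_theta_op]).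

    The object that carries the proof is the star sum Theta_a, the sum of the
    products T_(a b_1) ... T_(a b_r) over all sequences of r distinct indices
    different from a.  It is a consequence of the relations alone that Theta_a
    commutes with every Dunkl element ([star_sum_comm], [star_sum_theta]).  A
    transition argument
    shows that an operator commuting with the Dunkl elements is multiplication
    by its value at the identity permutation ([act_central]).  Hence the sum
    D_k of the Theta_a over the first k positions a is multiplication by some
    class, and the theorem results from computing D_k in two ways.

    At the identity, the walks in a star centred at a can only grow hook
    shapes with corner at a or a - 1, whence Theta_a(1) = P_(a+1) - P_a with
    P_k the k-th quantum power sum ([act1_star_sum]), and D_k(1) = P_k.

    At u, the relations turn a walk inside a star centred at a into a walk that
    is a chain of the quantum k-Bruhat order with k = a or k = a + 1, with the
    same endpoint ([star_to_chain]); conversely, a chain of length r along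
    which the permutation changes by an (r + 1)-cycle becomes a walk in a star
    centred at any of the support positions next to the cut k
    ([chain_to_star]).  The exponent of q at the endpoint tells whether k is a or a + 1
    ([chain_exclusive]).  So the signed sum over the star walks centred at
    a = 0, ..., k - 1 telescopes ([sum_star_sums]): what remains are the
    endpoints of such chains for the cut k, which are exactly the minimal
    intervals of the theorem ([MN_intervalsE]), each with a sign given by the
    number of support positions before the cut.  That number is the height of
    the cycle ([chain_ht]). *)

(** * A ring of square-free generating functions *)

(** A function of finite sets stands for a polynomial in central variables
    indexed by [I], one for each element, whose squares are zero.  The
    coefficient of a square-free monomial then collects exactly the words
    without repeated letters. *)
Definition setring (I : finType) (R : pzRingType) := {ffun {set I} -> R}.

HB.instance Definition _ (I : finType) (R : pzRingType) :=
  GRing.Zmodule.on (setring I R).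

Section SetRing.
Variables (I : finType) (R : pzRingType).
Implicit Types (f g h : setring I R) (M X Y : {set I}) (b : I).

Definition sr_cst (r : R) : setring I R := [ffun M : {set I} => if M == set0 then r else 0].

Definition sr_mul f g : setring I R :=
  [ffun M : {set I} => \sum_(X : {set I} | X \subset M) f X * g (M :\: X)].

Fact sr_mulA : associative sr_mul.
Proof.
move=> f g h; apply/ffunP=> M; rewrite !ffunE.
under eq_bigr => X _ do rewrite ffunE mulr_sumr.
under [RHS]eq_bigr => X _ do rewrite ffunE mulr_suml.
rewrite [RHS](exchange_big_dep (fun X : {set I} => X \subset M)) /=; last first.
  by move=> Z X ZM XZ; apply: subset_trans XZ ZM.
apply: eq_bigr => X XM.
rewrite [RHS](reindex_onto (fun Y => X :|: Y) (fun Z => Z :\: X)) /=; last first.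
  by move=> Z /andP[_ XZ]; rewrite -[RHS](setID Z X) (setIidPr XZ).
apply: eq_big => Y.
  rewrite subsetUl andbT subUset XM subsetD /=; case: (boolP (Y \subset M)) => //= _.
  rewrite setDUl setDv set0U; apply/idP/eqP => [/setDidPl //|<-].
  by rewrite disjoint_sym disjoints_subset setCD subsetUr.
rewrite subsetD => /andP[YM /setDidPl dYX]; rewrite -mulrA setDUl setDv set0U dYX.
by rewrite setDDl.
Qed.

Definition sr_one : setring I R := sr_cst 1.

Lemma sr_mul_cstl r f M : sr_mul (sr_cst r) f M = r * f M.
Proof.
rewrite ffunE (bigD1 set0) ?sub0set //= ffunE eqxx setD0 big1 ?addr0 // => X.
by case/andP=> _ /negPf nX; rewrite ffunE nX mul0r.
Qed.

Lemma sr_mul_cstr r f M : sr_mul f (sr_cst r) M = f M * r.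
Proof.
rewrite ffunE (bigD1 M) //= ffunE setDv eqxx big1 ?addr0 // => X.
case/andP=> XM nX; rewrite ffunE setD_eq0; case: ifP => [MX|_]; last by rewrite mulr0.
by rewrite eqEsubset XM MX in nX.
Qed.

Fact sr_mul1r : left_id sr_one sr_mul.
Proof. by move=> f; apply/ffunP=> M; rewrite sr_mul_cstl mul1r. Qed.

Fact sr_mulr1 : right_id sr_one sr_mul.
Proof. by move=> f; apply/ffunP=> M; rewrite sr_mul_cstr mulr1. Qed.

Fact sr_mulDl : left_distributive sr_mul +%R.
Proof.
move=> f g h; apply/ffunP=> M; rewrite !ffunE -big_split /=.
by apply: eq_bigr => X _; rewrite ffunE mulrDl.
Qed.

Fact sr_mulDr : right_distributive sr_mul +%R.
Proof.
move=> f g h; apply/ffunP=> M; rewrite !ffunE -big_split /=.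
by apply: eq_bigr => X _; rewrite ffunE mulrDr.
Qed.

HB.instance Definition _ := GRing.Zmodule_isPzRing.Build (setring I R)
  sr_mulA sr_mul1r sr_mulr1 sr_mulDl sr_mulDr.

Lemma setring1E M : (1 : setring I R) M = if M == set0 then 1 else 0.
Proof. by rewrite ffunE. Qed.

Lemma setringM f g M : (f * g) M = \sum_(X : {set I} | X \subset M) f X * g (M :\: X).
Proof. by rewrite ffunE. Qed.

Lemma cstMl r f M : (sr_cst r * f) M = r * f M.
Proof. exact: sr_mul_cstl. Qed.

Lemma cstMr r f M : (f * sr_cst r) M = f M * r.
Proof. exact: sr_mul_cstr. Qed.

Lemma cstM r s : sr_cst (r * s) = sr_cst r * sr_cst s.
Proof. by apply/ffunP=> M; rewrite cstMl !ffunE; case: eqP; rewrite ?mulr0. Qed.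

Lemma cstB r s : sr_cst (r - s) = sr_cst r - sr_cst s.
Proof. by apply/ffunP=> M; rewrite !ffunE; case: eqP; rewrite ?subr0. Qed.

HB.instance Definition _ := GRing.isZmodMorphism.Build R (setring I R) sr_cst cstB.

Definition sr_var b : setring I R := [ffun M : {set I} => if M == [set b] then 1 else 0].

Lemma varMl b f M : (sr_var b * f) M = if b \in M then f (M :\ b) else 0.
Proof.
rewrite setringM; case: ifP => bM.
  rewrite (bigD1 [set b]) ?sub1set //= ffunE eqxx mul1r big1 ?addr0 // => X.
  by case/andP=> _ /negPf nX; rewrite ffunE nX mul0r.
rewrite big1 // => X XM; rewrite ffunE; case: eqP => [eqX|_]; last by rewrite mul0r.
by rewrite eqX sub1set bM in XM.
Qed.

Lemma varMr b f M : (f * sr_var b) M = if b \in M then f (M :\ b) else 0.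
Proof.
rewrite setringM; case: ifP => bM.
  rewrite (bigD1 (M :\ b)) ?subD1set //= ffunE setDDr setDv set0U.
  rewrite (setIidPr _) ?sub1set // eqxx mulr1 big1 ?addr0 // => X.
  case/andP=> XM nX; rewrite ffunE; case: eqP => [eqX|_]; last by rewrite mulr0.
  by case/eqP: nX; rewrite -eqX setDDr setDv set0U (setIidPr _).
rewrite big1 // => X XM; rewrite ffunE; case: eqP => [eqX|_]; last by rewrite mulr0.
by have := subsetDl M X; rewrite eqX sub1set bM.
Qed.

Lemma varC b f : f * sr_var b = sr_var b * f.
Proof. by apply/ffunP=> M; rewrite varMl varMr. Qed.

Lemma var_sq b : sr_var b * sr_var b = 0.
Proof.
apply/ffunP=> M; rewrite varMl !ffunE; case: ifP => // bM; case: eqP => // eqM.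
by have := set11 b; rewrite -eqM !inE eqxx.
Qed.

End SetRing.

(** This makes the decision procedure for noncommutative rings available. *)
#[local] Instance pzring_ops (R : pzRingType) :
  @Ring_ops R 0 1 +%R *%R (fun x y => x - y) -%R eq := {}.

#[local] Instance pzring_ring (R : pzRingType) : Ring (Ro := pzring_ops R).
Proof.
split; first exact: eq_equivalence.
- by move=> ? ? -> ? ? ->.
- by move=> ? ? -> ? ? ->.
- by move=> ? ? -> ? ? ->.
- by move=> ? ? ->.
- exact: add0r.
- exact: addrC.
- exact: addrA.
- exact: mul1r.
- exact: mulr1.
- exact: mulrA.
- exact: mulrDl.
- by move=> *; exact: mulrDr.
- by [].
- exact: subrr.
Qed.

(** * Star sums and Dunkl elements commute *)

Record fk_relations (I : finType) (R : pzRingType) (T : I -> I -> R) : Prop := FkRelations {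
  fk_diag : forall x, T x x = 0;
  fk_anti : forall x y, T y x = - T x y;
  fk_comm : forall x y z w, x != z -> x != w -> y != z -> y != w ->
    GRing.comm (T x y) (T z w);
  fk_tri : forall x y z, x != y -> y != z -> x != z ->
    T x y * T y z + T y z * T z x + T z x * T x y = 0;
  fk_sq : forall x y z w, GRing.comm (T x y * T x y) (T z w)
}.

(** The sum of T a b_1 * ... * T a b_r over all sequences of distinct elements
    b_1, ..., b_r of [S], see [star_sum_words]. *)
Fixpoint star_sum (I : finType) (R : pzRingType) (T : I -> I -> R) (a : I)
    (S : {set I}) (r : nat) : R :=
  if r is r'.+1 then \sum_(b in S) T a b * star_sum T a (S :\ b) r' else 1.

Section FK.
Variables (I : finType) (R : pzRingType) (T : I -> I -> R).
Hypothesis fkT : fk_relations T.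
Variable a : I.
Implicit Types (S M : {set I}) (b l : I).

Local Notation e := (@sr_var I R).
Local Notation t x y := (sr_cst I (T x y)).
Local Notation SR := (setring I R).

Definition letters S : SR := \sum_(b in S) e b * t a b.
(** The generating function of all words in the letters [T a b] without
    repetitions: the inverse of [1 - letters S], a finite geometric series
    since [letters S] is nilpotent.  Locking keeps the series folded under
    simplification. *)
Definition words_of S : SR := locked (\sum_(i < #|I|.+1) letters S ^+ i).

Lemma words_ofE S : words_of S = \sum_(i < #|I|.+1) letters S ^+ i.
Proof. by rewrite /words_of -lock. Qed.

Lemma letters_pow_support S i M : (letters S ^+ i) M != 0 -> (#|M| == i) && (M \subset S).
Proof.
elim: i M => [|i IH] M.
  by rewrite expr0 setring1E; have [->|_] := eqVneq M set0; rewrite ?cards0 ?sub0set ?eqxx.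
apply: contraR => H; rewrite exprS mulr_suml sum_ffunE big1 // => b bS.
rewrite -mulrA varMl; case: ifP => // bM; rewrite cstMl.
have [->|/IH/andP[/eqP cM MS]] := eqVneq ((letters S ^+ i) (M :\ b)) 0; first by rewrite mulr0.
case/negP: H; rewrite (cardsD1 b) bM cM eqxx /= -(setD1K bM) subUset sub1set bS /=.
exact: MS.
Qed.

Lemma words_of_support S M : ~~ (M \subset S) -> words_of S M = 0.
Proof.
move=> nMS; rewrite words_ofE sum_ffunE big1 // => i _; apply/eqP; apply: contraNT nMS.
by move/letters_pow_support/andP=> [].
Qed.

Lemma words_ofr S : (1 - letters S) * words_of S = 1.
Proof.
have := subrX1 (letters S) #|I|.+1.
have -> : letters S ^+ #|I|.+1 = 0.
  apply/ffunP=> M; rewrite [RHS]ffunE; apply/eqP; apply/negPn/negP.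
  move/letters_pow_support/andP=> [/eqP cM _].
  by have := max_card (mem M); rewrite cM ltnn.
rewrite sub0r -words_ofE => eq1.
by rewrite -opprB mulNr -eq1 opprK.
Qed.

Lemma words_of_comm S (x : SR) : GRing.comm x (letters S) -> GRing.comm x (words_of S).
Proof. by move=> cx; rewrite words_ofE; apply: commr_sum => i _; apply: commrX. Qed.

Lemma words_ofl S : words_of S * (1 - letters S) = 1.
Proof.
rewrite -[RHS](words_ofr S); apply/esym; rewrite -/(GRing.comm _ _).
apply: words_of_comm; apply/commr_sym/commrB; first exact: commr1.
exact: commr_refl.
Qed.

Lemma words_of_recl S : words_of S = 1 + letters S * words_of S.
Proof. by rewrite -{1}(words_ofr S) mulrBl mul1r subrK. Qed.

Lemma words_of_recr S : words_of S = 1 + words_of S * letters S.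
Proof. by rewrite -{1}(words_ofl S) mulrBr mulr1 subrK. Qed.

Lemma words_of_uniq S (g : SR) : (1 - letters S) * g = 1 -> words_of S = g.
Proof. by move=> h; rewrite -[LHS]mulr1 -h mulrA words_ofl mul1r. Qed.

(** A letter marked by the variable [e y] can occur only once in a word. *)
Lemma var_dup y (f g : SR) : e y * f * (e y * g) = 0.
Proof. by rewrite mulrA -(mulrA (e y)) varC mulrA var_sq !mul0r. Qed.

(** A word either avoids [y] or is cut in two by its only letter [y]. *)
Lemma words_ofD1 S y : y \in S ->
  words_of S = words_of (S :\ y)
             + e y * (words_of (S :\ y) * t a y * words_of (S :\ y)).
Proof.
move=> yS; apply: words_of_uniq; set G := words_of (S :\ y).
have -> : letters S = e y * t a y + letters (S :\ y).
  by rewrite /letters (big_setD1 y).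
have h : (1 - letters (S :\ y)) * G = 1 := words_ofr _.
have -> : 1 - (e y * t a y + letters (S :\ y)) = (1 - letters (S :\ y)) - e y * t a y.
  by rewrite opprD addrA addrAC.
have h' : (1 - letters (S :\ y)) * (e y * (G * t a y * G)) = e y * (t a y * G).
  by rewrite (mulrA _ (e y)) varC -(mulrA (e y)); congr (_ * _); rewrite !mulrA h mul1r.
by rewrite mulrBl !mulrDr h h' var_dup addr0 !mulrA addrK.
Qed.

Lemma var_words_of S y : y \in S -> e y * words_of S = e y * words_of (S :\ y).
Proof. by move=> yS; rewrite {1}(words_ofD1 yS) mulrDr mulrA var_sq mul0r addr0. Qed.

Lemma cst_comm x y z w : x != z -> x != w -> y != z -> y != w -> GRing.comm (t x y) (t z w).
Proof. by move=> *; rewrite /GRing.comm -!cstM (fk_comm fkT). Qed.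

(** The operator [T x y] commutes with all letters that it shares no index
    with. *)
Lemma cst_words_of S x y : x != a -> y != a -> x \notin S -> y \notin S ->
  GRing.comm (t x y) (words_of S).
Proof.
move=> xa ya xS yS; apply/words_of_comm/commr_sum => b bS; apply: commrM.
  exact: varC.
apply: cst_comm => //; [apply: contraNneq xS => -> //|apply: contraNneq yS => -> //].
Qed.

Lemma fk_swap x y : x != a -> y != a -> x != y ->
  T a x * T a y = T a y * T y x - T y x * T a x.
Proof.
move=> xa ya xy; have := fk_tri fkT (x := a) (y := y) (z := x).
rewrite (fk_anti fkT a x) !(mulrN, mulNr) => h.
apply/esym/eqP; rewrite -subr_eq0; apply/eqP; apply: h; by rewrite eq_sym.
Qed.

Lemma cst_swap x y : x != a -> y != a -> x != y ->
  t a x * t a y = t a y * t y x - t y x * t a x.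
Proof. by move=> xa ya xy; rewrite -!cstM -cstB fk_swap. Qed.

(** Congruence under multiplication by a central element; it is used with
    products of variables, which kill the words containing given letters. *)
Lemma central_congr (w f g p q : SR) : (forall h, h * w = w * h) ->
  w * f = w * g -> w * (p * f * q) = w * (p * g * q).
Proof.
by move=> wC wfg; rewrite !mulrA -!wC -!(mulrA p) wfg.
Qed.

Lemma var_exchange S (F : I -> I -> SR) :
  \sum_(x in S) e x * (\sum_(b in S) e b * F x b)
  = \sum_(b in S) e b * (\sum_(x in S) e x * F x b).
Proof.
under eq_bigr do rewrite mulr_sumr.
rewrite exchange_big; apply: eq_bigr => b _; rewrite mulr_sumr.
by apply: eq_bigr => x _; rewrite !mulrA varC.
Qed.

Section Kappa.
Variables (l : I).
Hypothesis la : l != a.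

Local Notation S1 := ([set~ a] :\ l).
Local Notation G1 := (words_of S1).

(** Together with [loop_total] this generates the words that begin and end with
    the same letter: [loop_sum y] is the part of [loop_total] in which [y] is
    used, see [loop_total_part]. *)
Definition loop_sum z : SR := t a z * G1 * t a z
  + \sum_(b in S1) e b * (t a b * G1 * t a z * G1 * t a b).

Lemma loop_sum_expand y :
  loop_sum y = t a y * t a y + \sum_(x in S1) e x * (t a y * G1 * (t a x * t a y)
    + t a x * t a y * G1 * t a x
    + \sum_(b in S1) e b * (t a b * G1 * (t a x * t a y) * G1 * t a b)).
Proof.
have GE (f : SR) : G1 * f = f + \sum_(x in S1) e x * (G1 * (t a x * f)).
  rewrite {1}words_of_recr mulrDl mul1r /letters mulr_sumr mulr_suml; congr (_ + _).
  by apply: eq_bigr => x _; rewrite !mulrA varC.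
rewrite /loop_sum -mulrA GE mulrDr -!addrA; congr (_ + _).
rewrite mulr_sumr.
transitivity (\sum_(x in S1) e x * (t a y * G1 * (t a x * t a y))
  + (\sum_(x in S1) e x * (t a x * t a y * G1 * t a x)
  + \sum_(x in S1) e x * \sum_(b in S1) e b * (t a b * G1 * (t a x * t a y) * G1 * t a b))).
  congr (_ + _).
    by apply: eq_bigr => x _; rewrite !mulrA varC.
  rewrite var_exchange -big_split /=; apply: eq_bigr => b _.
  rewrite -mulrDr; congr (_ * _).
  rewrite -!mulrA GE !mulrDr !mulrA; congr (_ + _).
  rewrite !mulr_sumr; apply: eq_bigr => x _.
  by rewrite -!mulrA (mulrA _ (e x)) varC -!mulrA.
by rewrite -!big_split /=; apply: eq_bigr => x _; rewrite !mulrDr !addrA.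
Qed.

Lemma var2_words_of S x y : x \in S -> y \in S -> x != y ->
  e x * e y * words_of S = e x * e y * words_of (S :\ x :\ y).
Proof.
move=> xS yS xy; rewrite -{1}(varC x (e y)) -mulrA var_words_of // mulrA.
by rewrite varC -[RHS]mulrA -mulrA var_words_of // 2!inE eq_sym xy.
Qed.

(** The relation between [T a x], [T a y] and [T y x] moves the letter next to
    the middle one outwards; everything else cancels, so that [loop_sum y] is
    expressed by squares and by the twisted commutators of [T y x] with loop sums
    in one letter less. *)
Lemma loop_sum_rec y : y \in S1 ->
  e y * loop_sum y = e y * (t a y * t a y
    + \sum_(x in S1 :\ y) e x * (loop_sum y * t y x - t y x * loop_sum x)).
Proof.
move=> yS; rewrite [X in e y * X = _]loop_sum_expand [LHS]mulrDr [RHS]mulrDr; congr (_ + _).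
rewrite (big_setD1 y) //= mulrDr mulrA var_sq mul0r add0r !mulr_sumr.
apply: eq_bigr => x; rewrite 2!inE => /andP[xy xS].
have [xl xa] : x != l /\ x != a by move: xS; rewrite !inE => /andP[].
have [yl ya] : y != l /\ y != a by move: yS; rewrite !inE => /andP[].
set w := e y * e x; rewrite !(mulrA (e y)) -/w.
have wC h : h * w = w * h by rewrite /w mulrA (varC y h) -mulrA (varC x h) mulrA.
set s := t y x.
have wG3 : w * G1 = w * words_of (S1 :\ y :\ x) by rewrite var2_words_of // eq_sym.
have wG : w * (G1 * s) = w * (s * G1).
  rewrite mulrA wG3 -mulrA -(cst_words_of (S := S1 :\ y :\ x)) //; last 2 first.
  - by rewrite !inE eqxx ?andbF.
  - by rewrite !inE eqxx ?andbF.
  by rewrite mulrA -wC -mulrA -wG3 mulrA wC mulrA.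
have swap := cst_swap xa ya xy; rewrite -/s in swap.
have congr p q := central_congr p q wC wG.
have E1 : w * (t a y * G1 * (t a x * t a y))
        = w * (t a y * G1 * t a y * s) - w * (t a y * s * G1 * t a x).
  rewrite swap !mulrBr; congr (_ - _); first by rewrite !mulrA.
  by have := congr (t a y) (t a x); rewrite !mulrA.
have E2 : w * (t a x * t a y * G1 * t a x)
        = w * (t a y * s * G1 * t a x) - w * (s * t a x * G1 * t a x).
  by rewrite swap !mulrBl mulrBr.
have E3 b : b \in S1 -> w * (e b * (t a b * G1 * (t a x * t a y) * G1 * t a b))
   = w * (e b * (t a b * G1 * t a y * G1 * t a b) * s)
   - w * (s * (e b * (t a b * G1 * t a x * G1 * t a b))).
  move=> bS; have [wb0|wb0] := eqVneq (w * e b) 0.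
    by rewrite (mulrA s) (varC b s) -(mulrA (e b) s) !mulrA wb0 !mul0r subrr.
  have [bx|bx] := eqVneq b x; first by rewrite bx /w -mulrA var_sq mulr0 eqxx in wb0.
  have [by_|by_] := eqVneq b y.
    by rewrite by_ /w varC mulrA var_sq mul0r eqxx in wb0.
  have [bl ba] : b != l /\ b != a by move: bS; rewrite !inE => /andP[].
  have sb : s * t a b = t a b * s.
    by apply: cst_comm; rewrite // eq_sym.
  rewrite swap mulrBr !mulrBl !mulrBr; congr (_ - _).
    have -> : e b * (t a b * G1 * t a y * G1 * t a b) * s
            = (e b * (t a b * G1 * t a y)) * (G1 * s) * t a b.
      by rewrite -!mulrA -sb.
    by rewrite congr !mulrA.
  have -> : e b * (t a b * G1 * (s * t a x) * G1 * t a b)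
            = (e b * t a b) * (G1 * s) * (t a x * G1 * t a b).
    by rewrite -!mulrA.
  by rewrite congr !mulrA -(mulrA w s) (varC b s) -(mulrA _ (t a b) s) -sb !mulrA.
have E4 : w * (loop_sum y * s) = w * (t a y * G1 * t a y * s)
    + \sum_(b in S1) w * (e b * (t a b * G1 * t a y * G1 * t a b) * s).
  by rewrite /loop_sum mulrDl mulrDr mulr_suml mulr_sumr.
have E5 : w * (s * loop_sum x) = w * (s * t a x * G1 * t a x)
    + \sum_(b in S1) w * (s * (e b * (t a b * G1 * t a x * G1 * t a b))).
  by rewrite /loop_sum mulrDr mulrDr mulr_sumr mulr_sumr !mulrA.
rewrite [LHS]mulrDr [w * (_ + _)]mulrDr E1 E2 mulr_sumr (eq_bigr _ E3) sumrB.
rewrite [RHS]mulrBr E4 E5 [X in X + _]addrA subrK.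
by rewrite addrACA -opprD.
Qed.

(** By induction on the number of letters: in the recursion, squares are central
    and [T y x] shares no index with [T a l]. *)
Lemma loop_sum_comm y M : y \in S1 -> y \notin M -> GRing.comm (T a l) (loop_sum y M).
Proof.
have [m] := ubnP #|M|; elim: m => // m IH in M y *; rewrite ltnS => cM yS yM.
have [yl ya] : y != l /\ y != a by move: yS; rewrite !inE => /andP[].
have -> : loop_sum y M = (e y * loop_sum y) (y |: M).
  by rewrite varMl setU11 setU1K.
rewrite loop_sum_rec // varMl setU11 setU1K //.
rewrite -cstM ffunE; apply: commrD.
  rewrite ffunE; case: ifP => _; last exact: commr0.
  exact/commr_sym/(fk_sq fkT).
rewrite sum_ffunE; apply: commr_sum => x; rewrite !inE => /and3P[xy xl xa].
rewrite varMl; case: ifP => xM; last exact: commr0.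
have cyx : GRing.comm (T a l) (T y x).
  by apply: (fk_comm fkT); rewrite // eq_sym.
have lt_m : (#|M :\ x| < m)%N by move: cM; rewrite (cardsD1 x) xM.
rewrite ffunE cstMr [X in _ + X]ffunE cstMl; apply: commrB; apply: commrM => //.
  by apply: IH; rewrite // inE negb_and yM orbT.
by apply: IH; rewrite // !inE ?eqxx // xl.
Qed.

Definition loop_total : SR := \sum_(b in S1) e b * (t a b * G1 * t a b).

Lemma loop_total_part y M : y \in S1 -> y \in M -> loop_total M = loop_sum y (M :\ y).
Proof.
move=> yS yM; pose G2 := words_of (S1 :\ y).
have -> : loop_total = e y * loop_sum y
    + \sum_(b in S1 :\ y) e b * (t a b * G2 * t a b).
  rewrite /loop_total (big_setD1 y) //= /loop_sum mulrDr -addrA; congr (_ + _).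
  rewrite [X in e y * X](big_setD1 y) //= mulrDr mulrA var_sq mul0r add0r mulr_sumr -big_split /=.
  apply: eq_bigr => b _; rewrite (words_ofD1 yS) -/G2.
  rewrite [in LHS]mulrDr [in LHS]mulrDl mulrDr addrC; congr (_ + _).
  rewrite -(words_ofD1 yS).
  have -> : e b * (t a b * (e y * (G2 * t a y * G2)) * t a b)
     = e b * (t a b * (e y * G2) * t a y * G2 * t a b) by rewrite !mulrA.
  have -> : e y * (e b * (t a b * G1 * t a y * G1 * t a b))
     = e b * (t a b * (e y * G1) * t a y * G1 * t a b).
    by rewrite !mulrA -(varC y (e b)) -!mulrA !(mulrA _ (e y)) (varC y (t a b)) -!mulrA.
  rewrite (var_words_of yS) -/G2.
  have Q X : t a b * (e y * G2) * t a y * X = t a b * G2 * t a y * (e y * X).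
    by rewrite -(varC y G2) -!mulrA (mulrA (e y)) -(varC y (t a y)) -!mulrA.
  by rewrite !Q (var_words_of yS).
rewrite ffunE varMl yM sum_ffunE big1 ?addr0 // => b; rewrite in_setD1 => /andP[bey _].
rewrite varMl; case: ifP => // bM; rewrite -mulrA cstMl cstMr.
rewrite words_of_support ?mul0r ?mulr0 //; apply/subsetPn; exists y.
  by rewrite in_setD1 eq_sym bey.
by rewrite !inE eqxx.
Qed.

Lemma loop_total_comm : GRing.comm (t a l) loop_total.
Proof.
apply/ffunP=> M; rewrite cstMl cstMr -/(GRing.comm _ _).
have [y /setIP[yS yM]|nS] := pickP (mem (S1 :&: M)).
  rewrite (loop_total_part yS yM); apply: loop_sum_comm => //.
  by rewrite !inE eqxx.
rewrite sum_ffunE big1 => [|b bS]; first exact: commr0.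
rewrite varMl; case: ifP => // bM.
by have := nS b; rewrite /= inE bS bM.
Qed.

Lemma var_congrM b (f f' g g' : SR) : e b * f = e b * f' -> e b * g = e b * g' ->
  e b * (f * g) = e b * (f' * g').
Proof.
by move=> ff gg; rewrite mulrA ff -(varC b f') -mulrA gg mulrA varC mulrA.
Qed.

Lemma var_congrB b (f f' g g' : SR) : e b * f = e b * f' -> e b * g = e b * g' ->
  e b * (f - g) = e b * (f' - g').
Proof. by move=> ff gg; rewrite !mulrBr ff gg. Qed.

Lemma var_congrD b (f f' g g' : SR) : e b * f = e b * f' -> e b * g = e b * g' ->
  e b * (f + g) = e b * (f' + g').
Proof. by move=> ff gg; rewrite !mulrDr ff gg. Qed.

Local Notation theta := (\sum_m T l m).
Local Notation S := [set~ a].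
Local Notation G := (words_of S).
Local Notation d b := (t l b * t a l - t a l * t l b).

Lemma lS : l \in S. Proof. by rewrite !inE. Qed.

Lemma S1P b : b \in S1 -> b != l /\ b != a.
Proof. by rewrite !inE => /andP[]. Qed.

Lemma fk_link b : b \in S1 ->
  T l b * T a l = T a l * T a b + T a b * T l b /\
  T a l * T l b = T a b * T a l + T l b * T a b.
Proof.
move=> /S1P[bl ba].
have e1 := fk_tri fkT la (y := a) (z := b).
have e2 := fk_tri fkT ba (y := a) (z := l).
rewrite eq_sym ba eq_sym bl in e1; rewrite eq_sym la bl in e2.
have {}e1 := e1 isT isT; have {}e2 := e2 isT isT.
rewrite (fk_anti fkT a l) (fk_anti fkT l b) in e1.
rewrite (fk_anti fkT a b) in e2.
split; apply/eqP; rewrite -subr_eq0; apply/eqP.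
  rewrite -[RHS]e1; non_commutative_ring.
rewrite -[RHS]e2; non_commutative_ring.
Qed.

Lemma theta_commutator b : b \in S1 ->
  theta * T a b - T a b * theta = - (T l b * T a l - T a l * T l b).
Proof.
move=> bS; have [bl ba] := S1P bS; have [e1 e2] := fk_link bS.
rewrite (bigD1 a) //= (bigD1 b) //=; set X := \sum_(i | _) _.
rewrite !mulrDl !mulrDr e1 e2 (fk_anti fkT a l).
have -> : X * T a b = T a b * X.
  apply/esym/commr_sum => m /andP[ma mb].
  by apply: (fk_comm fkT); rewrite // eq_sym.
non_commutative_ring.
Qed.

Lemma theta_commutator_self :
  theta * T a l - T a l * theta = \sum_(b in S1) (T l b * T a l - T a l * T l b).
Proof.
rewrite (bigD1 a) //= (bigD1 l) //= (fk_diag fkT) add0r sumrB.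
rewrite (eq_bigl (fun b => b \in S1)) => [|b]; last by rewrite !inE andbC.
rewrite -mulr_suml -mulr_sumr (fk_anti fkT a l); set X := \sum_(i in _) _.
non_commutative_ring.
Qed.

(** A Dunkl element fails to commute with the letters only by terms with a factor
    [e l - e b].  The two variables contribute equally in each degree, so such a
    term vanishes once its other factors involve neither of them. *)
Lemma letters_commutator :
  sr_cst I theta * letters S - letters S * sr_cst I theta
  = \sum_(b in S1) (e l - e b) * d b.
Proof.
rewrite /letters (big_setD1 l lS) /= mulrDr mulrDl opprD addrACA.
have E b : sr_cst I theta * (e b * t a b) - e b * t a b * sr_cst I theta
  = e b * sr_cst I (theta * T a b - T a b * theta).
  by rewrite mulrA varC -!mulrA -mulrBr cstB !cstM.
rewrite E theta_commutator_self mulr_sumr mulr_suml -sumrB.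
under [X in _ + X]eq_bigr => b bS do rewrite E theta_commutator // raddfN mulrN.
rewrite raddf_sum mulr_sumr -big_split; apply: eq_bigr => b _ /=.
by rewrite cstB !cstM mulrBl.
Qed.

(** The derivation [f * _ - _ * f] applied to an inverse. *)
Lemma words_commutator (f : SR) :
  f * G - G * f = G * (f * letters S - letters S * f) * G.
Proof.
have h1 := words_ofl S; have h2 := words_ofr S.
have e1 : f * G = G * (1 - letters S) * f * G by rewrite h1 mul1r.
have e2 : G * f = G * f * ((1 - letters S) * G) by rewrite h2 mulr1.
rewrite e1 e2; non_commutative_ring.
Qed.

Lemma square_zero_expand b (H P f : SR) :
  (H + e b * P) * f * (H + e b * P) = H * f * H + e b * (P * f * H + H * f * P).
Proof.
have h1 : H * f * (e b * P) = e b * (H * f * P) by rewrite mulrA varC -mulrA.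
have h2 : e b * (P * f) * (e b * P) = 0 := var_dup b _ _.
transitivity (H * f * H + H * f * (e b * P) + e b * P * f * H + e b * (P * f) * (e b * P)).
  non_commutative_ring.
rewrite h1 h2; non_commutative_ring.
Qed.

(** The variable [e l] removes the letter [l] from the words, [e b] the letter
    [b], so that all words can be taken without [l] and [b] up to a correction
    marked by both variables. *)
Lemma words_square_expand b (f : SR) : b \in S1 ->
  let H := words_of (S1 :\ b) in
  (e l - e b) * (G * f * G) = (e l - e b) * (H * f * H)
    + e l * (e b * (H * (t a b * H * f + f * H * t a b
                         - t a l * H * f - f * H * t a l) * H)).
Proof.
move=> bS H; have [bl ba] := S1P bS.
have E1 : e l * (G * f * G) = e l * (G1 * f * G1).
  by apply: var_congrM; [apply: var_congrM|]; rewrite ?(var_words_of lS).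
have bS' : b \in S by rewrite !inE.
have E2 : e b * (G * f * G) = e b * (words_of (S :\ b) * f * words_of (S :\ b)).
  by apply: var_congrM; [apply: var_congrM|]; rewrite ?(var_words_of bS').
have lS' : l \in S :\ b by rewrite !inE eq_sym bl.
rewrite !mulrBl E1 E2 (words_ofD1 bS) (words_ofD1 lS').
have -> : S :\ b :\ l = S1 :\ b by apply/setP=> x; rewrite !inE andbCA.
rewrite !square_zero_expand -/H; set P := t a b; set Q := t a l.
have swap X : e b * (e l * X) = e l * (e b * X) by rewrite mulrA -(varC b) -mulrA.
rewrite [e l * (H * f * H + _)]mulrDr [e b * (H * f * H + _)]mulrDr swap opprD addrACA.
congr (_ + _).
rewrite -!mulrBr; congr (_ * (_ * _)); non_commutative_ring.
Qed.

Lemma link_identity b : b \in S1 ->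
  let H := words_of (S1 :\ b) in
  t a b * H * d b + d b * H * t a b - t a l * H * d b - d b * H * t a l
  = t a l * (t a b * H * t a b) - t a b * H * t a b * t a l
    + t a l * (H * t a b - t a b * H) * t a l.
Proof.
move=> bS H; have [bl ba] := S1P bS.
have LH : t l b * H = H * t l b.
  by apply: cst_words_of; rewrite // !inE ?eqxx ?andbF.
have [e1 e2] := fk_link bS.
have {}e1 : t l b * t a l = t a l * t a b + t a b * t l b.
  by rewrite -!cstM e1 raddfD.
have {}e2 : t a l * t l b = t a b * t a l + t l b * t a b.
  by rewrite -!cstM e2 raddfD.
set L := t l b in LH e1 e2 *; set q := t a l in e1 e2 *; set m := t a b in e1 e2 *.
have f1 : m * H * (L * q) = L * q * H * q - q * m * H * q.
  rewrite mulrA -(mulrA m H L) -LH e1; non_commutative_ring.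
have f2 : m * H * (q * L) = m * H * m * q + m * L * H * m.
  by rewrite e2 mulrDr !mulrA -(mulrA m H L) -LH !mulrA.
have f3 : q * H * (q * L) = q * H * m * q + q * L * H * m.
  transitivity (q * H * (m * q + L * m)); first by rewrite -e2.
  by rewrite mulrDr !mulrA -(mulrA q H L) -LH !mulrA.
have f4 : q * H * (L * q) = q * L * H * q by rewrite mulrA -(mulrA q H L) -LH !mulrA.
have f5 : L * q * H * m = q * m * H * m + m * L * H * m by rewrite e1 !mulrDl.
transitivity (m * H * (L * q) - m * H * (q * L) + (L * q * H * m - q * L * H * m)
  - (q * H * (L * q) - q * H * (q * L)) - (L * q * H * q - q * L * H * q)).
  non_commutative_ring.
rewrite f1 f2 f3 f4 f5; non_commutative_ring.
Qed.

Lemma varsum_l S0 (f : SR) F :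
  f * (\sum_(b in S0) e b * F b) = \sum_(b in S0) e b * (f * F b).
Proof. by rewrite mulr_sumr; apply: eq_bigr => b _; rewrite mulrA varC -mulrA. Qed.

Lemma varsum_r S0 (f : SR) F :
  (\sum_(b in S0) e b * F b) * f = \sum_(b in S0) e b * (F b * f).
Proof. by rewrite mulr_suml; apply: eq_bigr => b _; rewrite mulrA. Qed.

Lemma varsumB S0 (F F' : I -> SR) : \sum_(b in S0) e b * F b - \sum_(b in S0) e b * F' b
  = \sum_(b in S0) e b * (F b - F' b).
Proof. by rewrite -sumrB; apply: eq_bigr => b _; rewrite mulrBr. Qed.

Lemma varsumD S0 (F F' : I -> SR) : \sum_(b in S0) e b * F b + \sum_(b in S0) e b * F' b
  = \sum_(b in S0) e b * (F b + F' b).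
Proof. by rewrite -big_split; apply: eq_bigr => b _; rewrite mulrDr. Qed.

(** After summation over [b], the corrections of [words_square_expand] become a
    commutator of [T a l] with [loop_total] and a commutator of the words with
    their own letters.  Both vanish. *)
Lemma link_sum : \sum_(b in S1) (e l - e b) * (G * d b * G)
  = \sum_(b in S1) (e l - e b) * (words_of (S1 :\ b) * d b * words_of (S1 :\ b)).
Proof.
apply/eqP; rewrite -subr_eq0 -sumrB; apply/eqP.
pose m b := t a b; pose q := t a l.
transitivity (\sum_(b in S1) e l * (e b * (G1 * (q * (m b * G1 * m b)
  - m b * G1 * m b * q + q * (G1 * m b - m b * G1) * q) * G1))).
  apply: eq_bigr => b bS; rewrite words_square_expand // addrC addKr link_identity //.
  congr (_ * _); have E := esym (var_words_of bS).
  have MHM := var_congrM (var_congrM (erefl (e b * m b)) E) (erefl (e b * m b)).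
  have comm_part := var_congrB (var_congrM E (erefl (e b * m b)))
                               (var_congrM (erefl (e b * m b)) E).
  apply: (var_congrM _ E); apply: (var_congrM E); apply: var_congrD.
    by apply: var_congrB; apply: var_congrM.
  by apply: var_congrM => //; apply: var_congrM.
have -> : \sum_(b in S1) e l * (e b * (G1 * (q * (m b * G1 * m b)
  - m b * G1 * m b * q + q * (G1 * m b - m b * G1) * q) * G1))
  = e l * (G1 * (q * loop_total - loop_total * q
     + q * (G1 * letters S1 - letters S1 * G1) * q) * G1).
  rewrite -mulr_sumr; congr (_ * _).
  rewrite /loop_total /letters !(varsum_l, varsum_r) !varsumB !(varsum_l, varsum_r).
  by rewrite varsumD !(varsum_l, varsum_r).
rewrite (loop_total_comm : q * _ = _) subrr add0r.
have -> : G1 * letters S1 = letters S1 * G1.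
  by apply/commr_sym/words_of_comm/commr_refl.
by rewrite subrr mulr0 mul0r mulr0 mul0r mulr0.
Qed.

End Kappa.

(** The functions in which the variable of [b] does not occur. *)
Definition off b (f : SR) := forall M, b \in M -> f M = 0.

Lemma offM b f g : off b f -> off b g -> off b (f * g).
Proof.
move=> of_ og M bM; rewrite setringM big1 // => X XM.
have [bX|bX] := boolP (b \in X); first by rewrite of_ ?mul0r.
by rewrite og ?mulr0 // inE bX.
Qed.

Lemma offB b f g : off b f -> off b g -> off b (f - g).
Proof. by move=> of_ og M bM; rewrite ffunE [X in _ + X]ffunE of_ ?og ?subr0. Qed.

Lemma off_cst b r : off b (sr_cst I r).
Proof. by move=> M bM; rewrite ffunE; case: eqP => // eM; rewrite eM inE in bM. Qed.

Lemma off_words b S : b \notin S -> off b (words_of S).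
Proof.
by move=> bS M bM; apply: words_of_support; apply: contraNN bS => /subsetP; apply.
Qed.

(** The sum of all coefficients in degree [r]; unlike a single coefficient, it
    does not distinguish between the variables of [l] and [b], which is what
    the cancellation in [star_sum_comm] requires. *)
Definition degree_part r (f : SR) : R := \sum_(M : {set I} | #|M| == r) f M.

Lemma degree_partB r f g : degree_part r (f - g) = degree_part r f - degree_part r g.
Proof.
by rewrite /degree_part -sumrB; apply: eq_bigr => M _; rewrite ffunE [X in _ + X]ffunE.
Qed.

HB.instance Definition _ r :=
  GRing.isZmodMorphism.Build SR R (degree_part r) (degree_partB r).

Lemma degree_part_cstl r x f : degree_part r (sr_cst I x * f) = x * degree_part r f.
Proof. by rewrite mulr_sumr; apply: eq_bigr => M _; rewrite cstMl. Qed.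

Lemma degree_part_cstr r x f : degree_part r (f * sr_cst I x) = degree_part r f * x.
Proof. by rewrite mulr_suml; apply: eq_bigr => M _; rewrite cstMr. Qed.

Lemma degree_part_var r b f : off b f ->
  degree_part r (e b * f) = \sum_(M : {set I} | #|M|.+1 == r) f M.
Proof.
move=> of_; rewrite /degree_part (bigID (fun M : {set I} => b \in M)) /=.
rewrite [X in _ + X]big1 ?addr0 => [|M /andP[_ /negPf bM]]; last by rewrite varMl bM.
rewrite [RHS](bigID (fun M : {set I} => b \in M)) /=.
rewrite [X in _ = X + _]big1 ?add0r => [|M /andP[_ bM]]; last exact: of_.
rewrite (reindex_onto (fun M => b |: M) (fun M => M :\ b)) /=; last first.
  by move=> M /andP[_ bM]; rewrite setD1K.
apply: eq_big => M.
  rewrite setU11 andbT; have [bM|bM] := boolP (b \in M).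
    rewrite andbF; apply/negbTE; rewrite negb_and orbC.
    by apply/orP; left; apply: contraTneq bM => <-; rewrite !inE eqxx.
  by rewrite setU1K // eqxx !andbT cardsU1 bM.
move=> /andP[/andP[_ _] /eqP eM]; have bM : b \notin M by rewrite -eM !inE eqxx.
by rewrite varMl setU11 eM.
Qed.

Lemma star_sumE S r : star_sum T a S r = degree_part r (words_of S).
Proof.
elim: r S => [|r IH] S.
  rewrite /degree_part (big_pred1 set0) => [|M]; last by rewrite cards_eq0.
  rewrite words_of_recl ffunE setring1E eqxx mulr_suml sum_ffunE big1 ?addr0 // => b _.
  by rewrite -mulrA varMl inE.
rewrite words_of_recl raddfD /= [X in _ = X + _]big1 => [|M /eqP cM]; last first.
  by rewrite setring1E -cards_eq0 cM.
rewrite add0r mulr_suml raddf_sum; apply: eq_bigr => b bS.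
have offb : off b (t a b * words_of (S :\ b)).
  by apply: offM; [exact: off_cst | apply: off_words; rewrite !inE eqxx].
rewrite IH -degree_part_cstl.
transitivity (degree_part r.+1 (e b * (t a b * words_of (S :\ b)))).
  by rewrite degree_part_var.
rewrite /= -mulrA; congr degree_part.
by apply: var_congrM => //; rewrite (var_words_of bS).
Qed.

(** The commutator of the words with the Dunkl element is a sum of terms
    [(e l - e b) * F] in which [F] involves neither variable, by [link_sum].
    In each degree, the contributions of [e l] and of [e b] cancel. *)
Theorem star_sum_comm l r : l != a ->
  GRing.comm (\sum_m T l m) (star_sum T a [set~ a] r).
Proof.
move=> la; apply/eqP; rewrite -subr_eq0; apply/eqP.
rewrite star_sumE -degree_part_cstl -degree_part_cstr -raddfB /=.
rewrite words_commutator letters_commutator // mulr_sumr mulr_suml.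
have -> : \sum_(b in [set~ a] :\ l) words_of [set~ a] * ((e l - e b) *
     (t l b * t a l - t a l * t l b)) * words_of [set~ a]
  = \sum_(b in [set~ a] :\ l) (e l - e b) * (words_of [set~ a] *
     (t l b * t a l - t a l * t l b) * words_of [set~ a]).
  apply: eq_bigr => b _; set G := words_of _; set f := _ - t a l * _.
  have cG : G * (e l - e b) = (e l - e b) * G by rewrite mulrBr mulrBl !varC.
  by rewrite mulrA cG -!mulrA.
rewrite link_sum // raddf_sum big1 //= => b bS.
have [bl ba] : b != l /\ b != a by move: bS; rewrite !inE => /andP[].
set F := _ * _ * _; have offF c : (c == l) || (c == b) -> off c F.
  move=> cl; apply: offM; first apply: offM.
  - by apply: off_words; case/orP: cl => /eqP ->; rewrite !inE eqxx ?andbF.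
  - by apply: offB; apply: offM; apply: off_cst.
  - by apply: off_words; case/orP: cl => /eqP ->; rewrite !inE eqxx ?andbF.
rewrite mulrBl raddfB /= !degree_part_var ?subrr //; apply: offF.
  by rewrite eqxx orbT.
by rewrite eqxx.
Qed.

End FK.

(** * Covers of the quantum Bruhat order *)

Section Length.
Variable n : nat.
Implicit Types (u : 'S_n) (i j p q : 'I_n).

Lemma lenE u : (len u)%:Z = \sum_(p < n) \sum_(q < n) ((p < q)%N && (u q < u p)%N)%:Z.
Proof.
rewrite /len cardsE -sum1_card -natz natr_sum pair_big /= big_mkcond /=.
by apply: eq_bigr => -[p q] _ /=; rewrite unfold_in /=; case: ifP.
Qed.

(** Only pairs that contain [i] or [j] change.  Each position between [i] and
    [j] whose value lies between [u i] and [u j] creates two inversions. *)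
Lemma len_tperm u i j : (i < j)%N -> (u i < u j)%N ->
  len (tperm i j * u)%g
  = ((len u).+1 + 2 * #|[set p : 'I_n | (i < p < j)%N && (u i < u p < u j)%N]|)%N.
Proof.
move=> ij uij; set t := tperm i j; have tij : i != j by apply: contraTneq ij => ->; rewrite ltnn.
apply/eqP; rewrite -eqz_nat PoszD PoszM -addn1 PoszD !lenE.
have -> : \sum_(p < n) \sum_(q < n) ((p < q)%N && ((t * u)%g q < (t * u)%g p)%N)%:Z
  = \sum_(p < n) \sum_(q < n) ((t p < t q)%N && (u q < u p)%N)%:Z :> int.
  rewrite (reindex_inj (@perm_inj _ t)); apply: eq_bigr => p _.
  rewrite (reindex_inj (@perm_inj _ t)); apply: eq_bigr => q _.
  by rewrite !permM !tpermK.
pose c p q : int := ((t p < t q)%N && (u q < u p)%N)%:Z - ((p < q)%N && (u q < u p)%N)%:Z.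
have c0 p q : p != i -> p != j -> q != i -> q != j -> c p q = 0.
  by move=> pi pj qi qj; rewrite /c /t !tpermD 1?eq_sym // subrr.
have ci : c i i = 0 by rewrite /c !ltnn.
have cj : c j j = 0 by rewrite /c !ltnn.
have cij : c i j = 0 by rewrite /c /t tpermL tpermR; lia.
have cji : c j i = 1 by rewrite /c /t tpermL tpermR; lia.
have cp p : p != i -> p != j ->
  c i p + c p i + (c j p + c p j) = 2 * ((i < p < j)%N && (u i < u p < u j)%N)%:Z.
  move=> pi pj; rewrite /c /t tpermL tpermR !tpermD 1?eq_sym //.
  have : p != i :> nat by []. have : p != j :> nat by [].
  have : u p != u i :> nat by rewrite (inj_eq val_inj) (inj_eq perm_inj).
  have : u p != u j :> nat by rewrite (inj_eq val_inj) (inj_eq perm_inj).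
  lia.
set A := \sum_(p < n) _; set B := \sum_(p < n) _; set N := Posz #|_|.
have D : A - B = \sum_p \sum_q c p q.
  by rewrite /A /B -sumrB; apply: eq_bigr => p _; rewrite -sumrB.
suff S : \sum_p \sum_q c p q = 1 + 2 * N.
  by rewrite S in D; rewrite -[A](subrK B) D; apply/eqP; lia.
clear A B D; clearbody c.
have splitij (f : 'I_n -> int) :
  \sum_q f q = f i + (f j + \sum_(q | (q != i) && (q != j)) f q).
  have ji : j != i by rewrite eq_sym.
  by rewrite (bigD1 i isT) (bigD1 j ji).
rewrite !splitij ci cj cij cji.
have -> : \sum_(p | (p != i) && (p != j)) \sum_q c p q
   = \sum_(p | (p != i) && (p != j)) (c p i + c p j).
  apply: eq_bigr => p /andP[pi pj]; rewrite splitij big1 ?addr0 // => q /andP[qi qj].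
  exact: c0.
have -> : N = \sum_(p | (p != i) && (p != j)) ((i < p < j)%N && (u i < u p < u j)%N)%:Z.
  rewrite /N cardsE -sum1_card -natz natr_sum [LHS]big_mkcond [RHS]big_mkcond /=.
  apply: eq_bigr => p _; rewrite unfold_in /=.
  have [->|pi] := eqVneq p i; first by rewrite ltnn.
  by have [->|pj] := eqVneq p j; [rewrite ltnn andbF | case: ifP].
rewrite mulr_sumr [in RHS](eq_bigr (fun p => c i p + c p i + (c j p + c p j))).
  by rewrite !big_split /=; ring.
by move=> p /andP[pi pj] /=; rewrite cp.
Qed.

End Length.

(** Going around a circle from [x], one meets [y] before [z]. *)
Definition cyc (x y z : nat) : bool :=
  [|| (x < y) && (y < z), (y < z) && (z < x) | (z < x) && (x < y)]%N.

(** The condition common to classical covers, where [u i < u j], and to quantum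
    covers, where [u j < u i]. *)
Definition okstep n (u : 'S_n) (i j : 'I_n) : bool :=
  [forall p : 'I_n, (i < p < j)%N ==> ~~ cyc (u i) (u p) (u j)].

(** One step along the edge [e], or [None] if it is not a cover.  All
    multiplicities are 1, so a product of steps is again a partial function,
    and identities between operators reduce to identities between walks. *)
Definition qstep n (e : 'I_n * 'I_n) (x : Snq n) : option (Snq n) :=
  if okstep x.2 e.1 e.2 then
    Some ((x.1 + if (x.2 e.2 < x.2 e.1)%N then qexp n e.1 e.2 else 0)%MM,
          (tperm e.1 e.2 * x.2)%g)
  else None.

Fixpoint run n (s : seq ('I_n * 'I_n)) (x : Snq n) : option (Snq n) :=
  if s is e :: s' then obind (run s') (qstep e x) else Some x.

Section Steps.
Variable n : nat.
Implicit Types (u : 'S_n) (i j k l p q : 'I_n) (e f : 'I_n * 'I_n) (x y : Snq n)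
  (s : seq ('I_n * 'I_n)).

Lemma okstepP u i j :
  reflect (forall p, (i < p < j)%N -> ~~ cyc (u i) (u p) (u j)) (okstep u i j).
Proof. by apply: (iffP forallP) => H p; apply/implyP/H. Qed.

Lemma val_perm_inj u p q : (u p == u q :> nat) = (p == q :> nat).
Proof. by rewrite !(inj_eq val_inj) (inj_eq perm_inj). Qed.

Lemma swapE u i j p :
  ((tperm i j * u)%g p : nat) = if p == i :> nat then u j else
    if p == j :> nat then u i else u p.
Proof.
rewrite permM; case: tpermP => [->|->|/eqP pi /eqP pj]; rewrite ?eqxx //.
  by case: ifP => // /eqP/val_inj ->.
by rewrite !(inj_eq val_inj) (negPf pi) (negPf pj).
Qed.

Lemma len_tperm_desc u i j : (i < j)%N -> (u j < u i)%N ->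
  len u = ((len (tperm i j * u)%g).+1
           + 2 * #|[set p : 'I_n | (i < p < j)%N && (u j < u p < u i)%N]|)%N.
Proof.
move=> ij uji; have := @len_tperm _ (tperm i j * u)%g i j ij.
rewrite !permM tpermL tpermR mulgA tperm2 mul1g => /(_ uji) ->; congr (_ + 2 * _)%N.
apply: eq_card => p; rewrite !inE; case: (boolP (i < p < j)%N) => //= ijp.
by rewrite swapE; move: ijp; do 2?case: ifP; lia.
Qed.

(** The length grows by exactly 1 when no position counted in [len_tperm]
    exists. *)
Lemma bruhat_stepE u i j : (i < j)%N ->
  bruhat_step u i j = okstep u i j && (u i < u j)%N.
Proof.
move=> ij; rewrite /bruhat_step.
have uij := val_perm_inj u i j; rewrite (ltn_eqF ij) in uij.
have [lt_ij|ge_ij] := ltnP (u i) (u j); last first.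
  have lt_ji : (u j < u i)%N by rewrite ltn_neqAle eq_sym uij.
  by rewrite andbF (len_tperm_desc ij lt_ji); apply/negbTE; lia.
rewrite andbT len_tperm // -[X in _ == X]addn0 eqn_add2l muln_eq0 /= cards_eq0.
apply/eqP/okstepP => [e0 p ijp|ok].
  by have := in_set0 p; rewrite -e0 inE ijp /cyc; lia.
apply/setP=> p; rewrite !inE; apply/negbTE/negP => /andP[/ok].
by rewrite /cyc; lia.
Qed.

Lemma card_between i j : (i < j)%N -> #|[set p : 'I_n | (i < p < j)%N]| = (j - i).-1.
Proof.
move=> ij; have -> : [set p : 'I_n | (i < p < j)%N] = [set p : 'I_n | (p < j)%N] :\: [set p : 'I_n | (p < i.+1)%N].
  by apply/setP=> p; rewrite !inE; lia.
have cardlt m : (m <= n)%N -> #|[set p : 'I_n | (p < m)%N]| = m.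
  move=> mn; rewrite -[RHS](size_iota 0) cardE -(size_map val).
  apply: perm_size; apply: uniq_perm; rewrite ?iota_uniq ?(map_inj_uniq val_inj) ?enum_uniq //.
  move=> z; rewrite mem_iota /=; apply/mapP/idP => [[p]|zm]; first by rewrite mem_enum inE => ? ->.
  by exists (Ordinal (leq_trans zm mn)); rewrite // mem_enum inE.
rewrite cardsD (setIidPr _) ?cardlt //; try by have := ltn_ord j; have := ltn_ord i; lia.
by apply/subsetP=> p; rewrite !inE; lia.
Qed.

(** The length drops by as much as possible, namely [2 * (j - i) - 1], when every
    position between [i] and [j] is counted in [len_tperm_desc]. *)
Lemma quantum_stepE u i j : (i < j)%N ->
  quantum_step u i j = okstep u i j && (u j < u i)%N.
Proof.
move=> ij; rewrite /quantum_step.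
have uij := val_perm_inj u i j; rewrite (ltn_eqF ij) in uij.
have [lt_ji|ge_ji] := ltnP (u j) (u i); last first.
  have lt_ij : (u i < u j)%N by rewrite ltn_neqAle uij.
  by rewrite andbF len_tperm //; apply/negbTE; lia.
rewrite andbT (len_tperm_desc ij lt_ji).
set N := [set p | _]; set M := [set p : 'I_n | (i < p < j)%N].
have NM : N \subset M by apply/subsetP=> p; rewrite !inE => /andP[].
transitivity (#|N| == #|M|); first by rewrite card_between //; apply/idP/idP; lia.
have [_ ->] := subset_leqif_cards NM; apply/eqP/okstepP => [e0 p ijp|ok].
  have : (p \in N) = (p \in M) by rewrite e0.
  by rewrite !inE ijp /cyc; lia.
apply/setP=> p; rewrite !inE; case: (boolP (i < p < j)%N) => //= ijp.
have := ok p ijp; have := val_perm_inj u p i; have := val_perm_inj u p j.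
by rewrite /cyc; lia.
Qed.

Lemma run_cat s1 s2 x : run (s1 ++ s2) x = obind (run s2) (run s1 x).
Proof. by elim: s1 x => //= e s1 IH x; case: qstep. Qed.

Definition qwt u i j : 'X_{1..n.-1} := if (u j < u i)%N then qexp n i j else 0%MM.

Lemma run2 e f x :
  run [:: e; f] x =
  if okstep x.2 e.1 e.2 && okstep (tperm e.1 e.2 * x.2)%g f.1 f.2 then
    Some ((x.1 + (qwt x.2 e.1 e.2 + qwt (tperm e.1 e.2 * x.2)%g f.1 f.2))%MM,
          (tperm f.1 f.2 * (tperm e.1 e.2 * x.2))%g)
  else None.
Proof.
by rewrite /= /qstep; case: ifP => //= _; case: ifP => //= _; rewrite -addmA.
Qed.

Lemma okstep_swap u i j k l : (i < j)%N -> (k < l)%N -> i != k -> i != l -> j != k -> j != l ->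
  okstep u i j -> okstep (tperm i j * u)%g k l ->
  okstep u k l && okstep (tperm k l * u)%g i j.
Proof.
move=> ij kl ik il jk jl /okstepP h1 /okstepP h2.
have E1 : (tperm i j * u)%g i = u j by rewrite permM tpermL.
have E2 : (tperm i j * u)%g j = u i by rewrite permM tpermR.
have E3 : (tperm i j * u)%g k = u k by rewrite permM tpermD.
have E4 : (tperm i j * u)%g l = u l by rewrite permM tpermD.
rewrite E3 E4 in h2.
have h1k := h1 k; have h1l := h1 l; have h2i := h2 i; have h2j := h2 j.
rewrite E1 in h2i; rewrite E2 in h2j.
have iik := val_perm_inj u i k; have iil := val_perm_inj u i l.
have ijk := val_perm_inj u j k; have ijl := val_perm_inj u j l.
have nil : (i != l :> nat) by []. have njk : (j != k :> nat) by [].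
have njl : (j != l :> nat) by []. have nik : (i != k :> nat) by [].
rewrite /cyc in h1k h1l h2i h2j.
apply/andP; split; apply/okstepP => p hp.
  have [epi|pi] := eqVneq p i; first by rewrite epi /cyc in hp *; clear - ij kl nil njl nik njk hp h2i h2j h1l iil ijl; lia.
  have [epj|pj] := eqVneq p j; first by rewrite epj /cyc in hp *; clear - ij kl nil njl nik njk hp h2i h2j h1k ijk iik; lia.
  by have := h2 p hp; rewrite permM tpermD // eq_sym.
have -> : (tperm k l * u)%g i = u i by rewrite permM tpermD // eq_sym.
have -> : (tperm k l * u)%g j = u j by rewrite permM tpermD // eq_sym.
have [epk|pk] := eqVneq p k.
  by rewrite epk permM tpermL /cyc in hp *; clear - ij kl nil njl nik njk hp h1k h1l h2j iik iil; lia.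
have [epl|pl] := eqVneq p l.
  by rewrite epl permM tpermR /cyc in hp *; clear - ij kl nil njl nik njk hp h1k h1l h2i ijl ijk; lia.
by rewrite permM tpermD 1?eq_sym //; apply: h1.
Qed.

Lemma run_swap e f x : (e.1 < e.2)%N -> (f.1 < f.2)%N ->
  [&& e.1 != f.1, e.1 != f.2, e.2 != f.1 & e.2 != f.2] ->
  run [:: e; f] x = run [:: f; e] x.
Proof.
rewrite !run2; case: e f x => [i j] [k l] [al u] /= ij kl /and4P[ik il jk jl].
have -> : okstep u i j && okstep (tperm i j * u)%g k l
       = okstep u k l && okstep (tperm k l * u)%g i j.
  apply/andP/andP => -[h1 h2]; apply/andP; apply: okstep_swap => //; by rewrite eq_sym.
have [ki li] : k != i /\ l != i by split; rewrite eq_sym.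
have [kj lj] : k != j /\ l != j by split; rewrite eq_sym.
case: ifP => // _; congr (Some (_, _)); last first.
  rewrite !mulgA; congr (_ * u)%g.
  have J : (tperm i j ^ tperm k l)%g = tperm i j by rewrite tpermJ !tpermD.
  by rewrite [RHS]conjgC J.
by congr (_ + _)%MM; rewrite addmC /qwt !permM !tpermD.
Qed.

Lemma cyc_rot (x y z : nat) : cyc x y z = cyc y z x.
Proof. by rewrite /cyc; lia. Qed.

Lemma cyc_split (x y z w : nat) : cyc x y z -> w != y ->
  cyc x w z = cyc x w y || cyc y w z.
Proof. by rewrite /cyc; lia. Qed.

Lemma cycN (x y z : nat) : x != y -> y != z -> x != z -> ~~ cyc x y z -> cyc y x z.
Proof. by rewrite /cyc; lia. Qed.

Lemma cyc_asym (x y z : nat) : cyc x y z -> ~~ cyc y x z.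
Proof. by rewrite /cyc; lia. Qed.

(** Of the two products of steps that could equal a given product of the
    transpositions (j, k) and (i, j), exactly one is possible, and the cyclic
    order of the three values decides which. *)
Lemma okstep_tri1 u i j k : (i < j)%N -> (j < k)%N ->
  (okstep u j k && okstep (tperm j k * u)%g i j =
     if cyc (u i) (u j) (u k) then okstep u i j && okstep (tperm i j * u)%g i k
     else okstep u i k && okstep (tperm i k * u)%g j k)
  /\ (if cyc (u i) (u j) (u k) then okstep u i k && okstep (tperm i k * u)%g j k
      else okstep u i j && okstep (tperm i j * u)%g i k) = false.
Proof.
move=> ij jk.
have hij := val_perm_inj u i j; have hjk := val_perm_inj u j k; have hik := val_perm_inj u i k.
have {}hij : u i != u j :> nat by rewrite hij; lia.
have {}hjk : u j != u k :> nat by rewrite hjk; lia.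
have {}hik : u i != u k :> nat by rewrite hik; lia.
have B : okstep (tperm j k * u)%g i j
    = [forall p : 'I_n, (i < p < j)%N ==> ~~ cyc (u i) (u p) (u k)].
  apply: eq_forallb => p; case: (boolP (i < p < j)%N) => //= hp; rewrite !swapE.
  by clear - ij jk hp; do 6?case: ifP => //; lia.
have D : okstep (tperm i j * u)%g i k
    = [forall p : 'I_n, (i < p < k)%N ==> ~~ cyc (u j) (if p == j :> nat then u i else u p) (u k)].
  apply: eq_forallb => p; case: (boolP (i < p < k)%N) => //= hp; rewrite !swapE.
  by clear - ij jk hp; do 6?case: ifP => //; lia.
have F : okstep (tperm i k * u)%g j k
    = [forall p : 'I_n, (j < p < k)%N ==> ~~ cyc (u j) (u p) (u i)].
  apply: eq_forallb => p; case: (boolP (j < p < k)%N) => //= hp; rewrite !swapE.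
  by clear - ij jk hp; do 6?case: ifP => //; lia.
rewrite B D F; have [c|c] := boolP (cyc (u i) (u j) (u k)); split.
- have c' := cyc_asym c.
  apply/andP/andP => -[/forallP h1 /forallP h2]; split; apply/forallP=> p; apply/implyP => hp;
  have := h1 p; have := h2 p; case E: (p == j :> nat);
  try (have pj : u p != u j :> nat by rewrite val_perm_inj E);
  try rewrite (cyc_split c pj); clear - E hp c' ij jk; lia.
- by apply/negP => /andP[/forallP/(_ j) h _]; move: h; rewrite ij jk c.
- have c' := cycN hij hjk hik c.
  apply/andP/andP => -[/forallP h1 /forallP h2]; split; apply/forallP=> p; apply/implyP => hp;
  have := h1 p; have := h2 p; case E: (p == j :> nat);
  try (have -> : p = j by apply/val_inj/eqP);
  (have pi : u p != u i :> nat by rewrite val_perm_inj; clear - hp ij; lia);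
  try rewrite (cyc_split c' pi); clear - E hp c ij jk; lia.
- have c' := cycN hij hjk hik c.
  apply/negbTE/negP => /andP[_ /forallP/(_ j)]; rewrite ij jk eqxx /=.
  by clear - c'; rewrite /cyc in c' *; lia.
Qed.

Lemma okstep_tri2 u i j k : (i < j)%N -> (j < k)%N ->
  (okstep u i j && okstep (tperm i j * u)%g j k =
     if cyc (u i) (u j) (u k) then okstep u j k && okstep (tperm j k * u)%g i k
     else okstep u i k && okstep (tperm i k * u)%g i j)
  /\ (if cyc (u i) (u j) (u k) then okstep u i k && okstep (tperm i k * u)%g i j
      else okstep u j k && okstep (tperm j k * u)%g i k) = false.
Proof.
move=> ij jk.
have hij := val_perm_inj u i j; have hjk := val_perm_inj u j k; have hik := val_perm_inj u i k.
have {}hij : u i != u j :> nat by rewrite hij; lia.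
have {}hjk : u j != u k :> nat by rewrite hjk; lia.
have {}hik : u i != u k :> nat by rewrite hik; lia.
have B : okstep (tperm i j * u)%g j k
    = [forall p : 'I_n, (j < p < k)%N ==> ~~ cyc (u i) (u p) (u k)].
  apply: eq_forallb => p; case: (boolP (j < p < k)%N) => //= hp; rewrite !swapE.
  by clear - ij jk hp; do 6?case: ifP => //; lia.
have D : okstep (tperm j k * u)%g i k
    = [forall p : 'I_n, (i < p < k)%N ==> ~~ cyc (u i) (if p == j :> nat then u k else u p) (u j)].
  apply: eq_forallb => p; case: (boolP (i < p < k)%N) => //= hp; rewrite !swapE.
  by clear - ij jk hp; do 6?case: ifP => //; lia.
have F : okstep (tperm i k * u)%g i j
    = [forall p : 'I_n, (i < p < j)%N ==> ~~ cyc (u k) (u p) (u j)].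
  apply: eq_forallb => p; case: (boolP (i < p < j)%N) => //= hp; rewrite !swapE.
  by clear - ij jk hp; do 6?case: ifP => //; lia.
rewrite B D F; have [c|c] := boolP (cyc (u i) (u j) (u k)); split.
- have c' : ~~ cyc (u i) (u k) (u j) by clear - c; rewrite /cyc in c *; lia.
  apply/andP/andP => -[/forallP h1 /forallP h2]; split; apply/forallP=> p; apply/implyP => hp;
  have := h1 p; have := h2 p; case E: (p == j :> nat);
  try (have pj : u p != u j :> nat by rewrite val_perm_inj E);
  try rewrite (cyc_split c pj); clear - E hp c' ij jk; lia.
- by apply/negP => /andP[/forallP/(_ j) h _]; move: h; rewrite ij jk c.
- have c' : cyc (u i) (u k) (u j).
    by rewrite -cyc_rot; have := cycN hij hjk hik c; rewrite cyc_rot.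
  apply/andP/andP => -[/forallP h1 /forallP h2]; split; apply/forallP=> p; apply/implyP => hp;
  have := h1 p; have := h2 p; case E: (p == j :> nat);
  try (have -> : p = j by apply/val_inj/eqP);
  (have pk : u p != u k :> nat by rewrite val_perm_inj; clear - hp jk; lia);
  try rewrite (cyc_split c' pk); clear - E hp c ij jk; lia.
- have c' := cycN hij hjk hik c.
  apply/negbTE/negP => /andP[_ /forallP/(_ j)]; rewrite ij jk eqxx /=.
  by clear - c'; rewrite /cyc in c' *; lia.
Qed.

End Steps.

(** * The Fomin-Kirillov relations for covers *)

Section Relations.
Variable n : nat.
Implicit Types (u : 'S_n) (i j k l p q : 'I_n) (e f : 'I_n * 'I_n) (x y : Snq n)
  (s : seq ('I_n * 'I_n)).

Lemma qwtE u i j m : qwt u i j m = ((u j < u i) * (i <= m < j))%N :> nat.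
Proof. by rewrite /qwt; case: ifP; rewrite ?mnmE ?mnm0E ?mul1n. Qed.

Lemma arc_split (i j k m : nat) : (i < j)%N -> (j < k)%N ->
  ((i <= m < k) = (i <= m < j) + (j <= m < k) :> nat)%N.
Proof. by lia. Qed.

Lemma cyc_desc (x y z : nat) : cyc x y z -> ((z < x) = (z < y) + (y < x) :> nat)%N.
Proof. by rewrite /cyc; lia. Qed.

Lemma tperm_mul3 i j k : i != j -> j != k -> i != k ->
  (tperm i k * tperm i j = tperm i j * tperm j k)%g /\
  (tperm j k * tperm i k = tperm i j * tperm j k)%g.
Proof.
move=> ij jk ik; have [ji kj ki] : [/\ j != i, k != j & k != i] by split; rewrite eq_sym.
split; first by rewrite conjgC tpermJ tpermL tpermD.
by rewrite [RHS]conjgC tpermJ tpermL tpermD.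
Qed.

Lemma swap_val3 u i j k : i != j -> j != k -> i != k ->
  ((tperm i j * u)%g i = u j) * ((tperm i j * u)%g j = u i) * ((tperm i j * u)%g k = u k).
Proof. by move=> ij jk ik; rewrite !permM tpermL tpermR tpermD. Qed.

(** With [run_tri2], this is the three-term relation, sharpened to an equality
    of walks: one term vanishes and the two others agree. *)
Lemma run_tri1 i j k x : (i < j)%N -> (j < k)%N ->
  let c := cyc (x.2 i) (x.2 j) (x.2 k) in
  run [:: (j, k); (i, j)] x
    = (if c then run [:: (i, j); (i, k)] x else run [:: (i, k); (j, k)] x) /\
  (if c then run [:: (i, k); (j, k)] x else run [:: (i, j); (i, k)] x) = None.
Proof.
move=> ij jk; rewrite !run2; case: x => al u; simpl fst; simpl snd.
have nij : i != j by apply: contraTneq ij => ->; rewrite ltnn.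
have njk : j != k by apply: contraTneq jk => ->; rewrite ltnn.
have nik : i != k by apply: contraTneq (ltn_trans ij jk) => ->; rewrite ltnn.
have [nji nkj nki] : [/\ j != i, k != j & k != i] by split; rewrite eq_sym.
have [E1 E2] := tperm_mul3 nij njk nik.
have nv p q : p != q -> u p != u q :> nat by move=> pq; rewrite val_perm_inj.
have okc := cycN (nv _ _ nij) (nv _ _ njk) (nv _ _ nik).
have [okE oknE] := okstep_tri1 u ij jk.
case: (boolP (cyc _ _ _)) okE oknE => c okE oknE; rewrite ?oknE ?okE; split => //.
  case: ifP => // _; congr (Some (_, _)); last by rewrite !mulgA E1.
  congr (_ + _)%MM; apply/mnmP => m; rewrite !mnmDE !qwtE.
  rewrite !(swap_val3 u njk nki nji) !(swap_val3 u nij njk nik).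
  by rewrite (cyc_desc c) (arc_split m ij jk); ring.
case: ifP => // _; congr (Some (_, _)); last by rewrite !mulgA E2.
congr (_ + _)%MM; apply/mnmP => m; rewrite !mnmDE !qwtE.
rewrite !(swap_val3 u njk nki nji) !(swap_val3 u nik nkj nij).
have c' := okc c.
by rewrite (cyc_desc c') (arc_split m ij jk); ring.
Qed.

Lemma run_tri2 i j k x : (i < j)%N -> (j < k)%N ->
  let c := cyc (x.2 i) (x.2 j) (x.2 k) in
  run [:: (i, j); (j, k)] x
    = (if c then run [:: (j, k); (i, k)] x else run [:: (i, k); (i, j)] x) /\
  (if c then run [:: (i, k); (i, j)] x else run [:: (j, k); (i, k)] x) = None.
Proof.
move=> ij jk; rewrite !run2; case: x => al u; simpl fst; simpl snd.
have nij : i != j by apply: contraTneq ij => ->; rewrite ltnn.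
have njk : j != k by apply: contraTneq jk => ->; rewrite ltnn.
have nik : i != k by apply: contraTneq (ltn_trans ij jk) => ->; rewrite ltnn.
have [nji nkj nki] : [/\ j != i, k != j & k != i] by split; rewrite eq_sym.
have [E1 E2] := tperm_mul3 nkj nji nki.
rewrite ![tperm k _]tpermC ![tperm j i]tpermC in E1 E2.
have nv p q : p != q -> u p != u q :> nat by move=> pq; rewrite val_perm_inj.
have okc := cycN (nv _ _ nij) (nv _ _ njk) (nv _ _ nik).
have [okE oknE] := okstep_tri2 u ij jk.
case: (boolP (cyc _ _ _)) okE oknE => c okE oknE; rewrite ?oknE ?okE; split => //.
  case: ifP => // _; congr (Some (_, _)); last by rewrite !mulgA E1.
  congr (_ + _)%MM; apply/mnmP => m; rewrite !mnmDE !qwtE.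
  rewrite !(swap_val3 u njk nki nji) !(swap_val3 u nij njk nik).
  by rewrite (cyc_desc c) (arc_split m ij jk); ring.
case: ifP => // _; congr (Some (_, _)); last by rewrite !mulgA E2.
congr (_ + _)%MM; apply/mnmP => m; rewrite !mnmDE !qwtE.
rewrite !(swap_val3 u nik nkj nij) !(swap_val3 u nij njk nik).
have c' := okc c; rewrite cyc_rot in c'.
by rewrite (cyc_desc c') (arc_split m ij jk); ring.
Qed.

(** After a step, the same step is possible again only if no position lies in
    between: such a position would have to lie cyclically on both sides. *)
Lemma run_sq i j x : (i < j)%N -> run [:: (i, j); (i, j)] x =
  if j == i.+1 :> nat then Some ((x.1 + qexp n i j)%MM, x.2) else None.
Proof.
move=> ij; rewrite run2; case: x => al u; simpl fst; simpl snd.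
rewrite mulgA tperm2 mul1g.
have -> : okstep u i j && okstep (tperm i j * u)%g i j = (j == i.+1 :> nat).
  apply/andP/eqP => [[/okstepP h1 /okstepP h2]|ji]; last first.
    by split; apply/okstepP => p; clear - ji; lia.
  apply/eqP; rewrite eqn_leq ij andbT leqNgt; apply/negP => lt.
  pose p := Ordinal (ltn_trans lt (ltn_ord j)).
  have hp : (i < p < j)%N by rewrite /= ltnSn.
  have := h1 p hp; have := h2 p hp; rewrite !swapE.
  have := val_perm_inj u p i; have := val_perm_inj u p j; have := val_perm_inj u i j.
  by clear - hp; rewrite /cyc; do 6?case: ifP; lia.
case: ifP => // _; congr (Some (_, _)); congr (_ + _)%MM.
apply/mnmP => m; rewrite !mnmDE !qwtE mnmE !permM tpermL tpermR.
by have := val_perm_inj u i j; clear - ij; lia.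
Qed.

End Relations.

Section Operators.
Variable n : nat.
Implicit Types (u v w : 'S_n) (i j k l p q : 'I_n) (e f : 'I_n * 'I_n) (x y : Snq n)
  (s : seq ('I_n * 'I_n)) (al be : 'X_{1..n.-1}).

Lemma run_shift s al be u : run s ((al + be)%MM, u)
  = omap (fun y => ((al + y.1)%MM, y.2)) (run s (be, u)).
Proof.
elim: s be u => //= e s IH be u; rewrite /qstep /=; case: ifP => //= _.
by rewrite -IH addmA.
Qed.

Lemma run_base s al u : run s (al, u)
  = omap (fun y => ((al + y.1)%MM, y.2)) (run s (0%MM, u)).
Proof. by rewrite -run_shift addm0. Qed.

Definition qterm (o : option (Snq n)) w : Zq n :=
  if o is Some y then if y.2 == w then 'X_[y.1] else 0 else 0.

Local Notation mx := 'M[Zq n]_#|{perm 'I_n}|.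

(** The matrix of the walk [s] acting on the right of row vectors, so that
    concatenation of walks is the product of matrices. *)
Definition opmx s : mx := \matrix_(a, b) qterm (run s (0%MM, enum_val a)) (enum_val b).

Lemma opmx_cat s1 s2 : opmx (s1 ++ s2) = opmx s1 * opmx s2.
Proof.
apply/matrixP => a b; rewrite !mxE run_cat.
case E: (run s1 _) => [[al v]|] /=; last first.
  by rewrite big1 // => c _; rewrite !mxE E mul0r.
rewrite (bigD1 (enum_rank v)) //= !mxE E /= enum_rankK eqxx big1 => [|c cv].
  rewrite addr0 run_base; case: (run s2 _) => [[be w]|] /=; last by rewrite mulr0.
  by case: ifP => _; rewrite ?mulr0 // mpolyXD.
rewrite !mxE E /=; have [vc|_] := eqVneq v (enum_val c); last by rewrite mul0r.
by rewrite vc enum_valK eqxx in cv.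
Qed.

Lemma opmx_nil : opmx [::] = 1.
Proof.
apply/matrixP => a b; rewrite !mxE /=.
by rewrite (inj_eq enum_val_inj); case: eqP => _; rewrite // mpolyX0.
Qed.

Lemma eq_opmx s1 s2 : (forall x, run s1 x = run s2 x) -> opmx s1 = opmx s2.
Proof. by move=> E; apply/matrixP => a b; rewrite !mxE E. Qed.

Lemma opmx_sum s s1 s2 (c : Snq n -> bool) :
  (forall x, run s x = (if c x then run s1 x else run s2 x) /\
             (if c x then run s2 x else run s1 x) = None) ->
  opmx s = opmx s1 + opmx s2.
Proof.
move=> E; apply/matrixP => a b; rewrite !mxE.
by have [-> ] := E (0%MM, enum_val a); case: ifP => _ -> /=; rewrite ?addr0 ?add0r.
Qed.

Definition bruhat_op i j : mx :=
  if (i < j)%N then opmx [:: (i, j)] else if (j < i)%N then - opmx [:: (j, i)] else 0.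

Lemma bruhat_op_lt i j : (i < j)%N -> bruhat_op i j = opmx [:: (i, j)].
Proof. by rewrite /bruhat_op => ->. Qed.

Lemma bruhat_op_anti i j : bruhat_op j i = - bruhat_op i j.
Proof. by rewrite /bruhat_op; case: ltngtP => _; rewrite ?opprK ?oppr0. Qed.

Lemma ord_neq_lt i j : i != j -> (i < j)%N || (j < i)%N.
Proof. by rewrite -neq_ltn. Qed.

(** The relation is invariant under cyclic rotation of the indices, so the
    smallest one may be assumed to come first. *)
Lemma bruhat_op_tri i j k : i != j -> j != k -> i != k ->
  bruhat_op i j * bruhat_op j k + bruhat_op j k * bruhat_op k i
    + bruhat_op k i * bruhat_op i j = 0.
Proof.
have tri (a b c : 'I_n) : (a < b)%N -> (a < c)%N -> b != c ->
    bruhat_op a b * bruhat_op b c + bruhat_op b c * bruhat_op c a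
    + bruhat_op c a * bruhat_op a b = 0.
  move=> ab ac /ord_neq_lt/orP[bc|cb]; rewrite (bruhat_op_anti a c).
    rewrite !bruhat_op_lt // mulrN mulNr -!opmx_cat /=.
    by rewrite (opmx_sum (fun x => run_tri2 x ab bc)) -addrA -opprD subrr.
  rewrite (bruhat_op_anti c b) !bruhat_op_lt // !mulrN !mulNr opprK -!opmx_cat /=.
  rewrite (opmx_sum (c := fun x => ~~ cyc (x.2 a) (x.2 c) (x.2 b))
     (s1 := [:: (a, b); (c, b)]) (s2 := [:: (a, c); (a, b)]) (s := [:: (c, b); (a, c)])).
    by rewrite addrA addNr add0r subrr.
  by move=> x; have := run_tri1 x ac cb; case: cyc.
move=> ij jk ik.
have [ji kj ki] : [/\ j != i, k != j & k != i] by split; rewrite eq_sym.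
have := ord_neq_lt ij; have := ord_neq_lt jk; have := ord_neq_lt ik.
by case/orP => lik /orP[] ljk /orP[] lij;
  first [by apply: tri | by rewrite -addrA addrC; apply: tri
       | by rewrite addrC addrA; apply: tri | by clear - lik ljk lij; lia].
Qed.

Lemma bruhat_op_comm i j k l : i != k -> i != l -> j != k -> j != l ->
  GRing.comm (bruhat_op i j) (bruhat_op k l).
Proof.
have C (a b c d : 'I_n) : (a < b)%N -> (c < d)%N -> a != c -> a != d -> b != c -> b != d ->
    GRing.comm (bruhat_op a b) (bruhat_op c d).
  move=> ab cd ac ad bc bd; rewrite /GRing.comm !bruhat_op_lt // -!opmx_cat /=.
  by apply: eq_opmx => x; apply: run_swap; rewrite //= ac ad bc bd.
move=> ik il jk jl; case: (ltngtP i j) => ij.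
- case: (ltngtP k l) => kl; first exact: C.
    by rewrite (bruhat_op_anti l k); apply/commrN/C.
  by rewrite /bruhat_op kl ltnn; apply: commr0.
- rewrite (bruhat_op_anti j i); apply/commr_sym/commrN/commr_sym.
  case: (ltngtP k l) => kl; first exact: C.
    by rewrite (bruhat_op_anti l k); apply/commrN/C.
  by rewrite /bruhat_op kl ltnn; apply: commr0.
by rewrite {1}/bruhat_op ij ltnn; apply/commr_sym/commr0.
Qed.

Lemma bruhat_op_sq i j k l :
  GRing.comm (bruhat_op i j * bruhat_op i j) (bruhat_op k l).
Proof.
have C (a b : 'I_n) : (a < b)%N -> exists c : Zq n, bruhat_op a b * bruhat_op a b = c%:M.
  move=> ab; exists (if b == a.+1 :> nat then 'X_[qexp n a b] else 0).
  rewrite bruhat_op_lt // -opmx_cat /=; apply/matrixP => c d.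
  rewrite !mxE run_sq //; case: ifP => _ /=; last by rewrite mul0rn.
  by rewrite (inj_eq enum_val_inj) add0m; case: eqP.
have S (a b : 'I_n) : exists c : Zq n, bruhat_op a b * bruhat_op a b = c%:M.
  case: (ltngtP a b) => ab; first exact: C.
    by rewrite bruhat_op_anti mulrNN; apply: C.
  by exists 0; rewrite /bruhat_op ab ltnn mulr0 raddf0.
have [c ->] := S i j; exact: comm_scalar_mx.
Qed.

Lemma bruhat_op_fk : fk_relations bruhat_op.
Proof.
split.
- by move=> i; rewrite /bruhat_op ltnn.
- exact: bruhat_op_anti.
- exact: bruhat_op_comm.
- exact: bruhat_op_tri.
- exact: bruhat_op_sq.
Qed.

End Operators.

(** * The action on Schubert classes *)

Fixpoint inj_words (I : finType) (S : {set I}) (r : nat) : seq (seq I) :=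
  if r is r'.+1 then
    flatten [seq [seq b :: w | w <- inj_words (S :\ b) r'] | b <- enum S]
  else [:: [::]].

Lemma mem_inj_words (I : finType) (S : {set I}) r w :
  (w \in inj_words S r) = [&& size w == r, uniq w & all (mem S) w].
Proof.
elim: r S w => [|r IH] S w /=; first by rewrite inE; case: w.
apply/flatten_mapP/idP => [[b]|].
  rewrite mem_enum => bS /mapP[w' ]; rewrite IH => /and3P[/eqP sw uw aw] -> /=.
  rewrite sw eqxx uw bS /= andbT; apply/andP; split.
    by apply/negP => /(allP aw); rewrite !inE eqxx.
  by apply: sub_all aw => x; rewrite !inE => /andP[].
case: w => [|b w] //= /and3P[sw /andP[bw uw] /andP[bS aw]].
exists b; first by rewrite mem_enum.
apply/mapP; exists w => //; rewrite IH -eqSS sw uw /=.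
apply/allP => x xw; rewrite !inE; have -> : x \in S := allP aw x xw; rewrite andbT.
by apply: contraNneq bw => <-.
Qed.

Lemma inj_words_uniq (I : finType) (S : {set I}) r : uniq (inj_words S r).
Proof.
elim: r S => //= r IH S; apply: allpairs_uniq_dep => //; first exact: enum_uniq.
by move=> [b w] [b' w'] _ _ /= [-> ->].
Qed.

Lemma star_sum_words (I : finType) (R : pzRingType) (T : I -> I -> R) a S r :
  star_sum T a S r = \sum_(w <- inj_words S r) \prod_(b <- w) T a b.
Proof.
elim: r S => [|r IH] S /=; first by rewrite big_seq1 big_nil.
rewrite big_flatten big_map big_enum /=; apply: eq_bigr => b _.
by rewrite big_map IH mulr_sumr; apply: eq_bigr => w _; rewrite big_cons.
Qed.

Section Action.
Variable n : nat.
Implicit Types (u v w : 'S_n) (i j k l p q a b : 'I_n) (e f : 'I_n * 'I_n) (x y : Snq n)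
  (s : seq ('I_n * 'I_n)).

Definition arrow a b : 'I_n * 'I_n := if (a < b)%N then (a, b) else (b, a).
Definition star a (bs : seq 'I_n) := map (arrow a) bs.

Lemma bruhat_op_arrow a b : a != b -> bruhat_op a b = (-1) ^+ (b < a)%N * opmx [:: arrow a b].
Proof.
by rewrite /bruhat_op /arrow neq_ltn; case: ltngtP => _ _ //=; rewrite ?expr0 ?mul1r // expr1 mulN1r.
Qed.

Lemma prod_bruhat_op a (bs : seq 'I_n) : a \notin bs ->
  \prod_(b <- bs) bruhat_op a b
  = (-1) ^+ count (fun b : 'I_n => (b < a)%N) bs * opmx (star a bs).
Proof.
elim: bs => [|b bs IH]; first by rewrite big_nil opmx_nil mulr1.
rewrite inE negb_or => /andP[ab abs]; rewrite big_cons IH // bruhat_op_arrow //=.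
rewrite (opmx_cat [:: arrow a b] (star a bs) : opmx (_ :: _) = _) exprD -!mulrA.
by congr (_ * _); rewrite mulrA commr_sign -mulrA.
Qed.

Section Sch.
Variables (A : comAlgType (Zq n)) (sch : 'S_n -> A).
Local Notation mx := 'M[Zq n]_#|{perm 'I_n}|.

Definition act u (M : mx) : A := \sum_w M (enum_rank u) (enum_rank w) *: sch w.

Definition eval (o : option (Snq n)) : A :=
  if o is Some y then ('X_[y.1] : Zq n) *: sch y.2 else 0.

Lemma act_opmx s u : act u (opmx s) = eval (run s (0%MM, u)).
Proof.
rewrite /act /eval; case E: (run s _) => [y|]; last first.
  by rewrite big1 // => w _; rewrite mxE enum_rankK E scale0r.
rewrite (bigD1 y.2) //= mxE !enum_rankK E /= eqxx big1 ?addr0 // => w wy.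
by rewrite mxE !enum_rankK E /= eq_sym (negPf wy) scale0r.
Qed.

Lemma act_mul M N u : act u (M * N) = \sum_w M (enum_rank u) (enum_rank w) *: act w N.
Proof.
under [RHS]eq_bigr do rewrite scaler_sumr.
rewrite exchange_big; apply: eq_bigr => w _; rewrite mxE scaler_suml.
rewrite (reindex (@enum_rank _)) /=; last by apply: onW_bij; exact: enum_rank_bij.
by apply: eq_bigr => v _; rewrite scalerA.
Qed.

Lemma act_is_zmod_morphism u : zmod_morphism (act u).
Proof.
move=> M N; rewrite /act -sumrB; apply: eq_bigr => w _.
by rewrite !mxE scalerBl.
Qed.

HB.instance Definition _ u := GRing.isZmodMorphism.Build mx A (act u) (act_is_zmod_morphism u).

Lemma act_sign c M u : act u ((-1) ^+ c * M) = (-1) ^+ c *: act u M.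
Proof.
rewrite -signr_odd -[in RHS]signr_odd; case: odd.
  by rewrite !expr1 mulN1r scaleN1r raddfN.
by rewrite !expr0 mul1r scale1r.
Qed.

Lemma act_opmxM s M u : act u (opmx s * M) =
  if run s (0%MM, u) is Some y then ('X_[y.1] : Zq n) *: act y.2 M else 0.
Proof.
rewrite act_mul; case E: (run s _) => [y|]; last first.
  by rewrite big1 // => w _; rewrite mxE enum_rankK E scale0r.
rewrite (bigD1 y.2) //= mxE !enum_rankK E /= eqxx big1 ?addr0 // => w wy.
by rewrite mxE !enum_rankK E /= eq_sym (negPf wy) scale0r.
Qed.

Hypothesis hA : is_quantum_cohomology sch.

(** The right-hand side of the Monk formula for the simple transposition of the
    positions [m - 1] and [m]; it is 0 for [m = 0] and [m = n]. *)
Definition monk_op (m : nat) : mx :=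
  \sum_(p : 'I_n * 'I_n | (p.1 < m <= p.2)%N) opmx [:: p].

Lemma act_monk_op m : (m <= n)%N -> exists x : A, forall u, act u (monk_op m) = sch u * x.
Proof.
move=> mn; have [m0|m_gt0] := posnP m.
  exists 0 => u; rewrite mulr0 /monk_op big_pred0 ?raddf0 // => p.
  by rewrite m0 ltn0.
have [nm|nm] := leqP n m.
  exists 0 => u; rewrite mulr0 /monk_op big_pred0 ?raddf0 // => -[p q] /=.
  by rewrite [(m <= q)%N]leqNgt (leq_trans (ltn_ord q) nm) andbF.
have hi : (m.-1 < n)%N by lia.
pose i := Ordinal hi; pose j := Ordinal nm.
exists (sch (tperm i j)) => u; have ij : j = i.+1 :> nat by rewrite /= prednK.
rewrite (quantum_monk hA u ij) /monk_op raddf_sum /=.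
under eq_bigr do rewrite act_opmx /= /qstep.
rewrite [in RHS]big_mkcondr [X in _ = _ + X]big_mkcondr -big_split /=.
apply: eq_bigr => -[a b] /= /andP[am mb].
have ab : (a < b)%N := leq_trans am mb.
rewrite bruhat_stepE // quantum_stepE //.
case: (okstep u a b) => /=; last by rewrite addr0.
case: ltngtP => ba; last by have := val_perm_inj u a b; rewrite ba eqxx (ltn_eqF ab).
  by rewrite add0r add0m.
by rewrite addr0 add0m mpolyX0 scale1r.
Qed.

Definition theta_op a : mx := \sum_b bruhat_op a b.

(** The edges that straddle both cuts [a] and [a.+1] cancel; those that remain
    have an end at [a]. *)
Lemma theta_opE a : theta_op a = monk_op a.+1 - monk_op a.
Proof.
rewrite /theta_op /monk_op.
rewrite (bigID (fun p : 'I_n * 'I_n => p.1 == a)) /=.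
rewrite [X in _ - X](bigID (fun p : 'I_n * 'I_n => p.2 == a)) /=.
rewrite [X in _ + X - _](eq_bigl (fun p : 'I_n * 'I_n => (p.1 < a <= p.2)%N && (p.2 != a))); last first.
  move=> [p q] /=; rewrite -!(inj_eq val_inj) /=; lia.
rewrite opprD addrACA subrr addr0.
rewrite (bigID (fun b : 'I_n => (a < b)%N)) /=; congr (_ + _).
  rewrite (reindex_onto (fun b => (a, b)) snd) /=; last first.
    by move=> [p q] /= /andP[_ /eqP ->].
  apply: eq_big => b; first by rewrite -!(inj_eq val_inj) /= !eqxx; lia.
  by move=> ab; rewrite bruhat_op_lt.
rewrite -sumrN (reindex_onto (fun b => (b, a)) fst) /=; last first.
  by move=> [p q] /= /andP[_ /eqP ->].
rewrite (bigID (fun b : 'I_n => b == a)) /= big1 ?add0r; last first.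
  by move=> b /andP[_ /eqP ->]; rewrite /bruhat_op ltnn.
apply: eq_big => b; first by rewrite -!(inj_eq val_inj) /= !eqxx; lia.
move=> /andP[ba ab]; rewrite bruhat_op_anti bruhat_op_lt //.
by rewrite ltn_neqAle ab leqNgt ba.
Qed.

Lemma act_theta_op a : exists x : A, forall u, act u (theta_op a) = sch u * x.
Proof.
have [x hx] := act_monk_op (ltn_ord a); have [y hy] := act_monk_op (ltnW (ltn_ord a)).
by exists (x - y) => u; rewrite theta_opE raddfB /= hx hy mulrBr.
Qed.

End Sch.
End Action.

(** * Operators commuting with the Dunkl elements *)

Section Transition.
Variable n : nat.
Implicit Types (u v w : 'S_n) (i j k l p q a b r s : 'I_n).

(** Lexicographic comparison of permutations as words, encoded in base [n]. *)
Definition lex_weight w : nat := \sum_(p < n) w p * n ^ (n - p).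

Lemma lex_weight_bound w : (lex_weight w < (n * (n * n ^ n)).+1)%N.
Proof.
rewrite ltnS /lex_weight -[X in (_ <= X * _)%N]card_ord -sum_nat_const.
apply: leq_sum => p _; apply: leq_mul; first exact/ltnW/ltn_ord.
by rewrite leq_pexp2l ?leq_subr // (leq_ltn_trans _ (ltn_ord p)).
Qed.

Lemma lex_weight_lt v b r s : (b < r)%N -> (r < s)%N -> (v b < v r)%N -> (v r < v s)%N ->
  (lex_weight (tperm r s * v)%g < lex_weight (tperm b r * v)%g)%N.
Proof.
move=> br rs vbr vrs; rewrite /lex_weight.
have nbr : r != b by apply: contraTneq br => ->; rewrite ltnn.
have nrs : s != r by apply: contraTneq rs => ->; rewrite ltnn.
have nbs : s != b by apply: contraTneq (ltn_trans br rs) => ->; rewrite ltnn.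
rewrite (bigD1 b) //= (bigD1 r) //= (bigD1 s) /=; last by rewrite nbs nrs.
rewrite [X in (_ < X)%N](bigD1 b) //= [X in (_ < _ + X)%N](bigD1 r) //=.
rewrite [X in (_ < _ + (_ + X))%N](bigD1 s) /=; last by rewrite nbs nrs.
have [nbr' nrs' nbs'] : [/\ b != r, r != s & b != s] by split; rewrite eq_sym.
rewrite !(swap_val3 v nrs' nbs nbr) !(swap_val3 v nbr' nrs' nbs').
rewrite (eq_bigr (fun p : 'I_n => (tperm b r * v)%g p * n ^ (n - p))%N); last first.
  by move=> p /andP[/andP[pb pr] ps]; rewrite !permM !tpermD // eq_sym.
rewrite !addnA ltn_add2r.
have cb : (n * n ^ (n - r) <= n ^ (n - b))%N.
  by rewrite -expnS leq_pexp2l ?(leq_ltn_trans _ (ltn_ord b)) //; have := ltn_ord r; lia.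
have cr : (0 < n ^ (n - r))%N by rewrite expn_gt0 (leq_ltn_trans _ (ltn_ord b)).
have vsn := ltn_ord (v s).
move: (n ^ (n - b))%N (n ^ (n - r))%N (n ^ (n - s))%N cb cr => cb cr cs hcb hcr.
have h1 : (v s * cr < n * cr)%N by rewrite ltn_pmul2r.
have h2 : (v b * cb + cb <= v r * cb)%N by rewrite addnC -mulSn leq_mul2r vbr orbT.
have h3 : (v r * cs <= v s * cs)%N by rewrite leq_mul2r (ltnW vrs) orbT.
by have := leq0n (v b * cr); lia.
Qed.

Lemma perm_inversion w : w != 1%g -> exists r j, (r < j)%N && (w j < w r)%N.
Proof.
move=> w1; have [p0 wp0] : exists p, w p != p.
  apply/existsP; apply: contraNT w1 => /existsPn h; apply/eqP/permP => p.
  by rewrite perm1; apply/eqP; have := h p; rewrite negbK.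
have [p wp pmin] := arg_minnP (P := fun p => w p != p) val wp0.
have fixp q : (q < p)%N -> w q = q.
  by move=> qp; apply/eqP; apply: contraTT qp => /pmin; rewrite -leqNgt.
exists p, (w^-1%g p); rewrite permKV.
have jp : w^-1%g p != p by apply: contraNneq wp => jp; rewrite -{1}jp permKV.
have nlt1 : ~~ (w^-1%g p < p)%N.
  by apply/negP => lt; have := fixp _ lt; rewrite permKV => /esym/eqP; apply/negP.
have nlt2 : ~~ (w p < p)%N.
  by apply/negP => lt; have /perm_inj/eqP := fixp _ lt; apply/negP.
have jp' : (w^-1%g p != p :> nat) := jp; have wp' : (w p != p :> nat) := wp.
by move: jp' wp' nlt1 nlt2; lia.
Qed.

(** The transition of Lascoux and Schuetzenberger: [r] is the last position with
    an inversion to its right and [s] the position of the largest smaller value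
    to the right of [r].  Then [w] is the only permutation obtained from
    [tperm r s * w] by a classical cover moving [r] to the right. *)
Lemma transition_pair w : w != 1%g -> exists r s, [/\ (r < s)%N, (w s < w r)%N,
  okstep (tperm r s * w)%g r s &
  forall j, (r < j)%N -> okstep (tperm r s * w)%g r j ->
    ((tperm r s * w)%g r < (tperm r s * w)%g j)%N -> j = s].
Proof.
move=> /perm_inversion[r0 [j0 h0]].
have hr0 : [exists j : 'I_n, (r0 < j)%N && (w j < w r0)%N] by apply/existsP; exists j0.
have [r /existsP[j1 hj1] rmax] := arg_maxnP (P := fun r : 'I_n => [exists j : 'I_n, (r < j)%N && (w j < w r)%N]) val hr0.
have [s /andP[rs ws] smax] := arg_maxnP (P := fun j : 'I_n => (r < j)%N && (w j < w r)%N) (fun j => w j : nat) hj1.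
have incr p q : (r < p)%N -> (p < q)%N -> (w p < w q)%N.
  move=> rp pq; rewrite ltnNge; apply/negP => wqp.
  have wne : (w q == w p :> nat) = false by rewrite val_perm_inj gtn_eqF.
  have : [exists j : 'I_n, (p < j)%N && (w j < w p)%N].
    by apply/existsP; exists q; rewrite pq ltn_neqAle wne.
  by move/rmax; rewrite /= leqNgt rp.
exists r, s; split=> //.
  apply/okstepP => p hp; rewrite !swapE /cyc eqxx.
  have -> : (p == r :> nat) = false by lia.
  have -> : (p == s :> nat) = false by lia.
  have -> : (s == r :> nat) = false by lia.
  rewrite eqxx.
  have := smax p; have := val_perm_inj w p s; have := val_perm_inj w p r; have := incr p s.
  rewrite /=; move: hp rs ws; lia.
move=> j rj /okstepP/(_ s) okj; rewrite !swapE eqxx.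
have -> : (j == r :> nat) = false by lia.
have [js|js] := eqVneq (j : nat) s; first by move=> _; apply/val_inj.
move=> lt; exfalso.
move: okj; rewrite !swapE !eqxx /cyc.
have -> : (j == r :> nat) = false by lia.
have -> : (s == r :> nat) = false by lia.
rewrite (negPf js).
have := smax j; have := val_perm_inj w j r; have := incr j s.
rewrite /=; move: rs ws js rj lt; lia.
Qed.

Section Linear.
Variables (A : comAlgType (Zq n)) (sch : 'S_n -> A).
Hypothesis hA : is_quantum_cohomology sch.
Variable D : 'M[Zq n]_#|{perm 'I_n}|.
Hypothesis cD : forall a, GRing.comm (theta_op a) D.

Lemma act_defect_theta v r : act sch v D = sch v * act sch 1%g D ->
  act sch v (theta_op r * D) = act sch v (theta_op r) * act sch 1%g D.
Proof.
move=> vD; have [x hx] := act_theta_op hA r.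
rewrite cD act_mul; under eq_bigr do rewrite hx scalerAl.
by rewrite -mulr_suml -/(act sch v D) vD hx -!mulrA [_ * x]mulrC.
Qed.

Lemma act_defect_opmx v e : (forall y, run [:: e] (0%MM, v) = Some y ->
    act sch y.2 D = sch y.2 * act sch 1%g D) ->
  act sch v (opmx [:: e] * D) = act sch v (opmx [:: e]) * act sch 1%g D.
Proof.
move=> H; rewrite act_opmxM act_opmx; case E: (run _ _) => [y|] /=; last by rewrite mul0r.
by rewrite H // scalerAl.
Qed.

(** Multiplication by [theta_op r] is compatible with [D] at [v].  If this is
    known for all terms of [theta_op r] applied to [v] but one, then it holds
    for the last one. *)
Lemma act_central_step v r s : r != s ->
  act sch v D = sch v * act sch 1%g D ->
  (forall b y, b != s -> b != r -> run [:: arrow r b] (0%MM, v) = Some y ->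
    act sch y.2 D = sch y.2 * act sch 1%g D) ->
  act sch v (opmx [:: arrow r s] * D) = act sch v (opmx [:: arrow r s]) * act sch 1%g D.
Proof.
move=> rs vD H; have := act_defect_theta r vD; rewrite /theta_op (bigD1 s) //=.
rewrite mulrDl mulr_suml raddfD raddf_sum /= (raddfD (act sch v)) raddf_sum /= mulrDl.
rewrite [(\sum_(i < n | i != s) _) * act sch 1%g D]mulr_suml.
rewrite [X in _ + X](eq_bigr (fun b => act sch v (bruhat_op r b) * act sch 1%g D)).
  move=> e0; have {e0} := addIr _ e0.
  rewrite bruhat_op_arrow // -mulrA !act_sign -scalerAl.
  move/(congr1 (fun z => (-1) ^+ (s < r)%N *: z)).
  by rewrite !scalerA -expr2 sqrr_sign !scale1r.
move=> b bs; have [->|br] := eqVneq b r; first by rewrite /bruhat_op ltnn mul0r raddf0 mul0r.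
rewrite bruhat_op_arrow 1?eq_sym // -mulrA !act_sign -scalerAl.
by rewrite act_defect_opmx // => y; apply: H.
Qed.

(** Induction on the length, and for equal length downwards in the
    lexicographic order.  Apply [act_central_step] to the permutation [v] below
    [w] given by [transition_pair]: the other classical covers of [v] with an
    end at [r] exchange it with an earlier position, hence have the length of
    [w] and are lexicographically larger, and the quantum covers are shorter. *)
Theorem act_central u : act sch u D = sch u * act sch 1%g D.
Proof.
(* [K] exceeds every weight, so that the measure compares the lengths first. *)
pose K := (n * (n * n ^ n)).+1%N.
have [m] := ubnP (len u * K + (K - lex_weight u))%N.
elim: m u => // m IH w; rewrite ltnS => le_m.
have [->|/transition_pair[r [s [rs ws okrs uniqs]]]] := eqVneq w 1%g.
  by rewrite (schubert_unit hA) mul1r.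
have lwK := lex_weight_bound w; rewrite -/K in lwK.
have IHlen z : (len z < len w)%N -> act sch z D = sch z * act sch 1%g D.
  move=> lz; apply: IH; apply: leq_trans le_m.
  have : ((len z).+1 * K <= len w * K)%N by rewrite leq_mul2r lz orbT.
  by rewrite mulSn; lia.
set v := (tperm r s * w)%g in okrs uniqs.
have wv : w = (tperm r s * v)%g by rewrite /v mulgA tperm2 mul1g.
have vrs : (v r < v s)%N by rewrite /v !permM tpermL tpermR.
have lenw : len w = (len v).+1.
  have : bruhat_step v r s by rewrite bruhat_stepE // okrs.
  by rewrite /bruhat_step -wv => /eqP.
have nrs : r != s by apply: contraTneq rs => ->; rewrite ltnn.
have vD : act sch v D = sch v * act sch 1%g D by apply: IHlen; rewrite lenw.
have := act_central_step nrs vD; rewrite act_opmxM act_opmx /arrow rs /= /qstep /= okrs.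
rewrite ltnNge (ltnW vrs) /= add0m mpolyX0 !scale1r -wv; apply=> b y bs br.
have quantum_case i j z : (i < j)%N -> okstep v i j -> (v j < v i)%N ->
    z = (tperm i j * v)%g -> act sch z D = sch z * act sch 1%g D.
  move=> ij ok vji ->; apply: IHlen.
  have : quantum_step v i j by rewrite quantum_stepE // ok.
  by rewrite /quantum_step lenw => /eqP; lia.
case: ltnP => [rb|]; rewrite /qstep /=; case: ifP => // ok.
  have [lt|ge] := ltnP (v r) (v b); first by rewrite (uniqs b rb ok lt) eqxx in bs.
  case=> <- /=; apply: (quantum_case r b) => //.
  by rewrite ltn_neqAle ge val_perm_inj gtn_eqF.
rewrite leq_eqVlt => /orP[/eqP/val_inj e|lbr]; first by rewrite e eqxx in br.
have [lt|ge] := ltnP (v b) (v r).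
  case=> <- /=; apply: IH; apply: leq_trans le_m.
  have : bruhat_step v b r by rewrite bruhat_stepE // ok.
  rewrite /bruhat_step -lenw => /eqP ->; rewrite ltn_add2l.
  have := lex_weight_lt lbr rs lt vrs; rewrite -wv.
  have := lex_weight_bound (tperm b r * v)%g; rewrite -/K; lia.
case=> <- /=; apply: (quantum_case b r) => //.
by rewrite ltn_neqAle ge val_perm_inj gtn_eqF.
Qed.

End Linear.
End Transition.

(** * From chains to stars *)

Lemma split_first (T : Type) (P : pred T) s : ~~ all P s ->
  exists s1 z s2, [/\ s = s1 ++ z :: s2, all P s1 & ~~ P z].
Proof.
elim: s => //= z s IH; case Pz: (P z) => /=; last by exists [::], z, s; rewrite Pz.
move=> /IH[s1 [z' [s2 [-> Ps1 Pz']]]].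
by exists (z :: s1), z', s2; rewrite /= Pz.
Qed.

Section Chains.
Variable n : nat.
Implicit Types (u v w : 'S_n) (i j k l a b : 'I_n) (e f : 'I_n * 'I_n) (x y : Snq n)
  (p q s : seq ('I_n * 'I_n)) (B : {set 'I_n}).

Definition edge e := (e.1 < e.2)%N.

Definition disj_edges e f := [&& e.1 != f.1, e.1 != f.2, e.2 != f.1 & e.2 != f.2].

Lemma disj_edgesC e f : disj_edges e f = disj_edges f e.
Proof.
rewrite /disj_edges ![f.1 == _]eq_sym ![f.2 == _]eq_sym.
by case: (e.1 == f.1); case: (e.1 == f.2); case: (e.2 == f.1); case: (e.2 == f.2).
Qed.

(** Walks with the same effect that consist of the same edges. *)
Definition run_equiv s1 s2 := perm_eq s1 s2 /\ forall x, run s1 x = run s2 x.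

Lemma run_equiv_refl s : run_equiv s s. Proof. by split. Qed.

Lemma run_equiv_trans s2 s1 s3 : run_equiv s1 s2 -> run_equiv s2 s3 -> run_equiv s1 s3.
Proof.
by case=> p1 r1 [p2 r2]; split=> [|x]; [exact: perm_trans p1 p2 | rewrite r1 r2].
Qed.

Lemma run_equiv_cat (p q : seq ('I_n * 'I_n)) s1 s2 : run_equiv s1 s2 -> run_equiv (p ++ s1 ++ q) (p ++ s2 ++ q).
Proof.
case=> ps rs; split=> [|x]; first by rewrite perm_cat2l perm_cat2r.
by rewrite !run_cat; case: (run p x) => //= z; rewrite !run_cat rs.
Qed.

Lemma run_equiv_cons e s1 s2 : run_equiv s1 s2 -> run_equiv (e :: s1) (e :: s2).
Proof. by move/(run_equiv_cat [:: e] [::]); rewrite !cats0. Qed.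

Lemma run_equiv_block e s : edge e -> all edge s -> all (disj_edges e) s ->
  run_equiv (e :: s) (rcons s e).
Proof.
move=> he; elim: s => [|f s IH] /=; first by move=> *; apply: run_equiv_refl.
move=> /andP[hf hs] /andP[df ds].
apply: (@run_equiv_trans (f :: e :: s)); last exact/run_equiv_cons/IH.
apply: (run_equiv_cat [::] s (s1 := [:: e; f]) (s2 := [:: f; e])).
split=> [|x]; first by rewrite (perm_catC [:: e] [:: f]).
exact: run_swap.
Qed.

Lemma all_filter_sub (P Q : pred ('I_n * 'I_n)) s : all P s -> all P (filter Q s).
Proof. by move=> h; apply/allP=> z; rewrite mem_filter => /andP[_ /(allP h)]. Qed.

Section Adjacent.
Variable T : pred ('I_n * 'I_n).

(** Try to move the edges in [T] to the front, commuting disjoint edges; either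
    this succeeds, or an edge in [T] meets an edge outside [T] that it shares a
    vertex with. *)
Lemma bubble_sort s : all edge s ->
  (exists p q f e, [/\ ~~ T f, T e, ~~ disj_edges f e & run_equiv s (p ++ [:: f; e] ++ q)])
  \/ run_equiv s (filter T s ++ filter (predC T) s).
Proof.
elim: s => [_|g s IH /= /andP[hg hs]]; first by right; apply: run_equiv_refl.
have [[p [q [f [e [Tf Te d E]]]]]|E] := IH hs.
  by left; exists (g :: p), q, f, e; split=> //; apply: run_equiv_cons.
case Tg: (T g) => /=; first by right; apply: run_equiv_cons.
have [dis|] := boolP (all (disj_edges g) (filter T s)).
  right; apply: (run_equiv_trans (run_equiv_cons g E)).
  rewrite -cat_rcons; apply: (run_equiv_cat [::]  (filter (predC T) s)
    (s1 := g :: filter T s) (s2 := rcons (filter T s) g)).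
  by apply: run_equiv_block => //; apply: all_filter_sub.
move/split_first => [s1 [e [s2 [Es ds1 dge]]]]; left.
exists s1, (s2 ++ filter (predC T) s), g, e; split=> //.
- by rewrite Tg.
- have : e \in filter T s by rewrite Es mem_cat mem_head orbT.
  by rewrite mem_filter => /andP[].
apply: (run_equiv_trans (run_equiv_cons g E)); rewrite Es.
have es1 : all edge s1.
  have : all edge (filter T s) by exact: all_filter_sub.
  by rewrite Es all_cat => /andP[].
have := run_equiv_cat [::] (e :: s2 ++ filter (predC T) s) (run_equiv_block hg es1 ds1).
by rewrite /= cat_rcons -!catA.
Qed.

Lemma bring_together s1 s2 : all edge s1 -> all edge s2 ->
  ~~ all (fun e => all (disj_edges e) s2) s1 ->
  exists p q e f, [/\ e \in s1, f \in s2, ~~ disj_edges e f &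
    run_equiv (s1 ++ s2) (p ++ [:: e; f] ++ q)].
Proof.
elim: s1 => //= e s1 IH /andP[he hs1] hs2.
have [all1|/(IH hs1 hs2)[p [q [e' [f [e's fs d E]]]]]] :=
  boolP (all (fun e => all (disj_edges e) s2) s1); last first.
  move=> _; exists (e :: p), q, e', f; split=> //; first by rewrite inE e's orbT.
  exact: run_equiv_cons.
rewrite andbT => /split_first[p [f [q [Es dp def]]]].
exists p, (q ++ s1), e, f; split=> //; first exact: mem_head.
  by rewrite Es mem_cat mem_head orbT.
have push t : all edge t -> all (fun e => all (disj_edges e) s2) t ->
    run_equiv (t ++ s2) (s2 ++ t).
  elim: t => [|g t IHt] /=; first by rewrite cats0; move=> *; apply: run_equiv_refl.
  move=> /andP[hg ht] /andP[dg dt].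
  apply: (run_equiv_trans (run_equiv_cons g (IHt ht dt))).
  rewrite -cat_rcons; apply: (run_equiv_cat [::] t (s1 := g :: s2) (s2 := rcons s2 g)).
  by apply: run_equiv_block.
apply: (run_equiv_trans (run_equiv_cons e (push s1 hs1 all1))).
rewrite Es; have hp : all edge p by move: hs2; rewrite Es all_cat => /andP[].
have := run_equiv_cat [::] (f :: q ++ s1) (run_equiv_block he hp dp).
by rewrite /= cat_rcons -!catA.
Qed.

(** If some edge in [T] shares a vertex with some edge outside [T], then two such
    edges can be made neighbours by commuting disjoint edges. *)
Lemma adjacent_sharing s : all edge s ->
  ~~ all (fun e => all (disj_edges e) (filter (predC T) s)) (filter T s) ->
  exists p q e f, [/\ T e, ~~ T f, ~~ disj_edges e f &
    run_equiv s (p ++ [:: e; f] ++ q) \/ run_equiv s (p ++ [:: f; e] ++ q)].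
Proof.
move=> hs sh; have [[p [q [f [e [Tf Te d E]]]]]|E] := bubble_sort hs.
  by exists p, q, e, f; split=> //; [rewrite disj_edgesC | right].
have hsP (P : pred ('I_n * 'I_n)) : all edge (filter P s).
  by exact: all_filter_sub.
have [p [q [e [f [es fs d E']]]]] := bring_together (hsP T) (hsP (predC T)) sh.
exists p, q, e, f; split=> //.
- by move: es; rewrite mem_filter => /andP[].
- by move: fs; rewrite mem_filter => /andP[].
by left; apply: run_equiv_trans E E'.
Qed.

End Adjacent.

(** The permutation of the positions performed by a walk from [x] to [y]; it is
    conjugate to the permutation of the values that occurs in the theorem. *)
Definition walk_perm x y : 'S_n := (y.2 * x.2^-1)%g.

Definition stable (z : 'S_n) B := forall i, (z i \in B) = (i \in B).

Definition closed_under s B := all (fun e => (e.1 \in B) == (e.2 \in B)) s.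

Lemma run_stable s x y B : run s x = Some y -> closed_under s B -> stable (walk_perm x y) B.
Proof.
elim: s x => [|e s IH] x /=.
  by case=> -> _ p; rewrite /walk_perm mulgV perm1.
rewrite /qstep; case: ifP => //= _ /IH{}IH /andP[/eqP eB /IH{}IH] p.
have := IH p; rewrite /walk_perm /= invMg tpermV mulgA permM => <-.
by case: tpermP => [->|->|_ _]; rewrite ?eB.
Qed.

(** Each edge that leaves a set of vertices can be absorbed by adding one vertex;
    so the vertices reached from [B] number at most [#|B| + size s]. *)
Lemma closure_exists s B : exists B', [/\ B \subset B', closed_under s B' &
  (#|B'| <= #|B| + size s)%N].
Proof.
have [m] := ubnP (size s); elim: m s B => // m IH s B; rewrite ltnS => sm.
have [cl|/split_first[s1 [e [s2 [Es _ eB]]]]] := boolP (closed_under s B).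
  by exists B; split; rewrite ?leq_addr.
have szE : size s = (size (s1 ++ s2)).+1 by rewrite Es !size_cat /= addnS.
have [|B' [sub cl le]] := IH (s1 ++ s2) (e.1 |: (e.2 |: B)).
  by rewrite -szE.
have eB' : (e.1 \in B') && (e.2 \in B').
  by apply/andP; split; apply: (subsetP sub); rewrite !inE eqxx ?orbT.
exists B'; split.
- by apply: subset_trans sub; rewrite setUA subsetUr.
- move: cl; rewrite /closed_under Es !all_cat /= => /andP[-> ->].
  by case/andP: eB' => -> ->; rewrite eqxx.
apply: (leq_trans le); rewrite szE addnS -addSn leq_add2r.
move: eB; case e1: (e.1 \in B); case e2: (e.2 \in B) => // _.
  have E1 : e.1 |: B = B by apply/setUidPr; rewrite sub1set e1.
  by rewrite setUCA E1 cardsU1 e2.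
by rewrite (_ : e.2 |: B = B) ?cardsU1 ?e1 //; apply/setUidPr; rewrite sub1set.
Qed.

(** For [B] the support of [z], this says that [z] has a single nontrivial
    cycle, in a form that avoids powers of [z]. *)
Definition transitive_on (z : 'S_n) B := forall a B', a \in B -> a \in B' ->
  stable z B' -> B \subset B'.

(** The edges of the walk must connect the [size s + 1] points of the cycle;
    [size s] edges suffice for that only if none of them is wasted on vertices
    outside the cycle. *)
Lemma walk_vertices s x y a (P := supp (walk_perm x y)) : run s x = Some y ->
  transitive_on (walk_perm x y) P -> a \in P -> #|P| = (size s).+1 ->
  all (fun e => (e.1 \in P) && (e.2 \in P)) s.
Proof.
move=> rs tr aP cP.
have clP : closed_under s P.
  have [B [aB clB leB]] := closure_exists s [set a].
  have PB := tr _ _ aP (subsetP aB a (set11 a)) (run_stable rs clB).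
  suff -> : P = B by [].
  by apply/eqP; rewrite eqEcard PB cP (leq_trans leB) // cards1.
pose t := fun e => (e.1 \in P) && (e.2 \in P).
have [B [aB clB leB]] := closure_exists (filter t s) [set a].
have PB : P \subset B :&: P.
  apply: (tr a) => //; first by rewrite inE aP andbT; apply: (subsetP aB); rewrite set11.
  apply: run_stable rs _; apply/allP => e es; rewrite !in_setI.
  have /eqP eP := allP clP e es; have cl := allP clB e.
  rewrite mem_filter es andbT /t /= eP andbb in cl; rewrite eP.
  by case: (e.2 \in P) cl => [/(_ isT)/eqP ->|_]; rewrite ?andbF.
have {}PB : P \subset B by apply: subset_trans PB (subsetIl _ _).
have := leq_trans (subset_leq_card PB) leB.
by rewrite cP cards1 add1n ltnS size_filter all_count eqn_leq count_size.
Qed.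

Definition straddles a e := [&& edge e, e.1 <= a & a <= e.2]%N.
Definition touches a e := (e.1 == a) || (e.2 == a).
Definition other_end a e := if e.1 == a then e.2 else e.1.

Lemma arrow_other_end a e : edge e -> touches a e -> arrow a (other_end a e) = e.
Proof.
case: e => i j; rewrite /edge /touches /other_end /arrow /= => ij.
have [<-|ia] /= := eqVneq i a; first by rewrite ij.
by move=> /eqP ja; rewrite -ja ltnNge (ltnW ij).
Qed.

Lemma other_end_neq a e : edge e -> other_end a e != a.
Proof.
case: e => i j; rewrite /edge /other_end /= => ij.
have [<-|//] := eqVneq i a; by apply: contraTneq ij => ->; rewrite ltnn.
Qed.

#[local] Arguments run n s x : simpl never.

(** The three-term relation with middle index [a]: an edge passing over [a]
    that meets an edge at [a] is replaced, together with it, by two edges at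
    [a]. *)
Lemma run_middle e f a x y : straddles a e -> touches a e -> straddles a f ->
  ~~ touches a f -> ~~ disj_edges e f ->
  run [:: e; f] x = Some y \/ run [:: f; e] x = Some y ->
  exists e' f', [/\ straddles a e', touches a e', straddles a f', touches a f' &
    run [:: e'; f'] x = Some y].
Proof.
case: e f => [i1 j1] [i k]; rewrite /straddles /touches /edge /disj_edges /=.
move=> /and3P[ij1 ia1 aj1] te /and3P[ik ia ak] /norP[nia nka] share.
have {ia nia} ia : (i < a)%N by rewrite ltn_neqAle nia.
have {ak nka} ak : (a < k)%N by rewrite ltn_neqAle eq_sym nka.
have [h1 h1'] := run_tri1 x ia ak; have [h2 h2'] := run_tri2 x ia ak.
have go1 : run [:: (a, k); (i, a)] x = Some y -> exists e' f' : 'I_n * 'I_n,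
   [/\ [&& (e'.1 < e'.2)%N, (e'.1 <= a)%N & (a <= e'.2)%N], (e'.1 == a) || (e'.2 == a),
       [&& (f'.1 < f'.2)%N, (f'.1 <= a)%N & (a <= f'.2)%N], (f'.1 == a) || (f'.2 == a)
     & run [:: e'; f'] x = Some y].
  by move=> E; exists (a, k), (i, a); rewrite /= ia ak (ltnW ia) (ltnW ak) leqnn !eqxx ?orbT.
have go2 : run [:: (i, a); (a, k)] x = Some y -> exists e' f' : 'I_n * 'I_n,
   [/\ [&& (e'.1 < e'.2)%N, (e'.1 <= a)%N & (a <= e'.2)%N], (e'.1 == a) || (e'.2 == a),
       [&& (f'.1 < f'.2)%N, (f'.1 <= a)%N & (a <= f'.2)%N], (f'.1 == a) || (f'.2 == a)
     & run [:: e'; f'] x = Some y].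
  by move=> E; exists (i, a), (a, k); rewrite /= ia ak (ltnW ia) (ltnW ak) leqnn !eqxx ?orbT.
have [ea|ea] : (i1, j1) = (i, a) \/ (i1, j1) = (a, k).
  move: share te; rewrite !negb_and !negbK => share /orP[/eqP e1|/eqP e1]; [right|left].
    move: e1 ia1 ij1 aj1 share => ->.
    by move=> _ aj _ /or4P[] /eqP/(congr1 val)/= e2; try (clear - ia ak aj e2; lia);
       congr (_, _); apply: val_inj.
  move: e1 ia1 ij1 aj1 share => -> ia1 _ _.
  by move=> /or4P[] /eqP/(congr1 val)/= e2; try (clear - ia ak ia1 e2; lia);
     congr (_, _); apply: val_inj.
- case: ea => -> ->; case=> E.
    apply: go1; rewrite h1; move: h1'; case: ifP => //; by rewrite E.
  by apply: go2; rewrite h2; move: h2'; case: ifP => //; rewrite E.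
case: ea => -> ->; case=> E.
  apply: go2; rewrite h2; move: h2'; case: ifP => //; by rewrite E.
by apply: go1; rewrite h1; move: h1'; case: ifP => //; rewrite E.
Qed.

Definition fan a (bs : seq 'I_n) : {set 'I_n} := a |: [set b in bs].

Lemma card_fan a bs : (#|fan a bs| <= (size bs).+1)%N.
Proof.
rewrite /fan cardsU1 cardsE; apply: (@leq_trans (1 + #|bs|)%N).
  by rewrite leq_add2r leq_b1.
by rewrite add1n ltnS card_size.
Qed.

Lemma touch_fan a e bs : touches a e -> other_end a e \in bs ->
  (e.1 \in fan a bs) && (e.2 \in fan a bs).
Proof.
rewrite /touches /other_end !inE.
by have [->|ne] /= := eqVneq e.1 a; [move=> _ -> | move=> /eqP -> ->]; rewrite ?eqxx ?orbT.
Qed.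

Lemma run_cat3 s1 s2 s3 x y : run (s1 ++ s2 ++ s3) x = Some y ->
  exists x1 x2, [/\ run s1 x = Some x1, run s2 x1 = Some x2 & run s3 x2 = Some y].
Proof.
rewrite !run_cat; case E1: (run s1 x) => [x1|] //=.
rewrite run_cat; case E2: (run s2 x1) => [x2|] //= E3.
by exists x1, x2.
Qed.

(** Induction on the number of edges that do not have [a] as an end.  As long as
    there is one, connectedness of the walk yields an edge passing over [a] and
    sharing a vertex with an edge at [a]; make them neighbours and apply
    [run_middle].  In the end, the other ends of the edges are distinct because
    the walk visits [size s + 1] vertices. *)
Theorem chain_to_star a s x y (P := supp (walk_perm x y)) :
  all (straddles a) s -> run s x = Some y ->
  transitive_on (walk_perm x y) P -> a \in P -> #|P| = (size s).+1 ->
  exists bs, [/\ a \notin bs, uniq bs, size bs = size s & run (star a bs) x = Some y].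
Proof.
move=> + + tr aP; have [m] := ubnP (count (predC (touches a)) s).
elim: m s => // m IH s; rewrite ltnS => cm sts rs cP.
have edges : all edge s by apply: sub_all sts => e /and3P[].
have fan_big bs : closed_under s (fan a bs) -> (size s <= size bs)%N.
  move=> cl; have aV : a \in fan a bs by rewrite !inE eqxx.
  have := subset_leq_card (tr a _ aP aV (run_stable rs cl)).
  by rewrite cP => /leq_trans/(_ (card_fan a bs)).
have [allT|nallT] := boolP (all (touches a) s).
  pose bs := map (other_end a) s; have sz : size bs = size s by rewrite size_map.
  have stE : star a bs = s.
    rewrite /star -map_comp -[RHS]map_id; apply/eq_in_map => e es /=.
    by rewrite arrow_other_end ?(allP edges) ?(allP allT).
  have abs : a \notin bs.
    by apply/mapP => -[e es ae]; have := other_end_neq a (allP edges e es); rewrite -ae eqxx.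
  have cl : closed_under s (fan a (undup bs)).
    apply/allP => e es; have /andP[-> ->] // : (e.1 \in fan a (undup bs)) && (e.2 \in fan a (undup bs)).
    by apply: touch_fan; rewrite ?(allP allT) ?mem_undup ?map_f.
  exists bs; split; rewrite ?stE //.
  by have := fan_big _ cl; rewrite -sz leqNgt ltn_size_undup negbK.
have share : ~~ all (fun e => all (disj_edges e) (filter (predC (touches a)) s))
    (filter (touches a) s).
  apply/negP => /allP dis.
  pose bs := map (other_end a) (filter (touches a) s).
  have cl : closed_under s (fan a bs).
    apply/allP => e es; have [te|nte] := boolP (touches a e).
      have /andP[-> ->] // : (e.1 \in fan a bs) && (e.2 \in fan a bs).
      by apply: touch_fan; rewrite // map_f // mem_filter te.
    have out c : (c == e.1) || (c == e.2) -> c \notin fan a bs.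
      move=> ce; rewrite !inE negb_or; apply/andP; split.
        by case/norP: nte => n1 n2; case/orP: ce => /eqP->.
      apply/mapP => -[g]; rewrite mem_filter => /andP[tg gs] cg.
      have /dis/allP/(_ e) : g \in filter (touches a) s by rewrite mem_filter tg.
      rewrite mem_filter /= nte es => /(_ isT)/and4P[d1 d2 d3 d4].
      move: ce; rewrite cg /other_end; case: ifP => _.
        by rewrite (negPf d3) (negPf d4).
      by rewrite (negPf d1) (negPf d2).
    by rewrite !(negPf (out _ _)) ?eqxx ?orbT.
  have := fan_big _ cl; rewrite size_map size_filter leqNgt ltn_neqAle count_size andbT.
  by rewrite -all_count nallT.
have [p [q [e [f [te ntf nd E]]]]] := adjacent_sharing edges share.
have [t [pt rt runt]] : exists t, [/\ perm_eq s (p ++ t ++ q),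
    t = [:: e; f] \/ t = [:: f; e] & run (p ++ t ++ q) x = Some y].
  by case: E => -[pe re]; [exists [:: e; f] | exists [:: f; e]]; rewrite -re; split; auto.
have {}rt : perm_eq t [:: e; f] /\ forall z z', run t z = Some z' ->
    run [:: e; f] z = Some z' \/ run [:: f; e] z = Some z'.
  by case: rt => ->; split; auto; rewrite (perm_catC [:: f] [:: e]).
case: rt => pef rt.
have [x1 [x2 [r1 r2 r3]]] := run_cat3 runt.
have all_s : all (straddles a) (p ++ [:: e; f] ++ q).
  rewrite -(perm_all (s1 := s)) //; apply: (perm_trans pt).
  by rewrite perm_cat2l perm_cat2r.
have /andP[ste stf] : straddles a e && straddles a f.
  by move: all_s; rewrite !all_cat /= => /and3P[_ /and3P[-> -> _] _].
have [e' [f' [ste' te' stf' tf' r2']]] := run_middle ste te stf ntf nd (rt _ _ r2).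
have {}pt : perm_eq s (p ++ [:: e; f] ++ q).
  by apply: (perm_trans pt); rewrite perm_cat2l perm_cat2r.
have szE : size (p ++ [:: e'; f'] ++ q) = size s by rewrite (perm_size pt) !size_cat.
have [||||bs [abs ubs sbs rbs]] := IH (p ++ [:: e'; f'] ++ q).
- apply: leq_trans cm; rewrite (seq.permP pt) !count_cat /= te te' tf' ntf.
  by rewrite ltn_add2l.
- by move: all_s; rewrite !all_cat /= ste' stf' => /and3P[-> _ ->].
- rewrite run_cat r1 -[obind _ _]/(run ([:: e'; f'] ++ q) x1) run_cat r2'.
  exact: r3.
- by rewrite szE.
by exists bs; rewrite sbs szE.
Qed.

End Chains.

(** * From stars to chains *)

Section Stars.
Variable n : nat.
Implicit Types (u v w : 'S_n) (i j k l m a b : 'I_n) (e f : 'I_n * 'I_n) (x y : Snq n)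
  (s : seq ('I_n * 'I_n)) (bs p q : seq 'I_n).
#[local] Arguments run n s x : simpl never.

(** The edges of the k-Bruhat order with [k = c]. *)
Definition crosses (c : nat) e := (e.1 < c <= e.2)%N.

Lemma arrow_lt a b : (a < b)%N -> arrow a b = (a, b).
Proof. by rewrite /arrow => ->. Qed.

Lemma arrow_gt a b : (b < a)%N -> arrow a b = (b, a).
Proof. by move=> ba; rewrite /arrow ltnNge (ltnW ba). Qed.

Definition opposite a l m := (l < a < m)%N || (m < a < l)%N.

(** The three-term relation read backwards: two edges at [a] on opposite sides
    are replaced by one edge at [a] and one passing over [a]. *)
Lemma run_middle_inv a l m x y : opposite a l m ->
  run [:: arrow a l; arrow a m] x = Some y ->
  run [:: arrow l m; arrow a l] x = Some y \/ run [:: arrow a m; arrow l m] x = Some y.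
Proof.
case/orP=> /andP[h1 h2].
  rewrite (arrow_gt h1) (arrow_lt h2) (arrow_lt (ltn_trans h1 h2)).
  have [-> _] := run_tri2 x h1 h2; case: ifP => _ ->; by [left | right].
rewrite (arrow_gt h1) (arrow_lt h2) (arrow_gt (ltn_trans h1 h2)).
have [-> _] := run_tri1 x h1 h2; case: ifP => _ ->; by [left | right].
Qed.

Lemma star_sides a bs : a \notin bs ->
  [\/ all (fun b => b < a)%N bs, all (fun b => a < b)%N bs |
      exists p l m q, bs = p ++ [:: l; m] ++ q /\ opposite a l m].
Proof.
elim: bs => [_|b bs IH]; first by constructor 1.
rewrite inE negb_or => /andP[ab /IH{}IH].
have /orP ab' : (b < a)%N || (a < b)%N by rewrite -neq_ltn eq_sym.
case: IH => [h|h|[p [l [m [q [-> o]]]]]]; last first.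
- by constructor 3; exists (b :: p), l, m, q.
- case: ab' => hb; last by constructor 2; rewrite /= hb.
  case: bs h => [_|c bs /= /andP[ac _]]; first by constructor 1; rewrite /= hb.
  by constructor 3; exists [::], b, c, bs; rewrite /opposite hb ac.
- case: ab' => hb; first by constructor 1; rewrite /= hb.
  case: bs h => [_|c bs /= /andP[ac _]]; first by constructor 2; rewrite /= hb.
  by constructor 3; exists [::], b, c, bs; rewrite /opposite hb ac orbT.
Qed.

Lemma arrow_edge a b : a != b -> edge (arrow a b).
Proof. by rewrite /edge /arrow neq_ltn; case: ltngtP. Qed.

Lemma arrow_disj a l m bs : l != a -> m != a -> l \notin bs -> m \notin bs ->
  all (disj_edges (arrow l m)) (star a bs).
Proof.
move=> la ma lb mb; rewrite all_map; apply/allP => b bb /=.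
have [lb' mb'] : l != b /\ m != b by split; [apply: contraNneq lb => -> | apply: contraNneq mb => ->].
by rewrite /disj_edges /arrow; case: ifP; case: ifP => _ _ /=; rewrite ?la ?ma ?lb' ?mb'.
Qed.

Lemma star_edges a bs : a \notin bs -> all (@edge n) (star a bs).
Proof.
move=> abs; rewrite all_map; apply/allP => b bb /=; apply: arrow_edge.
by apply: contraNneq abs => ->.
Qed.

(** If all neighbours lie on one side of [a], all edges cross the cut [a] or all
    cross the cut [a.+1].  Otherwise two consecutive neighbours are on opposite
    sides, and [run_middle_inv] produces an edge that crosses both cuts and
    commutes to the front or to the back of a shorter star. *)
Theorem star_to_chain a bs x y : a \notin bs -> uniq bs -> run (star a bs) x = Some y ->
  exists s, [/\ size s = size bs, run s x = Some y &
    all (crosses a) s \/ all (crosses a.+1) s].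
Proof.
have [N] := ubnP (size bs); elim: N bs x y => // N IH bs x y; rewrite ltnS => sz abs ubs.
have [h|h|[p [l [m [q [E o]]]]]] := star_sides abs.
- move=> rs; exists (star a bs); split; rewrite ?size_map //; left.
  rewrite all_map; apply: sub_all h => b /= ba.
  by rewrite arrow_gt // /crosses /= ba leqnn.
- move=> rs; exists (star a bs); split; rewrite ?size_map //; right.
  rewrite all_map; apply: sub_all h => b /= ba.
  by rewrite arrow_lt // /crosses /= ltnSn.
subst bs; set bs := p ++ [:: l; m] ++ q in sz abs ubs *.
have pbs : perm_eq bs ([:: l; m] ++ (p ++ q)) by rewrite perm_catCA.
have := abs; rewrite (perm_mem pbs) !inE !negb_or => /and3P[al am apq].
have := ubs; rewrite (perm_uniq pbs) /= inE negb_or => /and3P[/andP[lm lpq] mpq upq].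
rewrite !mem_cat !negb_or in apq lpq mpq.
move/andP: apq => [ap aq]; move/andP: lpq => [lp lq]; move/andP: mpq => [mp mq].
rewrite eq_sym in al; rewrite eq_sym in am.
have szpq b : size (p ++ b :: q) = (size bs).-1.
  by rewrite (perm_size pbs) !size_cat /= addnS.
have shorter b : (size (p ++ b :: q) < N)%N.
  by rewrite szpq; apply: leq_trans sz; rewrite (perm_size pbs).
have sub_ok b : (b == l) || (b == m) -> (a \notin p ++ b :: q) && uniq (p ++ b :: q).
  move=> bl; have [ab bp bq] : [/\ a != b, b \notin p & b \notin q].
    by case/orP: bl => /eqP ->; rewrite eq_sym.
  by rewrite -cat_rcons -cats1 -catA mem_cat negb_or ap uniq_catCA /= inE negb_or ab aq
             mem_cat negb_or bp bq upq.
have hlm := arrow_edge lm.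
move=> rs; have [x1 [x2 [r1 r2 r3]]] : exists x1 x2, [/\ run (star a p) x = Some x1,
    run [:: arrow a l; arrow a m] x1 = Some x2 & run (star a q) x2 = Some y].
  by apply: run_cat3; move: rs; rewrite /bs /star !map_cat.
have cross_lm : crosses a (arrow l m) && crosses a.+1 (arrow l m).
  case/orP: o => /andP[h1 h2].
    by rewrite (arrow_lt (ltn_trans h1 h2)) /crosses /= ltnS h1 h2 (ltnW h1) (ltnW h2).
  by rewrite (arrow_gt (ltn_trans h1 h2)) /crosses /= ltnS h1 h2 (ltnW h1) (ltnW h2).
case: (run_middle_inv o r2) => r2'.
- have rs' : run (arrow l m :: star a (p ++ l :: q)) x = Some y.
    have [_ E] := run_equiv_block hlm (star_edges ap) (arrow_disj al am lp mp).
    rewrite /star map_cat -cat_cons run_cat E -cats1 run_cat r1.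
    change (obind (run (star a (l :: q))) (run [:: arrow l m] x1) = Some y).
    rewrite -run_cat; change (run ([:: arrow l m; arrow a l] ++ star a q) x1 = Some y).
    by rewrite run_cat r2'.
  move: rs'; rewrite (run_cat [:: arrow l m]); case E: (run [:: arrow l m] x) => [x'|] //= rs'.
  have /andP[h1 h2] := sub_ok l (introT orP (or_introl (eqxx l))).
  have [s [ss rs2 cs]] := IH _ x' y (shorter l) h1 h2 rs'.
  exists (arrow l m :: s); split.
  + by rewrite /= ss szpq (perm_size pbs).
  + by rewrite (run_cat [:: arrow l m] s) E.
  by case/andP: cross_lm => c1 c2; case: cs => cs; [left|right]; rewrite /= ?c1 ?c2.
have rs' : run (star a (p ++ m :: q) ++ [:: arrow l m]) x = Some y.
  have E := run_equiv_block hlm (star_edges aq) (arrow_disj al am lq mq).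
  have [_ {}E] := run_equiv_cat (star a p ++ [:: arrow a m]) [::] E.
  move: E; rewrite !cats0 -cats1 -!catA => /(_ x) E.
  rewrite /star map_cat /= -catA -[X in run X]/(star a p ++ [:: arrow a m] ++ star a q ++ [:: arrow l m]).
  rewrite -E run_cat r1; change (run ([:: arrow a m; arrow l m] ++ star a q) x1 = Some y).
  by rewrite run_cat r2'.
move: rs'; rewrite run_cat; case E: (run (star a (p ++ m :: q)) x) => [y'|] //= rs'.
have /andP[h1 h2] := sub_ok m (introT orP (or_intror (eqxx m))).
have [s [ss rs2 cs]] := IH _ x y' (shorter m) h1 h2 E.
exists (s ++ [:: arrow l m]); split.
+ by rewrite size_cat ss szpq addn1 (perm_size pbs).
+ by rewrite run_cat rs2.
by case/andP: cross_lm => c1 c2; case: cs => cs; [left|right]; rewrite all_cat cs /= ?c1 ?c2.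
Qed.

End Stars.

(** * Endpoints of star walks *)

Section StarFacts.
Variable n : nat.
Implicit Types (u v w : 'S_n) (i j k l m a b : 'I_n) (e f : 'I_n * 'I_n) (x y : Snq n)
  (s : seq ('I_n * 'I_n)) (bs p q : seq 'I_n) (B : {set 'I_n}).
#[local] Arguments run n s x : simpl never.

Lemma star_cons a b bs x y : run (star a (b :: bs)) x = Some y ->
  exists x1, [/\ qstep (arrow a b) x = Some x1, x1.2 = (tperm a b * x.2)%g,
    run (star a bs) x1 = Some y & walk_perm x y = (walk_perm x1 y * tperm a b)%g].
Proof.
rewrite -[run _ _]/(obind (run (star a bs)) (qstep (arrow a b) x)).
case E: (qstep _ x) => [x1|] //= rs; exists x1.
have E2 : x1.2 = (tperm a b * x.2)%g.
  move: E; rewrite /qstep /arrow; case: ifP => // _; case=> <- /=.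
  by case: ifP; rewrite // tpermC.
by split=> //; rewrite /walk_perm E2 invMg tpermV -!mulgA tperm2 mulg1.
Qed.

Lemma star_fixed a bs x y b : run (star a bs) x = Some y -> b \notin a :: bs ->
  walk_perm x y b = b.
Proof.
elim: bs x => [|c bs IH] x; first by case=> -> _; rewrite /walk_perm mulgV perm1.
case/star_cons => x1 [_ _ rs ->]; rewrite !inE !negb_or => /and3P[ba bc bbs].
by rewrite permM (IH _ rs) ?tpermD 1?eq_sym // inE negb_or ba.
Qed.

Lemma walk_permE x y b : x.2 (walk_perm x y b) = y.2 b.
Proof. by rewrite /walk_perm permM permKV. Qed.

Lemma star_fixed_val a bs x y b : run (star a bs) x = Some y -> b \notin a :: bs ->
  y.2 b = x.2 b.
Proof. by move=> rs /(star_fixed rs) E; rewrite -(walk_permE x y) E. Qed.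

Lemma star_head a b bs x y : run (star a (b :: bs)) x = Some y -> a \notin b :: bs ->
  b \notin bs -> walk_perm x y b = a.
Proof.
case/star_cons => x1 [_ _ rs ->]; rewrite inE negb_or => /andP[ab _] bbs.
by rewrite permM (star_fixed rs) ?tpermR // inE negb_or eq_sym ab.
Qed.

(** The permutation sends the first neighbour to the centre, so a stable set that
    contains the centre contains all neighbours one after another. *)
Lemma star_transitive a bs x y B : run (star a bs) x = Some y -> a \notin bs -> uniq bs ->
  a \in B -> stable (walk_perm x y) B -> {subset bs <= B}.
Proof.
elim: bs x => [|b bs IH] x //= rs abs /andP[bbs ubs] aB st.
have bB : b \in B by rewrite -(st b) (star_head rs).
have abs' : a \notin bs by move: abs; rewrite inE negb_or => /andP[].
have [x1 [_ _ rs1 Ew]] := star_cons rs.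
have st1 : stable (walk_perm x1 y) B.
  move=> d; rewrite -(st d) Ew (permM (walk_perm x1 y)).
  by case: tpermP => [->|->|_ _]; rewrite ?aB ?bB.
by move=> c; rewrite inE => /orP[/eqP->//|]; apply: IH rs1 abs' ubs aB st1 c.
Qed.

Lemma star_supp a bs x y : run (star a bs) x = Some y -> a \notin bs -> uniq bs ->
  (0 < size bs)%N -> supp (walk_perm x y) = fan a bs.
Proof.
move=> rs abs ubs sz; apply/setP => b; rewrite !inE.
apply/idP/idP => [|bin]; first by apply: contraR; rewrite -in_cons => /(star_fixed rs) ->.
apply/negP => /eqP fixb.
have stb : stable (walk_perm x y) [set b].
  by move=> c; rewrite !inE -{1}fixb (inj_eq perm_inj).
have [ba|ba] := eqVneq b a.
  case: bs rs abs ubs sz bin => // c bs rs abs ubs _ _.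
  have := star_transitive rs abs ubs (B := [set b]).
  rewrite ba inE eqxx -ba => /(_ isT stb c (mem_head _ _)).
  by rewrite inE ba => /eqP ca; rewrite ca mem_head in abs.
have stc : stable (walk_perm x y) (~: [set b]) by move=> c; rewrite !in_setC stb.
have := star_transitive rs abs ubs (B := ~: [set b]).
rewrite !inE eq_sym ba => /(_ isT stc b).
by move: bin; rewrite (negPf ba) /= => -> /(_ isT); rewrite !inE eqxx.
Qed.

(** The endpoint determines the star walk: the first neighbour is the preimage of
    the centre. *)
Lemma star_inj a bs bs' x y y' : run (star a bs) x = Some y -> run (star a bs') x = Some y' ->
  a \notin bs -> uniq bs -> a \notin bs' -> uniq bs' -> size bs = size bs' ->
  walk_perm x y = walk_perm x y' -> bs = bs'.
Proof.
elim: bs bs' x => [|b bs IH] [|b' bs'] //= x rs rs' abs /andP[bbs ubs] abs' /andP[bbs' ubs'].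
case=> sz Ew.
have Eb : b = b'.
  apply: (@perm_inj _ (walk_perm x y)); rewrite (star_head rs) // Ew.
  by rewrite (star_head rs').
subst b'; congr (_ :: _).
have [x1 [E1 _ rs1 Ew1]] := star_cons rs; have [x1' [E1' _ rs1' Ew1']] := star_cons rs'.
have Ex : x1' = x1 by apply: Some_inj; rewrite -E1 -E1'.
rewrite Ex in rs1' Ew1'.
move: abs abs'; rewrite !inE !negb_or => /andP[_ abs] /andP[_ abs'].
apply: (IH bs' x1) => //; apply: (mulIg (tperm a b)); by rewrite -Ew1 -Ew1'.
Qed.

(** The exponent of the variable attached to the cut between the positions
    [c - 1] and [c], with value 0 at both ends of the row of positions. *)
Definition cut (al : 'X_{1..n.-1}) (c : nat) : nat :=
  if c is c'.+1 then oapp al 0%N (insub c' : option 'I_n.-1) else 0%N.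

Lemma cutD al be c : cut (al + be)%MM c = (cut al c + cut be c)%N.
Proof. by case: c => //= c; case: insubP => //= z _ _; rewrite mnmDE. Qed.

Lemma cut_qexp i j c : cut (qexp n i j) c = (i < c <= j)%N :> nat.
Proof.
case: c => [|c] /=; first by lia.
case: insubP => [z zn cz|nz] /=; first by rewrite mnmE cz.
have := ltn_ord j; move: nz; lia.
Qed.

Lemma cut_step e x y c : qstep e x = Some y ->
  cut y.1 c = (cut x.1 c + (x.2 e.2 < x.2 e.1) * (e.1 < c <= e.2))%N.
Proof.
rewrite /qstep; case: ifP => // _; case=> <- /=; rewrite cutD; congr (_ + _)%N.
case: ifP => _; first by rewrite cut_qexp mul1n.
by case: c => //= c; case: insubP => //= z _ _; rewrite mnm0E.
Qed.

(** In a star walk, a position [b] other than the centre changes its value only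
    once.  If [b] is to the left of the centre and this step goes down, then
    the edge carries the cut just after [b] but not the one just before [b], and
    symmetrically on the right. *)
Lemma cut_star a bs x y b : run (star a bs) x = Some y -> a \notin bs -> uniq bs -> b != a ->
  if (b < a)%N then cut y.1 b.+1 + cut x.1 b = cut y.1 b + cut x.1 b.+1 + (y.2 b < x.2 b)%N
  else cut y.1 b + cut x.1 b.+1 = cut y.1 b.+1 + cut x.1 b + (x.2 b < y.2 b)%N.
Proof.
move=> + + + ba; elim: bs x => [|d bs IH] x rs abs ubs.
  by case: rs => ->; case: ifP; rewrite ltnn; lia.
have [x1 [E1 E2 rs1 _]] := star_cons rs.
move: abs ubs; rewrite inE negb_or /= => /andP[ad abs] /andP[dbs ubs].
have := IH _ rs1 abs ubs; rewrite !(cut_step _ E1).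
have [bd|bd] := eqVneq b d.
  have bv : y.2 b = x1.2 b by apply: star_fixed_val rs1 _; rewrite inE negb_or ba bd.
  rewrite bv E2 permM -bd tpermR /arrow.
  by case: (ltngtP b a) ba => [lt|lt|/val_inj ->]; rewrite ?eqxx //= => _; lia.
have -> : x1.2 b = x.2 b by rewrite E2 permM tpermD // eq_sym.
have na : (b != a :> nat) := ba; have nd : (b != d :> nat) := bd.
by rewrite /arrow; case: (ltnP a d) => ? /=; case: ifP => ?; lia.
Qed.

End StarFacts.

(** * Stars and chains with the same endpoint *)

Section Reach.
Variable n : nat.
Implicit Types (u v w : 'S_n) (i j k l m a b : 'I_n) (e f : 'I_n * 'I_n) (x y : Snq n)
  (s : seq ('I_n * 'I_n)) (bs p q : seq 'I_n) (B : {set 'I_n}).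
#[local] Arguments run n s x : simpl never.
#[local] Arguments cut n al c : simpl never.

(** The permutation performed by the walk is a single cycle of length [r.+1]. *)
Definition cyclic_walk (r : nat) x y :=
  #|supp (walk_perm x y)| = r.+1 /\ transitive_on (walk_perm x y) (supp (walk_perm x y)).

Definition chain_to (c r : nat) x y := cyclic_walk r x y /\
  exists s, [/\ size s = r, run s x = Some y & all (crosses c) s].

Definition star_to a (r : nat) x y := exists bs,
  [/\ a \notin bs, uniq bs, size bs = r & run (star a bs) x = Some y].

Lemma star_cyclic a r x y : (0 < r)%N -> star_to a r x y ->
  cyclic_walk r x y /\ a \in supp (walk_perm x y).
Proof.
move=> r0 [bs [abs ubs sz rs]]; have sup : supp (walk_perm x y) = fan a bs.
  by apply: star_supp => //; rewrite sz.
split; last by rewrite sup !inE eqxx.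
split.
  rewrite sup /fan cardsU1 cardsE inE abs add1n; congr _.+1.
  by rewrite -sz; apply/card_uniqP.
move=> b B bs' bB st.
have ab : a \in B.
  apply/negPn/negP => aB.
  have st' : stable (walk_perm x y) (~: B) by move=> d; rewrite !in_setC st.
  have H := star_transitive rs abs ubs (B := ~: B).
  rewrite in_setC aB in H; have {}H := H isT st'.
  have : b \in ~: B; last by rewrite in_setC bB.
  move: bs'; rewrite sup !inE => /orP[/eqP ->|/H]; by rewrite ?inE ?aB.
have H := star_transitive rs abs ubs ab st.
by apply/subsetP => d; rewrite sup !inE => /orP[/eqP ->|/H].
Qed.

Lemma star_to_chain_to a r x y : (0 < r)%N -> star_to a r x y ->
  chain_to a r x y \/ chain_to a.+1 r x y.
Proof.
move=> r0 st; have [cw _] := star_cyclic r0 st; case: st => bs [abs ubs sz rs].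
have [s [ss rs2 cs]] := star_to_chain abs ubs rs.
by case: cs => cs; [left|right]; split=> //; exists s; rewrite ss.
Qed.

Lemma chain_vertices r x y s : (0 < r)%N -> cyclic_walk r x y -> size s = r ->
  run s x = Some y ->
  all (fun e => (e.1 \in supp (walk_perm x y)) && (e.2 \in supp (walk_perm x y))) s.
Proof.
move=> r0 [cP tr] sz rs.
have [a aP] : exists a, a \in supp (walk_perm x y) by apply/card_gt0P; rewrite cP.
by apply: walk_vertices rs tr aP _; rewrite cP sz.
Qed.

(** If no support position lies strictly between [a] and the cut [c], then the
    edges of the chain pass over [a] or end there. *)
Lemma chain_to_star_at c r x y a : (0 < r)%N -> chain_to c r x y ->
  a \in supp (walk_perm x y) ->
  (forall b, b \in supp (walk_perm x y) -> if (b < c)%N then (b <= a)%N else (a <= b)%N) ->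
  star_to a r x y.
Proof.
move=> r0 [cw [s [sz rs cs]]] aP H; have vs := chain_vertices r0 cw sz rs.
case: cw => cP tr.
have st : all (straddles a) s.
  apply/allP => e es; have /andP[e1 e2] := allP vs e es.
  have /andP[ec ce] := allP cs e es.
  have := H _ e1; have := H _ e2; rewrite ec ltnNge ce /= /straddles /edge => -> ->.
  by rewrite !andbT (leq_trans ec ce).
have [|bs [abs ubs sbs rbs]] := chain_to_star st rs tr aP; first by rewrite cP sz.
by exists bs; rewrite sbs sz.
Qed.

Lemma chain_to_star_above c r x y : (0 < r)%N -> chain_to c r x y ->
  exists2 a, star_to a r x y & (c <= a)%N.
Proof.
move=> r0 ch; have [cw [s [sz rs cs]]] := ch; have vs := chain_vertices r0 cw sz rs.
case: s sz rs cs vs => [|e s]; first by move=> sz; rewrite -sz in r0.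
move=> _ _ /= /andP[/andP[ec ce] _] /andP[/andP[_ e2P] _].
have h2 : (e.2 \in supp (walk_perm x y)) && (c <= e.2)%N by rewrite e2P.
have [a /andP[aP ca] amin] := arg_minnP (P := fun a => (a \in supp (walk_perm x y)) && (c <= a)%N) val h2.
exists a => //; apply: chain_to_star_at ch aP _ => // b bP.
by case: ltnP => [bc|cb]; [apply: ltnW (leq_trans bc ca) | apply: amin; rewrite bP].
Qed.

Lemma chain_to_star_below c r x y : (0 < r)%N -> chain_to c r x y ->
  exists2 a, star_to a r x y & (a < c)%N.
Proof.
move=> r0 ch; have [cw [s [sz rs cs]]] := ch; have vs := chain_vertices r0 cw sz rs.
case: s sz rs cs vs => [|e s]; first by move=> sz; rewrite -sz in r0.
move=> _ _ /= /andP[/andP[ec ce] _] /andP[/andP[e1P _] _].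
have h1 : (e.1 \in supp (walk_perm x y)) && (e.1 < c)%N by rewrite e1P.
have [a /andP[aP ca] amax] := arg_maxnP (P := fun a => (a \in supp (walk_perm x y)) && (a < c)%N) val h1.
exists a => //; apply: chain_to_star_at ch aP _ => // b bP.
by case: ltnP => [bc|cb]; [apply: amax; rewrite bP | apply: ltnW (leq_trans ca cb)].
Qed.

(** For [b] left of the cut, regard the chain as a star centred right of the cut,
    for [b] right of the cut as one centred left of it; then [cut_star]
    applies. *)
Lemma chain_cut c r x y b : (0 < r)%N -> chain_to c r x y ->
  if (b < c)%N then (cut y.1 b.+1 + cut x.1 b = cut y.1 b + cut x.1 b.+1 + (y.2 b < x.2 b))%N
  else (cut y.1 b + cut x.1 b.+1 = cut y.1 b.+1 + cut x.1 b + (x.2 b < y.2 b))%N.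
Proof.
move=> r0 ch; case: ltnP => bc.
  have [a [bs [abs ubs sz rs]] ca] := chain_to_star_above r0 ch.
  have ba : (b < a)%N := leq_trans bc ca.
  have nba : b != a by apply: contraTneq ba => ->; rewrite ltnn.
  by have := cut_star rs abs ubs nba; rewrite ba.
have [a [bs [abs ubs sz rs]] ca] := chain_to_star_below r0 ch.
have ab : (a < b)%N := leq_trans ca bc.
have nba : b != a by apply: contraTneq ab => ->; rewrite ltnn.
by have := cut_star rs abs ubs nba; rewrite ltnNge (ltnW ab).
Qed.

Lemma supp_walk x y a : (a \in supp (walk_perm x y)) = (y.2 a != x.2 a).
Proof. by rewrite inE -(walk_permE x y) (inj_eq perm_inj). Qed.

(** By [chain_cut] for both cuts, the same difference of exponents would say that
    the value at [a] goes down and that it goes up. *)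
Lemma chain_exclusive a r x y : (0 < r)%N -> a \in supp (walk_perm x y) ->
  chain_to a r x y -> ~ chain_to a.+1 r x y.
Proof.
move=> r0 aP ch ch'; have := chain_cut a r0 ch; have := chain_cut a r0 ch'.
rewrite ltnn ltnSn; rewrite supp_walk in aP.
have {}aP : (y.2 a != x.2 a :> nat) := aP.
move: aP; lia.
Qed.

Lemma chain_to_skip a r x y : (0 < r)%N -> a \notin supp (walk_perm x y) ->
  chain_to a r x y <-> chain_to a.+1 r x y.
Proof.
move=> r0 aP.
have E s : cyclic_walk r x y -> size s = r -> run s x = Some y ->
    all (crosses a) s = all (crosses a.+1) s.
  move=> cw sz rs; have vs := chain_vertices r0 cw sz rs.
  apply: eq_in_all => -[i j] /(allP vs)/andP[/= iP jP].
  have n1 : (i != a :> nat) by apply: contraNneq aP => /val_inj <-.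
  have n2 : (j != a :> nat) by apply: contraNneq aP => /val_inj <-.
  by rewrite /crosses /=; move: n1 n2; clear; lia.
by split=> -[cw [s [sz rs cs]]]; split=> //; exists s; rewrite ?(E s) // -?(E s).
Qed.

Lemma chain_to_star_self a (c : nat) r x y : (0 < r)%N -> (c == a :> nat) || (c == a.+1) ->
  a \in supp (walk_perm x y) -> chain_to c r x y -> star_to a r x y.
Proof.
move=> r0 ca aP ch; apply: chain_to_star_at ch aP _ => // b _.
by case/orP: ca => /eqP ->; case: ltnP => // /ltnW.
Qed.

(** The exponent of the sign that the endpoint of a chain receives. *)
Definition low_support (c : nat) x y := #|[set a in supp (walk_perm x y) | (a < c)%N]|.

Lemma card_belowS B a : #|[set b in B | (b < a.+1)%N]|
  = ((a \in B) + #|[set b in B | (b < a)%N]|)%N.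
Proof.
have [aP|aP] := boolP (a \in B).
  have -> : [set b in B | (b < a.+1)%N] = a |: [set b in B | (b < a)%N].
    apply/setP => b; rewrite !inE ltnS leq_eqVlt.
    have [->|ba] /= := eqVneq b a; first by rewrite aP eqxx.
    by rewrite (inj_eq val_inj) (negPf ba).
  by rewrite cardsU1 !inE ltnn andbF.
apply: eq_card => b; rewrite !inE ltnS leq_eqVlt; case bP: (b \in B) => //=.
by rewrite (inj_eq val_inj); case: eqP => // ba; rewrite -ba bP in aP.
Qed.

Lemma low_supportS a x y : low_support a.+1 x y
  = ((a \in supp (walk_perm x y)) + low_support a x y)%N.
Proof. exact: card_belowS. Qed.

(** The number of positions before the cut whose value decreases equals the number
    of positions after the cut whose value increases, because by [chain_cut] the
    exponents of the cuts rise by the former and fall by the latter, from 0 to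
    0.  So the ascents are as many as the support positions before the cut. *)
Lemma chain_ht c u r y : (0 < r)%N -> (c <= n)%N -> chain_to c r (0%MM, u) y ->
  ht (u^-1 * y.2)%g = low_support c (0%MM, u) y.
Proof.
move=> r0 cn ch.
have -> : ht (u^-1 * y.2)%g = (\sum_b (u b < y.2 b)%N)%N.
  rewrite /ht -sum1dep_card big_mkcond /= (reindex_inj (@perm_inj _ u)) /=.
  by apply: eq_bigr => b _; rewrite permM permK; case: ltnP.
have -> : low_support c (0%MM, u) y = (\sum_b (y.2 b != u b) && (b < c)%N)%N.
  rewrite /low_support -sum1dep_card big_mkcond /=.
  by apply: eq_bigr => b _; rewrite supp_walk; case: ifP.
have cut0 d : cut (0%MM : 'X_{1..n.-1}) d = 0%N.
  by case: d => [|d]; rewrite /cut //; case: insubP => //= z _ _; rewrite mnm0E.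
(* The exponent of the cut [N] is accumulated from the positions before it. *)
have telescope N : (N <= n)%N -> (\sum_(b < n | (b < N)%N) ((b < c) * (y.2 b < u b))
   = cut y.1 N + \sum_(b < n | (b < N)%N) ((c <= b) * (u b < y.2 b)))%N.
  elim: N => [|N IH] Nn; first by rewrite !big_pred0.
  have step (F : 'I_n -> nat) : (\sum_(b < n | (b < N.+1)%N) F b
      = F (Ordinal Nn) + \sum_(b < n | (b < N)%N) F b)%N.
    rewrite (bigD1 (Ordinal Nn)) /=; last by [].
    congr (_ + _)%N; apply: eq_bigl => b.
    by rewrite -(inj_eq val_inj) /= ltnS; case: ltngtP.
  rewrite !step (IH (ltnW Nn)).
  have := chain_cut (Ordinal Nn) r0 ch; rewrite /= !cut0 !addn0.
  by case: (ltnP N c) => /= _ ->; rewrite mul0n mul1n add0n ?addnA // [X in (X + _)%N]addnC.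
have := telescope n (leqnn n).
have -> : cut y.1 n = 0%N.
  by case: (n) (y.1) => [|N] al; rewrite /cut // insubN // ltnn.
have full (F : 'I_n -> nat) : (\sum_(b < n | (b < n)%N) F b = \sum_b F b)%N.
  by apply: eq_bigl => b; rewrite ltn_ord.
rewrite add0n !full => E.
have -> : (\sum_b (u b < y.2 b) = \sum_(b < n) ((b < c) * (u b < y.2 b))
   + \sum_(b < n) ((c <= b) * (u b < y.2 b)))%N.
  by rewrite -big_split; apply: eq_bigr => b _ /=; case: (ltnP b c) => _; rewrite ?mul1n ?addn0.
rewrite -E -big_split; apply: eq_bigr => b _ /=.
have -> : (y.2 b != u b) = (y.2 b != u b :> nat) by [].
by case: (ltnP b c) => _; case: (ltngtP (y.2 b) (u b)).
Qed.

End Reach.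

(** * Minimal intervals and chains *)

Section Intervals.
Variable n : nat.
Implicit Types (u v w : 'S_n) (i j k l m a b : 'I_n) (e f : 'I_n * 'I_n) (x y : Snq n)
  (s : seq ('I_n * 'I_n)) (bs p q : seq 'I_n) (B : {set 'I_n}).
#[local] Arguments run n s x : simpl never.

Lemma qbruhat_coverE c x y :
  qbruhat_cover c x y <-> exists2 e, crosses c e & qstep e x = Some y.
Proof.
split=> [[i [j [hij [E2 E]]]]|[[i j] hij]].
  have ij : (i < j)%N by case/andP: hij => h1 h2; apply: leq_trans h1 h2.
  exists (i, j); first exact: hij.
  rewrite /qstep /=; move: E; rewrite bruhat_stepE // quantum_stepE //.
  case: (okstep _ _ _) => -[] [//= h E1].
    by rewrite ltnNge (ltnW h) addm0 -E1 -E2 -surjective_pairing.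
  by rewrite h -E1 -E2 -surjective_pairing.
have ij : (i < j)%N by case/andP: hij => h1 h2; apply: leq_trans h1 h2.
rewrite /qstep /=; case: ifP => // ok [<-]; exists i, j; split=> //=; split=> //.
rewrite bruhat_stepE // quantum_stepE // ok.
have := val_perm_inj x.2 i j; rewrite (ltn_eqF ij).
by case: ltngtP => // h _; [left; rewrite addm0 | right].
Qed.

Lemma qbruhat_leE c x y :
  qbruhat_le c x y <-> exists2 s, all (crosses c) s & run s x = Some y.
Proof.
split=> [|[s]].
  elim=> {x y} [x y /qbruhat_coverE[e ce he]|x|x z y _ [s1 c1 r1] _ [s2 c2 r2]].
  - by exists [:: e]; rewrite /= ?ce // /run /= he.
  - by exists [::].
  by exists (s1 ++ s2); rewrite ?all_cat ?c1 // run_cat r1.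
elim: s x => [|e s IH] x /=; first by move=> _ [->]; apply: rt_refl.
case/andP=> ce cs; rewrite -[run _ _]/(obind (run s) (qstep e x)).
case E: (qstep e x) => [x1|] //= rs; apply: rt_trans (IH _ cs rs).
by apply: rt_step; apply/qbruhat_coverE; exists e.
Qed.

Lemma sum_interval (N i j : nat) : (i <= j <= N)%N -> (\sum_(m < N) (i <= m < j) = j - i)%N.
Proof.
elim: N j => [|N IH] j ijN.
  by rewrite big_ord0; lia.
rewrite big_ord_recr /=; have [jN|Nj] := leqP j N; first by rewrite IH; lia.
have -> : j = N.+1 by lia.
have [iN|Ni] := leqP i N; last by rewrite big1 => [|m _]; have := @ltn_ord N; lia.
rewrite (eq_bigr (fun m : 'I_N => nat_of_bool (i <= m < N)%N)) ?IH; try lia.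
by move=> m _; rewrite ltnS (ltnW (ltn_ord m)) ltn_ord.
Qed.

Lemma mdeg_qexp i j : (i <= j)%N -> mdeg (qexp n i j) = (j - i)%N.
Proof.
move=> ij; rewrite mdegE; under eq_bigr do rewrite mnmE.
by rewrite sum_interval // ij; have := ltn_ord j; lia.
Qed.

Lemma qlen_step e x y : edge e -> qstep e x = Some y -> qlen y = (qlen x).+1.
Proof.
move=> he; rewrite /qstep; case: ifP => // ok [<-]; rewrite /qlen /= mdegD.
have := val_perm_inj x.2 e.1 e.2; rewrite (ltn_eqF he).
case: ltngtP => // h _.
  have : quantum_step x.2 e.1 e.2 by rewrite quantum_stepE // ok.
  rewrite /quantum_step mdeg_qexp ?(ltnW he) // => /eqP E.
  by rewrite mulnDr -addnA [(2 * (_ - _) + len _)%N]addnC -E addnS.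
have : bruhat_step x.2 e.1 e.2 by rewrite bruhat_stepE // ok.
by rewrite /bruhat_step => /eqP ->; rewrite mdeg0 addn0 addnS.
Qed.

Lemma qlen_run s x y : all (@edge n) s -> run s x = Some y -> qlen y = (qlen x + size s)%N.
Proof.
elim: s x => [|e s IH] x /=; first by move=> _ [->]; rewrite addn0.
case/andP=> he hs; rewrite -[run _ _]/(obind (run s) (qstep e x)).
case E: (qstep e x) => [x1|] //= /(IH _ hs) ->.
by rewrite (qlen_step he E) addSnnS.
Qed.

Lemma crosses_edge c s : all (crosses c) s -> all (@edge n) s.
Proof.
by apply: sub_all => e /andP[h1 h2]; apply: leq_trans h1 h2.
Qed.

Section Base.
Variables (u : 'S_n) (y : Snq n).
Local Notation z := (u^-1 * y.2)%g.
Local Notation pi := (walk_perm (0%MM, u) y).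

Lemma conj_walk a : z (u a) = u (pi a).
Proof. by rewrite permM permK -(walk_permE (0%MM, u) y a). Qed.

Lemma supp_conj : supp z = [set u a | a in supp pi].
Proof.
apply/setP => b; rewrite inE -{1 2}(permKV u b) conj_walk (inj_eq perm_inj).
apply/idP/imsetP => [h|[a]]; first by exists (u^-1%g b); rewrite ?permKV // inE.
by rewrite inE => h ->; rewrite permK.
Qed.

Lemma card_supp_conj : #|supp z| = #|supp pi|.
Proof. by rewrite supp_conj card_imset //; apply: perm_inj. Qed.

Lemma porbit_gt1 (t : 'S_n) b : (1 < #|porbit t b|)%N = (b \in supp t).
Proof.
rewrite inE; apply/idP/idP => [|tb].
  apply: contraTneq => tb; rewrite -leqNgt.
  suff -> : porbit t b = [set b] by rewrite cards1.
  apply/setP => d; rewrite inE; apply/porbitP/eqP => [[i ->]|->]; last by exists 0%N; rewrite expg0 perm1.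
  by elim: i => [|i IH]; rewrite ?expg0 ?perm1 // expgSr permM IH.
apply/card_gt1P; exists b, (t b); rewrite porbit_id eq_sym tb; split=> //.
by have := mem_porbit t 1 b; rewrite expg1.
Qed.

(** The orbits of the permutation of the values are the images under [u] of those
    of the permutation of the positions. *)
Lemma transitive_ncycles : transitive_on pi (supp pi) -> (0 < #|supp pi|)%N -> ncycles z = 1%N.
Proof.
move=> tr /card_gt0P[a aP]; apply/eqP/cards1P; exists (porbit z (u a)).
have memz b : (z b \in porbit z (u a)) = (b \in porbit z (u a)).
  by rewrite -!eq_porbit_mem; have := porbit_perm z 1 b; rewrite expg1 => ->.
apply/setP => c; rewrite !inE; apply/idP/eqP => [/andP[/imsetP[b _ ->]]|->].
  rewrite porbit_gt1 supp_conj => /imsetP[d dP ->]; apply/eqP; rewrite eq_porbit_mem.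
  have st : stable pi [set p | u p \in porbit z (u a)].
    by move=> p; rewrite !inE -conj_walk memz.
  have aB : a \in [set p | u p \in porbit z (u a)] by rewrite inE porbit_id.
  by have /subsetP/(_ d dP) := tr _ _ aP aB st; rewrite inE.
by rewrite imset_f // porbit_gt1 supp_conj imset_f.
Qed.

Lemma ncycles_transitive : ncycles z = 1%N -> transitive_on pi (supp pi).
Proof.
move=> /eqP/cards1P[C EC] a B' aP aB' st; apply/subsetP => d dP.
have orb b : b \in supp pi -> porbit z (u b) = C.
  move=> bP; apply/set1P; rewrite -EC inE imset_f // porbit_gt1 supp_conj imset_f //.
have : u d \in porbit z (u a) by rewrite -eq_porbit_mem !orb.
case/porbitP => i Ei.
have Ezi : (z ^+ i)%g (u a) = u ((pi ^+ i)%g a).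
  elim: i {Ei} => [|i IH]; first by rewrite !expg0 !perm1.
  by rewrite !expgSr (permM (z ^+ i)%g) IH conj_walk (permM (pi ^+ i)%g).
move: Ei; rewrite Ezi => /perm_inj ->.
by elim: (i) => [|k IH]; rewrite ?expg0 ?perm1 // expgSr (permM (pi ^+ k)%g) st.
Qed.

End Base.

(** For a single cycle, minimality says that the rank is one less than the size
    of the support. *)
Lemma MN_intervalsE c r u y : (0 < r)%N ->
  MN_intervals c r u y <-> chain_to c r (0%MM, u) y.
Proof.
move=> r0; split=> [[[/qbruhat_leE[s cs rs] mi] [rk nc]]|[[cP tr] [s [sz rs cs]]]].
  have sz : size s = r.
    by rewrite -rk /rank (qlen_run (crosses_edge cs) rs) addKn.
  split; last by exists s.
  split; last exact: ncycles_transitive.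
  by rewrite -card_supp_conj; move: mi; rewrite rk nc; clear - r0; lia.
have rk : rank (0%MM, u) y = r by rewrite /rank (qlen_run (crosses_edge cs) rs) addKn.
have nc : ncycles (u^-1 * y.2)%g = 1%N by apply: transitive_ncycles; rewrite ?cP.
split; last by split.
split; first by apply/qbruhat_leE; exists s.
by rewrite rk nc card_supp_conj cP subn1.
Qed.

End Intervals.

(** * The telescoping sum *)

Lemma big_pmap (V : nmodType) (I J : Type) (f : I -> option J) (s : seq I) (F : J -> V) :
  \sum_(y <- pmap f s) F y = \sum_(x <- s) oapp F 0 (f x).
Proof.
elim: s => [|x s IH] /=; first by rewrite !big_nil.
by rewrite big_cons -IH; case: (f x) => [y|] /=; rewrite ?big_cons ?add0r.
Qed.

Section Summation.
Variables (n : nat) (A : comAlgType (Zq n)) (sch : 'S_n -> A) (r : nat) (u : 'S_n).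
Hypothesis r_gt0 : (0 < r)%N.
Implicit Types (v w : 'S_n) (i j k l m a b : 'I_n) (x y : Snq n) (bs : seq 'I_n).
#[local] Arguments run n s x : simpl never.
Local Notation x0 := ((0%MM, u) : Snq n).

(** By [star_inj], no endpoint occurs twice. *)
Definition star_ends a : seq (Snq n) :=
  pmap (fun bs => run (star a bs) x0) (inj_words [set~ a] r).

Lemma mem_words a bs : (bs \in inj_words [set~ a] r) = [&& size bs == r, uniq bs & a \notin bs].
Proof.
rewrite mem_inj_words; congr [&& _, _ & _]; apply/allP/idP => [H|abs b bb].
  by apply/negP => /H; rewrite !inE eqxx.
by rewrite !inE; apply: contraNneq abs => <-.
Qed.

Lemma star_endsP a y : reflect (star_to a r x0 y) (y \in star_ends a).
Proof.
rewrite /star_ends -(mem_map (@Some_inj _)) pmapS_filter.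
apply: (iffP mapP) => [[bs]|[bs [abs ubs sz rs]]].
  rewrite mem_filter mem_words => /andP[_ /and3P[/eqP sz ubs abs]] E.
  by exists bs; split.
by exists bs; rewrite // mem_filter mem_words sz eqxx ubs abs rs.
Qed.

Lemma star_ends_uniq a : uniq (star_ends a).
Proof.
rewrite -(map_inj_uniq (@Some_inj _)) pmapS_filter map_inj_in_uniq.
  exact/filter_uniq/inj_words_uniq.
move=> bs bs'; rewrite !mem_filter !mem_words.
case E: (run _ _) => [y|] //= /and3P[/eqP sz ubs abs].
case E': (run _ _) => [y'|] //= /and3P[/eqP sz' ubs' abs'] [yy'].
by apply: (star_inj E E'); rewrite ?sz ?sz' ?yy'.
Qed.

Lemma star_low_support a bs y : (0 < size bs)%N -> a \notin bs -> uniq bs ->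
  run (star a bs) x0 = Some y ->
  low_support a x0 y = count (fun b : 'I_n => (b < a)%N) bs.
Proof.
move=> sz abs ubs rs; rewrite /low_support (star_supp rs) // -size_filter.
rewrite -(card_uniqP (filter_uniq _ ubs)); apply: eq_card => b.
rewrite !inE mem_filter andbC; case: (ltnP b a) => //= ba.
by have [ba'|//] := eqVneq b a; rewrite ba' ltnn in ba.
Qed.

Definition end_class y : A := ('X_[y.1] : Zq n) *: sch y.2.

Lemma act_star_sum a : act sch u (star_sum (@bruhat_op n) a [set~ a] r)
  = \sum_(y <- star_ends a) (-1) ^+ low_support a x0 y *: end_class y.
Proof.
rewrite big_pmap star_sum_words raddf_sum big_seq [RHS]big_seq; apply: eq_bigr => bs.
rewrite mem_words => /and3P[/eqP sz ubs abs] /=.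
rewrite prod_bruhat_op // act_sign act_opmx; case E: (run _ _) => [y|] /=.
  by rewrite (star_low_support _ abs ubs E) // sz.
by rewrite scaler0.
Qed.

Definition all_ends : seq (Snq n) := undup (flatten [seq star_ends a | a <- enum 'I_n]).

Lemma star_ends_sub a y : y \in star_ends a -> y \in all_ends.
Proof.
by move=> ya; rewrite mem_undup; apply/flatten_mapP; exists a; rewrite ?mem_enum.
Qed.

Lemma sum_star_ends a (F : Snq n -> A) :
  \sum_(y <- star_ends a) F y = \sum_(y <- all_ends | y \in star_ends a) F y.
Proof.
rewrite -[RHS]big_filter; apply: perm_big; apply: uniq_perm.
- exact: star_ends_uniq.
- exact/filter_uniq/undup_uniq.
move=> y; rewrite mem_filter; case ya: (y \in star_ends a) => //=.
by rewrite (star_ends_sub ya).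
Qed.

Lemma chain_to_ends c y : chain_to c r x0 y -> y \in all_ends.
Proof. by move=> /(chain_to_star_above r_gt0)[a /star_endsP/star_ends_sub]. Qed.

Local Notation "`[< P >]" := (boolp.asbool P).

(** Induction on [c].  Passing from the cut [a] to the cut [a.+1], nothing changes
    for endpoints that fix [a]; for the others, the set of endpoints of stars
    centred at [a] is the disjoint union of the endpoints for the two cuts, and
    the additional support position [a] flips the sign. *)
Lemma sum_star_sums c : (c <= n)%N ->
  \sum_(a < n | (a < c)%N) act sch u (star_sum (@bruhat_op n) a [set~ a] r)
  = \sum_(y <- all_ends | `[< chain_to c r x0 y >])
      (-1) ^+ (low_support c x0 y).+1 *: end_class y.
Proof.
elim: c => [|c IH] cn.
  rewrite !big_pred0 // => y; apply/negbTE/boolp.asboolPn => -[_ [[|e s] [sz _ cs]]].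
    by have := r_gt0; rewrite -sz.
  by have := allP cs e (mem_head _ _); rewrite /crosses; lia.
pose a := Ordinal cn; rewrite (bigD1 a) /=; last by [].
rewrite (eq_bigl (fun b : 'I_n => (b < c)%N)) => [|b]; last first.
  by rewrite -(inj_eq val_inj) /= ltnS; case: ltngtP.
rewrite (IH (ltnW cn)) act_star_sum sum_star_ends.
rewrite big_mkcond [X in _ + X]big_mkcond -big_split [RHS]big_mkcond.
apply: eq_bigr => y _ /=.
have -> : low_support c.+1 x0 y = ((a \in supp (walk_perm x0 y)) + low_support c x0 y)%N.
  exact: (low_supportS a).
rewrite -[low_support a _ _]/(low_support c x0 y).
have [aP|aP] := boolP (a \in supp _).
  have toS c' := @chain_to_star_self n a c' r x0 y r_gt0.
  case: (boolp.asboolP (chain_to c r x0 y)) => [ch|nch];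
  case: (boolp.asboolP (chain_to c.+1 r x0 y)) => [ch'|nch'].
  - by have := chain_exclusive r_gt0 aP ch ch'.
  - have -> : y \in star_ends a by apply/star_endsP/(toS c) => //; rewrite eqxx.
    by rewrite exprS mulN1r scaleNr subrr.
  - have -> : y \in star_ends a by apply/star_endsP/(toS c.+1) => //; rewrite eqxx orbT.
    by rewrite addr0 add1n !exprS !mulN1r opprK.
  case: (boolP (y \in star_ends a)) => [/star_endsP st|_]; last by rewrite addr0.
  by case: (star_to_chain_to r_gt0 st) => ?; [case: nch | case: nch'].
have -> : y \in star_ends a = false.
  by apply/negbTE/negP => /star_endsP/(star_cyclic r_gt0)[_]; apply/negP.
rewrite add0r add0n; have [h1 h2] := chain_to_skip r_gt0 aP.
by rewrite (boolp.asbool_equiv_eq (conj h1 h2)).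
Qed.

End Summation.

(** * Growing hooks from the identity *)

Section Hooks.
Variable n : nat.
Implicit Types (u v w : 'S_n) (i j k l m a b p : 'I_n) (x y : Snq n) (bs : seq 'I_n)
  (c s t : nat).
#[local] Arguments run n s x : simpl never.

(** The graph of the cycle that fixes all positions outside the interval from
    [c - t] to [c + s], has the largest value at the position [c] and the smallest
    at the position [c + 1], and is increasing elsewhere.  These are the
    Grassmannian permutations of the hook with first row [s] and leg [t], see
    [hook_grassmannian]. *)
Variant hook_graph c s t (p q : nat) : Prop :=
  | HookLow of (p < c - t)%N & q = p
  | HookLeg of (c - t <= p < c)%N & q = p.+1
  | HookCorner of p = c & q = (c + s)%N
  | HookNext of p = c.+1 & q = (c - t)%N
  | HookArm of (c.+1 < p <= c + s)%N & q.+1 = p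
  | HookHigh of (c + s < p)%N & q = p.

Ltac hook_region := first [apply: HookLow; lia | apply: HookLeg; lia | apply: HookCorner; lia
  | apply: HookNext; lia | apply: HookArm; lia | apply: HookHigh; lia].

Definition is_hook c s t v :=
  [/\ (t <= c)%N, (0 < s)%N, (c + s < n)%N & forall p, hook_graph c s t p (v p)].

Lemma hook_graph_fun c s t (p q q' : nat) : (0 < s)%N -> (t <= c)%N ->
  hook_graph c s t p q -> hook_graph c s t p q' -> q = q'.
Proof. by move=> s0 tc [] ? ? [] ? ?; lia. Qed.

Lemma is_hook_uniq c s t v v' : is_hook c s t v -> is_hook c s t v' -> v = v'.
Proof.
case=> tc s0 _ h [_ _ _ h']; apply/permP => p; apply/val_inj.
exact: hook_graph_fun s0 tc (h p) (h' p).
Qed.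

Lemma hook_start a b : (b = a.+1 :> nat) -> is_hook a 1 0 (tperm a b).
Proof.
move=> ba; split; rewrite ?addn1 -?ba ?ltn_ord // => p.
case: tpermP => [->|->|/eqP pa /eqP pb].
- by hook_region.
- by hook_region.
have [{}pa {}pb] : (p : nat) <> a /\ (p : nat) <> b by split=> /val_inj; apply/eqP.
have [pa'|pa'] : (p < a)%N \/ (a < p)%N by lia.
by hook_region.
by hook_region.
Qed.

Section Grow.
Variables (c s t : nat) (v : 'S_n) (i j : 'I_n).
Hypothesis hv : is_hook c s t v.

(** A step from one hook to another exchanges two values and leaves the others
    alone. *)
Lemma swap_hook c' s' t' :
  (forall p q : nat, p != i -> p != j -> hook_graph c s t p q -> hook_graph c' s' t' p q) ->
  (forall q : nat, hook_graph c s t j q -> hook_graph c' s' t' i q) ->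
  (forall q : nat, hook_graph c s t i q -> hook_graph c' s' t' j q) ->
  forall p, hook_graph c' s' t' p ((tperm i j * v)%g p).
Proof.
case: hv => _ _ _ h hp hi hj p; rewrite swapE.
have [->|pi] := eqVneq (p : nat) i; first exact: hi (h j).
by have [->|pj] := eqVneq (p : nat) j; [exact: hj (h i) | exact: hp (h p)].
Qed.

Ltac grow := apply: swap_hook => [p q pi pj|q|q] [] ? ?; try (exfalso; lia); hook_region.

Lemma grow_arm : (i = c :> nat) -> (j = (c + s).+1 :> nat) -> is_hook c s.+1 t (tperm i j * v)%g.
Proof.
case: hv => tc s0 csn h ic jc; split=> //; first by rewrite addnS -jc ltn_ord.
by grow.
Qed.

Lemma grow_leg : (i.+1 = c - t :> nat)%N -> (j = c.+1 :> nat) -> is_hook c s t.+1 (tperm i j * v)%g.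
Proof.
case: hv => tc s0 csn h ic jc; split=> //; first by lia.
by grow.
Qed.

Lemma grow_corner_left : t = 0%N -> (i.+1 = c :> nat) -> (j = c :> nat) ->
  is_hook i s.+1 0 (tperm i j * v)%g.
Proof.
case: hv => tc s0 csn h t0 ic jc; split=> //; first by lia.
by grow.
Qed.

Lemma grow_corner_right : s = 1%N -> (i = c.+1 :> nat) -> (j = i.+1 :> nat) ->
  is_hook i 1 t.+1 (tperm i j * v)%g.
Proof.
case: hv => tc s0 csn h t0 ic jc; split=> //; first by lia.
  by rewrite addn1 -jc ltn_ord.
by grow.
Qed.

End Grow.

Lemma hook_outside c s t v b : is_hook c s t v -> (b < c - t)%N || (c + s < b)%N -> v b = b :> nat.
Proof. by case=> tc s0 csn h hb; case: (h b) => ? ?; lia. Qed.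

(** A hook grows from its corner by one cell in the first row; only if there is no leg,
    the corner itself may move to the left. *)
Lemma hook_corner_step c s t v a b : is_hook c s t v -> a = c :> nat ->
  (b < c - t)%N || (c + s < b)%N ->
  okstep v (arrow a b).1 (arrow a b).2 =
    ((b == (c + s).+1 :> nat) || (t == 0%N) && (b.+1 == c :> nat)).
Proof.
move=> hv ac hb; have vb := hook_outside hv hb; case: hv => tc s0 csn h.
have va : v a = (c + s)%N :> nat by case: (h a) => ? ?; lia.
have [ab|ba] : (a < b)%N \/ (b < a)%N by lia.
  rewrite arrow_lt //=; apply/okstepP/idP => [ok|hb' p hp]; last first.
    by rewrite va vb /cyc; clear - hb' ab ac hb; lia.
  have [//|bcs] := eqVneq (b : nat) (c + s).+1; exfalso.
  have pn : ((c + s).+1 < n)%N by have := ltn_ord b; lia.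
  have vp : v (Ordinal pn) = (c + s).+1 :> nat by case: (h (Ordinal pn)) => /= ? ?; lia.
  have := ok (Ordinal pn); rewrite va vb vp /cyc /=.
  by clear - ab ac hb bcs s0; lia.
rewrite arrow_gt //=; apply/okstepP/idP => [ok|hb' p hp]; last by exfalso; lia.
have pn : (c.-1 < n)%N by lia.
have [t0|t0] := posnP t.
  have [//|bc] := eqVneq b.+1 c; first by rewrite orbT.
  have vp : v (Ordinal pn) = c.-1 :> nat by case: (h (Ordinal pn)) => /= ? ?; lia.
  by have := ok (Ordinal pn); rewrite va vb vp /cyc /=; clear - ba ac hb bc s0 t0; lia.
have vp : v (Ordinal pn) = c :> nat by case: (h (Ordinal pn)) => /= ? ?; lia.
by have := ok (Ordinal pn); rewrite va vb vp /cyc /=; clear - ba ac hb s0 t0 tc; lia.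
Qed.

(** The mirror image of [hook_corner_step], seen from the position after the
    corner: there the hook grows by one cell in the leg, and only if the first
    row is a single cell the corner may move to the right. *)
Lemma hook_next_step c s t v a b : is_hook c s t v -> a = c.+1 :> nat ->
  (b < c - t)%N || (c + s < b)%N ->
  okstep v (arrow a b).1 (arrow a b).2 =
    ((b.+1 == c - t :> nat)%N || (s == 1%N) && (b == a.+1 :> nat)).
Proof.
move=> hv ac hb; have vb := hook_outside hv hb; case: hv => tc s0 csn h.
have va : v a = (c - t)%N :> nat by case: (h a) => ? ?; lia.
have [ab|ba] : (a < b)%N \/ (b < a)%N by lia.
  rewrite arrow_lt //=; apply/okstepP/idP => [ok|hb' p hp]; last by exfalso; lia.
  have pn : (c.+2 < n)%N \/ b = c.+2 :> nat by have := ltn_ord b; lia.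
  have [s1|s1] := eqVneq s 1%N.
    case: pn => [pn|->]; last by rewrite ac eqxx orbT.
    have [bc|bc] := eqVneq (b : nat) a.+1; first by rewrite orbT.
    have vp : v (Ordinal pn) = c.+2 :> nat by case: (h (Ordinal pn)) => /= ? ?; lia.
    by have := ok (Ordinal pn); rewrite va vb vp /cyc /=; clear - ab ac hb bc s1; lia.
  have {}pn : (c.+2 < n)%N by lia.
  have vp : v (Ordinal pn) = c.+1 :> nat by case: (h (Ordinal pn)) => /= ? ?; lia.
  by have := ok (Ordinal pn); rewrite va vb vp /cyc /=; clear - ab ac hb s0 s1; lia.
rewrite arrow_gt //=; apply/okstepP/idP => [ok|hb' p hp]; last first.
  by rewrite va vb /cyc; clear - hb' ba ac hb; lia.
have pn : ((c - t).-1 < n)%N by lia.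
have [bc|bc] := eqVneq b.+1 (c - t)%N; first by [].
have vp : v (Ordinal pn) = (c - t).-1 :> nat by case: (h (Ordinal pn)) => /= ? ?; lia.
by have := ok (Ordinal pn); rewrite va vb vp /cyc /=; clear - ba ac hb bc; lia.
Qed.

End Hooks.

Section HookStars.
Variable n : nat.
Implicit Types (u v w : 'S_n) (i j l m a b p : 'I_n) (x y z : Snq n) (bs : seq 'I_n)
  (c s t r k : nat).
#[local] Arguments run n s x : simpl never.
Local Notation pos v := ((0%MM, v) : Snq n).

Lemma hook_fixed c s t v b : is_hook c s t v -> v b = b -> (b < c - t)%N || (c + s < b)%N.
Proof.
by move=> [tc s0 csn h] vb; case: (h b); rewrite vb => ? ?; lia.
Qed.

Lemma tperm_arrow a b : tperm (arrow a b).1 (arrow a b).2 = tperm a b.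
Proof. by rewrite /arrow; case: ifP => //= _; rewrite tpermC. Qed.

Lemma star_to1 a x y :
  star_to a 1 x y <-> exists2 b, b != a & qstep (arrow a b) x = Some y.
Proof.
split=> [[[|b [|b' bs]] []] //|[b ba xy]].
  rewrite inE /star /= /run /= => ab _ _; case E: qstep => [z|] //= [<-].
  by exists b; rewrite // eq_sym.
by exists [:: b]; split; rewrite ?inE 1?eq_sym // /star /= /run /= xy.
Qed.

(** Which neighbours have been used can be read off the permutation: those that do
    not keep their value. *)
Lemma star_to_rcons a r x y : (0 < r)%N -> star_to a r.+1 x y <->
  exists z b, [/\ star_to a r x z, b != a, z.2 b = x.2 b & qstep (arrow a b) z = Some y].
Proof.
move=> r0; split=> [[bs []]|[z [b [[bs [abs ubs sz rs]] ba zb zy]]]].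
  case/lastP: bs => [|bs b]; first by move=> _ _ [].
  rewrite mem_rcons inE rcons_uniq size_rcons negb_or /star map_rcons -cats1 run_cat.
  case/andP=> ab abs /andP[bbs ubs] [sz]; case E: (run _ x) => [z|] //=.
  rewrite /run /=; case F: qstep => [z'|] //= [zy].
  exists z, b; split; rewrite 1?eq_sym ?F ?zy //; first by exists bs.
  by rewrite (star_fixed_val E) // inE negb_or bbs eq_sym ab.
have bbs : b \notin bs.
  have := supp_walk x z b; rewrite (star_supp rs) ?sz // !inE zb eqxx.
  by move/negbT; rewrite negb_or => /andP[].
exists (rcons bs b); split; rewrite ?mem_rcons ?inE ?negb_or 1?eq_sym ?ba //.
- by rewrite rcons_uniq bbs.
- by rewrite size_rcons sz.
by rewrite /star map_rcons -cats1 run_cat -/(star a bs) rs /= /run /= zy.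
Qed.

(** The neighbours by which the centre [a] of a hook can be exchanged. *)
Definition next_hook c s t a b : bool :=
  if a == c :> nat then (b == (c + s).+1 :> nat) || (t == 0%N) && (b.+1 == c :> nat)
  else (b.+1 == c - t :> nat)%N || (s == 1%N) && (b == a.+1 :> nat).

Lemma qstep_hook c s t v a b : is_hook c s t v -> (a == c :> nat) || (a == c.+1 :> nat) ->
  b != a -> v b = b -> qstep (arrow a b) (pos v) =
    if next_hook c s t a b then Some (pos (tperm a b * v)%g) else None.
Proof.
move=> hv ac ba vb; have ob := hook_fixed hv vb; rewrite /qstep tperm_arrow /=.
have -> : okstep v (arrow a b).1 (arrow a b).2 = next_hook c s t a b.
  rewrite /next_hook; case: eqP ac => [ac _|_ /eqP ac]; first exact: hook_corner_step hv ac ob.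
  exact: hook_next_step hv ac ob.
rewrite /next_hook; case: ifP => // st; case: ifP => [desc|]; last by rewrite addm0.
have [tc s0 csn h] := hv; have := h a; have : v b = b :> nat by rewrite vb.
have : b <> a :> nat by move/val_inj/eqP; rewrite (negbTE ba).
move=> bna vbE ha; exfalso; move: desc st; rewrite /arrow; clear - ac s0 tc vbE ha bna.
have [ab|ba] := ltnP a b; rewrite /= vbE; case: ha => ? ?; case: eqP ac; lia.
Qed.

(** The centre of the star is the corner of the hook or the position after it. *)
Definition hook_end a r y := exists c s t,
  [/\ (a == c :> nat) || (a == c.+1 :> nat), (s + t)%N = r, is_hook c s t y.2 & y.1 = 0%MM].

Lemma qstep_id a b : b != a ->
  qstep (arrow a b) (pos 1%g) =
    if (b == a.+1 :> nat) || (a == b.+1 :> nat) then Some (pos (tperm a b)) else None.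
Proof.
move=> ba; rewrite /qstep tperm_arrow /= mulg1 !perm1.
have ab : ((arrow a b).1 < (arrow a b).2)%N.
  by rewrite /arrow; case: (ltnP a b) => //=; rewrite leq_eqVlt (inj_eq val_inj) (negbTE ba).
rewrite ltnNge (ltnW ab) addm0; congr (if _ then _ else _).
have -> : (b == a.+1 :> nat) || (a == b.+1 :> nat) = ((arrow a b).2 == (arrow a b).1.+1 :> nat).
  by move: ab; rewrite /arrow; case: ifP => /= *; lia.
move: (arrow a b) ab => [i j] /= ij; apply/okstepP/eqP => [ok|ji p]; last by rewrite ji; lia.
apply/eqP; rewrite eqn_leq ij andbT leqNgt; apply/negP => iSj.
have iSn : (i.+1 < n)%N by apply: leq_trans iSj (ltnW _).
by have := ok (Ordinal iSn); rewrite !perm1 /cyc /=; lia.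
Qed.

Lemma star_to_hook_end a r y : (0 < r)%N -> star_to a r (pos 1%g) y -> hook_end a r y.
Proof.
elim: r y => // -[_ y _ /star_to1[b ba]|r IH y _ /star_to_rcons[//|z [b []]]].
  rewrite qstep_id //; case: ifP => // ab [<-].
  case/orP: ab => /eqP ab.
    by exists a, 1%N, 0%N; split; rewrite ?eqxx //; apply: hook_start.
  by exists b, 1%N, 0%N; split; rewrite ?ab ?eqxx ?orbT //= tpermC; apply: hook_start.
case/IH=> // c [s [t [ac st hz z1]]] ba; rewrite perm1 => zb.
case: z z1 hz zb => _ v /= -> hv vb; rewrite (qstep_hook hv ac ba vb).
rewrite /next_hook; case: ifP => // + [<-]; case: eqP ac => [ac _|_ /eqP ac] /orP[|/andP[/eqP s1]] /eqP bc.
- exists c, s.+1, t; split; rewrite ?ac ?eqxx -?st //; exact: grow_arm.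
- exists b, s.+1, 0%N; split; rewrite ?ac -?bc ?eqxx ?orbT -?st ?s1 //= tpermC.
  by apply: (grow_corner_left hv).
- exists c, s, t.+1; split; rewrite ?ac ?eqxx ?orbT -?st ?addnS //= tpermC.
  by apply: (grow_leg hv).
exists a, 1%N, t.+1; split; rewrite ?eqxx -?st ?s1 //.
by apply: (grow_corner_right hv).
Qed.

End HookStars.

(** * Hook permutations are Grassmannian *)

Section Grassmannian.
Variable n : nat.
Implicit Types (u v w : 'S_n) (i j l m a b p : 'I_n) (x y z : Snq n) (bs : seq 'I_n)
  (c s t r k : nat).
#[local] Arguments run n s x : simpl never.
Local Notation pos v := ((0%MM, v) : Snq n).

Lemma hook_fixes c s t v b : is_hook c s t v -> (b < c - t)%N || (c + s < b)%N -> v b = b.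
Proof. by move=> hv ob; apply/val_inj; apply: hook_outside hv ob. Qed.

Lemma star_grow c s t v a b r : (0 < r)%N -> is_hook c s t v ->
  (a == c :> nat) || (a == c.+1 :> nat) -> star_to a r (pos 1%g) (pos v) ->
  b != a -> v b = b -> next_hook c s t a b -> star_to a r.+1 (pos 1%g) (pos (tperm a b * v)%g).
Proof.
move=> r0 hv ac st ba vb nx; apply/star_to_rcons => //; exists (pos v), b.
by split; rewrite ?perm1 // (qstep_hook hv ac ba vb) nx.
Qed.

(** Peel off the cell added last: if [a] is the corner, a cell of the first row
    as long as there are two, otherwise the corner comes from the left; symmetrically with
    the leg if [a] is the position after the corner. *)
Lemma hook_reach r c s t a : (0 < r)%N -> (s + t)%N = r -> (t <= c)%N -> (0 < s)%N ->
  (c + s < n)%N -> (a == c :> nat) || (a == c.+1 :> nat) ->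
  exists2 v, is_hook c s t v & star_to a r (pos 1%g) (pos v).
Proof.
elim: r c s t a => // -[_ c s t a _ sr tc s0 csn ac|r IH c s t a _ sr tc s0 csn ac].
  have [s1 t0] : s = 1%N /\ t = 0%N by lia.
  subst s t; have cn : (c < n)%N by lia.
  have cn1 : (c.+1 < n)%N by lia.
  have st : (Ordinal cn1 = (Ordinal cn).+1 :> nat) by [].
  exists (tperm (Ordinal cn) (Ordinal cn1)); first exact: hook_start st.
  apply/star_to1; case/orP: ac => /eqP ac.
    exists (Ordinal cn1); first by rewrite -val_eqE /= ac; lia.
    have -> : a = Ordinal cn by apply/val_inj.
    by rewrite qstep_id ?eqxx // -val_eqE /=; lia.
  exists (Ordinal cn); first by rewrite -val_eqE /= ac; lia.
  have -> : a = Ordinal cn1 by apply/val_inj.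
  by rewrite qstep_id ?eqxx ?orbT 1?tpermC // -val_eqE /=; lia.
have grow c' s' t' (b : 'I_n) : (s' + t')%N = r.+1 -> (t' <= c')%N -> (0 < s')%N ->
    (c' + s' < n)%N -> (a == c' :> nat) || (a == c'.+1 :> nat) ->
    (b < c' - t')%N || (c' + s' < b)%N -> next_hook c' s' t' a b ->
    (forall v, is_hook c' s' t' v -> is_hook c s t (tperm a b * v)%g) ->
    exists2 v, is_hook c s t v & star_to a r.+2 (pos 1%g) (pos v).
  move=> sr' tc' s0' csn' ac' ob nx H; have [v hv st] := IH c' s' t' a isT sr' tc' s0' csn' ac'.
  exists (tperm a b * v)%g; first exact: H.
  apply: (star_grow _ hv) => //; last exact: hook_fixes hv ob.
  by rewrite -val_eqE /=; clear - ob ac' tc' s0'; lia.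
have ordE (N : nat) : (N < n)%N -> exists b, b = N :> nat by move=> Nn; exists (Ordinal Nn).
have [ac0|ac1] : a = c :> nat \/ a = c.+1 :> nat by lia.
- have [s1|s1] := eqVneq s 1%N.
    have [|b bE] := ordE c.+1; first by lia.
    have nx : next_hook c.-1 1 t.-1 a b.
      by rewrite /next_hook ac0 bE; case: eqP => ?; lia.
    apply: (grow _ _ _ _ _ _ _ _ _ _ nx) => [||||||v hv]; rewrite ?bE; try by lia.
    rewrite s1 -ac0 (_ : t = t.-1.+1); last by lia.
    by apply: grow_corner_right hv _ _ _; lia.
  have [|b bE] := ordE (c + s)%N; first by lia.
  have nx : next_hook c s.-1 t a b.
    by rewrite /next_hook ac0 bE eqxx; lia.
  apply: (grow _ _ _ _ _ _ _ _ _ _ nx) => [||||||v hv]; rewrite ?bE; try by lia.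
  rewrite (_ : s = s.-1.+1); last by lia.
  by apply: grow_arm hv _ _; lia.
have [t0|t0] := posnP t.
  have [|b bE] := ordE c; first by lia.
  have nx : next_hook a s.-1 0 a b.
    by rewrite /next_hook ac1 bE eqxx; lia.
  apply: (grow _ _ _ _ _ _ _ _ _ _ nx) => [||||||v hv]; rewrite ?bE ?eqxx //; try by lia.
  rewrite t0 -bE (_ : s = s.-1.+1); last by lia.
  by rewrite tpermC; apply: (grow_corner_left hv); lia.
have [|b bE] := ordE (c - t)%N; first by lia.
have nx : next_hook c s t.-1 a b.
  by rewrite /next_hook ac1 bE; case: eqP => ?; lia.
apply: (grow _ _ _ _ _ _ _ _ _ _ nx) => [||||||v hv]; rewrite ?bE; try by lia.
rewrite (_ : t = t.-1.+1); last by lia.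
by rewrite tpermC; apply: grow_leg hv _ _; lia.
Qed.

Lemma hook_end_star_to a r y : (0 < r)%N -> hook_end a r y -> star_to a r (pos 1%g) y.
Proof.
case: y => al v r0 [c [s [t [ac st /= hv ->]]]]; have [tc s0 csn _] := hv.
by have [v' hv'] := hook_reach r0 st tc s0 csn ac; rewrite -(is_hook_uniq hv' hv).
Qed.

Lemma card_interval (i j : nat) : (i <= j <= n)%N -> #|[set p : 'I_n | (i <= p < j)%N]| = (j - i)%N.
Proof.
move=> ij; rewrite -(sum_interval ij) cardsE -sum1_card big_mkcond /=.
by apply: eq_bigr => p _; rewrite unfold_in; case: (_ && _).
Qed.

Lemma hook_low_support c s t v a : is_hook c s t v -> (a == c :> nat) || (a == c.+1 :> nat) ->
  low_support a (pos 1%g) (pos v) = (t + (a == c.+1 :> nat))%N.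
Proof.
move=> hv ac; have [tc s0 csn h] := hv; rewrite /low_support.
have -> : [set b in supp (walk_perm (pos 1%g) (pos v)) | (b < a)%N]
    = [set p : 'I_n | (c - t <= p < a)%N].
  apply/setP => p; rewrite [in LHS]inE [in RHS]inE supp_walk /= perm1 -val_eqE /=.
  by clear - h ac s0; case: (h p) => ? ?; lia.
by rewrite card_interval; have := ltn_ord a; clear - tc ac; lia.
Qed.

Lemma hook_grassmannian c s t v : is_hook c s t v ->
  is_grassmannian (s :: nseq t 1%N) c.+1 v.
Proof.
case=> tc s0 csn h; apply/andP; split; apply/forallP => i.
  apply/implyP => ic; have := h i.
  have [->|ic'] : i = c :> nat \/ (i < c)%N by lia.
    by rewrite subnn /=; case=> ? ?; lia.
  have -> : (c - i)%N = (c - i).-1.+1 by lia.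
  by rewrite /= nth_nseq; case=> ? ?; case: ifP => ?; lia.
apply/forallP => j; apply/implyP => ij; move: (h i) (h j).
by clear - ij s0; case=> ? ? [] ? ?; lia.
Qed.

(** At the first position where two such permutations differ, the smaller of the
    two values would have to occur further right in the other permutation,
    where the values increase. *)
Lemma is_grassmannian_uniq la k v v' : is_grassmannian la k v -> is_grassmannian la k v' ->
  v = v'.
Proof.
have P w : is_grassmannian la k w -> (forall i, (i < k)%N ->
      w i = (i + nth 0 la (k.-1 - i))%N :> nat) /\ (forall i j, (k <= i < j)%N -> (w i < w j)%N).
  case/andP=> /forallP h /forallP h'; split=> [i|i j]; first by move/implyP: (h i) => H /H/eqP.
  by move/implyP: (forallP (h' i) j).
move=> /P[h1 h2] /P[h1' h2']; apply/permP => i; have [m] := ubnP i.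
elim: m i => // m IH i; rewrite ltnS => im.
have [ik|ki] := ltnP i k; first by apply/val_inj; rewrite /= h1 // h1'.
have key w w' : (forall i j, (k <= i < j)%N -> (w i < w j)%N) ->
    (forall j, (j < i)%N -> w j = w' j) -> ~~ (w' i < w i)%N.
  move=> mono agree; apply/negP => lt; pose j := (w^-1)%g (w' i).
  have wj : w j = w' i by rewrite /j permKV.
  have [ij|ji] := ltnP i j.
    by have := mono i j; rewrite ki ij wj ltnNge (ltnW lt) => /(_ isT).
  have [E|ne] := eqVneq j i; first by move: lt; rewrite -wj E ltnn.
  have {}ji : (j < i)%N by rewrite ltn_neqAle ji andbT; exact: ne.
  by move: (agree j ji) ne; rewrite wj => /perm_inj ->; rewrite eqxx.
have vv' j : (j < i)%N -> v j = v' j by move=> ji; rewrite IH // (leq_trans ji).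
have lt1 := key v v' h2 vv'; have lt2 := key v' v h2' (fun j ji => esym (vv' j ji)).
apply: val_inj => /=; move: lt1 lt2.
by case: (ltngtP (nat_of_ord (v i)) (nat_of_ord (v' i))).
Qed.

Lemma grassmannian_perm_eq la k v : is_grassmannian la k v -> grassmannian_perm n la k = v.
Proof.
rewrite /grassmannian_perm; case: pickP => [w hw|/(_ v) -> //] hv.
exact: is_grassmannian_uniq hw hv.
Qed.

End Grassmannian.

(** * Star sums at the identity *)

Section PowerSum.
Variables (n : nat) (A : comAlgType (Zq n)) (sch : 'S_n -> A) (r : nat).
Hypothesis r_gt0 : (0 < r)%N.
Implicit Types (v w : 'S_n) (i j l m a b : 'I_n) (x y : Snq n) (bs : seq 'I_n) (k : nat).
#[local] Arguments run n s x : simpl never.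
Local Notation pos v := ((0%MM, v) : Snq n).

(** The hook with first row [r - i] and leg [i] fits into the rectangle with [k] rows
    and [n - k] columns. *)
Definition hook_rect k (i : nat) : bool := (i < k)%N && (k + (r - i) <= n)%N.

Lemma in_rect_hook k (i : nat) : (i < r)%N -> in_rect k (n - k) (hook r i) = hook_rect k i.
Proof.
move=> ir; rewrite /in_rect /hook_rect /= size_nseq all_nseq.
by case: (ltnP i k) => //= ik; lia.
Qed.

Definition hook_class k (i : nat) : Snq n := pos (grassmannian_perm n (hook r i) k).

Definition hook_ends k : seq (Snq n) :=
  [seq hook_class k t | t <- iota 0 r & hook_rect k t].

Lemma qpower_sumE k :
  qpower_sum sch k r =
  \sum_(t <- iota 0 r | hook_rect k t) (-1) ^+ t *: end_class sch (hook_class k t).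
Proof.
have -> : iota 0 r = index_iota 0 r by rewrite /index_iota subn0.
rewrite /qpower_sum [RHS]big_mkcond big_mkord.
apply: eq_bigr => t _; rewrite /qschur in_rect_hook //; case: ifP => _; last by rewrite mulr0.
rewrite /end_class /= mpolyX0 scale1r -signr_odd -[in RHS]signr_odd; case: odd;
  by rewrite ?expr1 ?mulN1r ?scaleN1r // !expr0 mul1r scale1r.
Qed.

Lemma hook_class_hook k (t : nat) : (t < r)%N -> hook_rect k t ->
  is_hook k.-1 (r - t) t (hook_class k t).2.
Proof.
move=> tr /andP[tk kn]; have k0 : (k.-1 < n)%N by lia.
have [|||||v hv _] := @hook_reach n r k.-1 (r - t) t (Ordinal k0) r_gt0; rewrite /= ?eqxx //; try lia.
by have := hook_grassmannian hv; rewrite prednK ?(leq_trans _ tk) // => /grassmannian_perm_eq ->.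
Qed.

Lemma hook_endE a y : hook_end a r y <-> y \in hook_ends a.+1 ++ hook_ends a.
Proof.
rewrite mem_cat; split.
  case=> c [s [t [ac st hv y1]]]; have [tc s0 csn _] := hv.
  have tr : (t < r)%N by lia.
  have hr : hook_rect c.+1 t by rewrite /hook_rect; lia.
  have -> : y = hook_class c.+1 t.
    rewrite [y]surjective_pairing y1; congr (_, _).
    by apply: is_hook_uniq hv _; have := hook_class_hook tr hr; rewrite -[in (r - t)%N]st addnK.
  have yc : hook_class c.+1 t \in hook_ends c.+1.
    by apply: map_f; rewrite mem_filter hr mem_iota.
  by case/orP: ac => /eqP ->; rewrite yc ?orbT.
move=> yin; have [c ac] : exists2 c : nat, (a == c :> nat) || (a == c.+1 :> nat) & y \in hook_ends c.+1.
  case/orP: yin => yin; first by exists a; rewrite ?eqxx.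
  case: (nat_of_ord a) yin => [|c] yin; last by exists c; rewrite ?eqxx ?orbT.
  by case/mapP: yin => t; rewrite mem_filter /hook_rect.
case/mapP=> t; rewrite mem_filter mem_iota => /andP[hr tr] ->.
by exists c, (r - t)%N, t; split; rewrite ?subnK 1?ltnW //; apply: (@hook_class_hook c.+1).
Qed.

Lemma hook_value k (t : nat) (kn : (k.-1 < n)%N) : (t < r)%N -> hook_rect k t ->
  (hook_class k t).2 (Ordinal kn) = (k.-1 + (r - t))%N :> nat.
Proof.
move=> tr hr; have [_ s0 _ h] := hook_class_hook tr hr.
by case: (h (Ordinal kn)) => /= ? ?; lia.
Qed.

Lemma hook_value_next k (t : nat) (kn : (k < n)%N) : (0 < k)%N -> (t < r)%N -> hook_rect k t ->
  (hook_class k t).2 (Ordinal kn) = (k.-1 - t)%N :> nat.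
Proof.
move=> k0 tr hr; have [_ s0 _ h] := hook_class_hook tr hr.
by case: (h (Ordinal kn)) => /= ? ?; lia.
Qed.

Lemma hook_ends_uniq k : (k <= n)%N -> uniq (hook_ends k).
Proof.
move=> kn; rewrite map_inj_in_uniq; first by apply/filter_uniq/iota_uniq.
move=> t t'; rewrite !mem_filter !mem_iota => /andP[hr tr] /andP[hr' tr'] E.
have kn' : (k.-1 < n)%N by case/andP: hr; lia.
by have := hook_value kn' tr hr; rewrite E hook_value //; lia.
Qed.

(** The hooks with corner [a] raise the value at [a], those with corner [a - 1]
    lower it, so no endpoint is counted twice. *)
Lemma star_ends_hooks a : perm_eq (star_ends r 1%g a) (hook_ends a.+1 ++ hook_ends a).
Proof.
apply: uniq_perm; first exact: star_ends_uniq.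
  rewrite cat_uniq !hook_ends_uniq ?(ltnW (ltn_ord a)) // andbT.
  apply/hasPn => _ /mapP[t + ->]; rewrite mem_filter mem_iota => /andP[hr tr].
  apply/mapP => -[t']; rewrite mem_filter mem_iota => /andP[hr' tr'] E.
  have a0 : (0 < a)%N by case/andP: hr; lia.
  have := @hook_value a.+1 t' (ltn_ord a) tr' hr'; rewrite -E hook_value_next //.
  by clear - a0 tr'; lia.
move=> y; apply/star_endsP/idP => [st|/hook_endE]; last exact: hook_end_star_to.
by apply/hook_endE/star_to_hook_end.
Qed.

(** A hook with leg [t] has [t] support positions before its corner and [t + 1]
    before the position after the corner; hence the opposite signs of the two
    power sums. *)
Lemma act1_star_sum a : act sch 1%g (star_sum (@bruhat_op n) a [set~ a] r) =
  qpower_sum sch a.+1 r - qpower_sum sch a r.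
Proof.
rewrite (act_star_sum sch 1%g r_gt0 a).
transitivity (\sum_(y <- hook_ends a.+1 ++ hook_ends a)
    (-1) ^+ low_support a (pos 1%g) y *: end_class sch y).
  exact: perm_big (star_ends_hooks a).
rewrite big_cat !qpower_sumE /=.
have sumE k : (a.+1 == k) || (a == k :> nat) ->
  \sum_(y <- hook_ends k) (-1) ^+ low_support a (pos 1%g) y *: end_class sch y
  = (-1) ^+ (a == k :> nat) *:
    (\sum_(t <- iota 0 r | hook_rect k t) (-1) ^+ t *: end_class sch (hook_class k t)).
  move=> ak; rewrite big_map big_filter scaler_sumr [LHS]big_seq_cond [RHS]big_seq_cond.
  apply: eq_bigr => t; rewrite mem_iota => /andP[tr hr].
  have k0 : (0 < k)%N by case/andP: hr; lia.
  have hv := hook_class_hook tr hr.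
  have {}ak : (a == k.-1 :> nat) || (a == k.-1.+1 :> nat) by clear - ak k0; lia.
  rewrite -[hook_class k t]/(pos (hook_class k t).2) (hook_low_support hv ak) prednK //.
  by rewrite scalerA -exprD addnC.
rewrite !sumE ?eqxx ?orbT // (ltn_eqF (ltnSn a)) expr0 scale1r expr1 scaleN1r.
by [].
Qed.

Lemma qpower_sum0 : qpower_sum sch 0 r = 0.
Proof. by rewrite /qpower_sum big1 // => i _; rewrite /qschur /in_rect /= mulr0. Qed.

Lemma sum_act1_star_sum k : (k <= n)%N ->
  \sum_(a < n | (a < k)%N) act sch 1%g (star_sum (@bruhat_op n) a [set~ a] r)
  = qpower_sum sch k r.
Proof.
elim: k => [|k IH] kn; first by rewrite qpower_sum0 big_pred0.
pose a := Ordinal kn; rewrite (bigD1 a) /=; last by [].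
rewrite (eq_bigl (fun b : 'I_n => (b < k)%N)) => [|b]; last first.
  by rewrite -(inj_eq val_inj) /= ltnS; case: ltngtP.
by rewrite (IH (ltnW kn)) act1_star_sum subrK.
Qed.

End PowerSum.

(** * The multiplication operator of the power sum *)

Section PowerOperator.
Variable n : nat.
Implicit Types a l : 'I_n.

Definition power_op (k r : nat) := \sum_(a < n | (a < k)%N) star_sum (@bruhat_op n) a [set~ a] r.

Lemma sum_theta_op : \sum_l theta_op l = 0 :> 'M[Zq n]_#|'S_n|.
Proof.
have swap_inj : injective (fun p : 'I_n * 'I_n => (p.2, p.1)) by move=> [i j] [i' j'] [-> ->].
have E : \sum_l theta_op l = \sum_(p : 'I_n * 'I_n | (p.1 < p.2)%N) (bruhat_op p.1 p.2 + bruhat_op p.2 p.1).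
  rewrite big_split /= pair_big /= (bigID (fun p : 'I_n * 'I_n => (p.1 < p.2)%N)) /=.
  congr (_ + _); rewrite [RHS](reindex_inj swap_inj) /= [LHS]big_mkcond [RHS]big_mkcond /=.
  by apply: eq_bigr => -[i j] _ /=; case: ltngtP => // /val_inj ->; rewrite (fk_diag (bruhat_op_fk n)).
by rewrite E big1 // => p _; rewrite (fk_anti (bruhat_op_fk n)) addNr.
Qed.

(** [star_sum_comm] covers all Dunkl elements but the one at the centre, which is
    minus the sum of the others. *)
Lemma star_sum_theta a l r : GRing.comm (theta_op l) (star_sum (@bruhat_op n) a [set~ a] r).
Proof.
have [->|la] := eqVneq l a; last exact: star_sum_comm (bruhat_op_fk n) _ _ _ la.
have -> : theta_op a = - \sum_(m | m != a) theta_op m.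
  by apply/eqP; rewrite -addr_eq0; have := sum_theta_op; rewrite (bigD1 a) //= => ->.
apply/commr_sym/commrN/commr_sum => m ma; apply/commr_sym.
exact: star_sum_comm (bruhat_op_fk n) _ _ _ ma.
Qed.

Lemma power_op_theta k r l : GRing.comm (theta_op l) (power_op k r).
Proof. by apply: commr_sum => a _; apply: star_sum_theta. Qed.

End PowerOperator.

Import boolp classical_sets fsbigop.

Theorem corollary3p3 (n : nat) (hn : (2 <= n)%N)
    (A : comAlgType (Zq n)) (sch : 'S_n -> A) (hA : is_quantum_cohomology sch)
    (k : nat) (hk : (1 <= k < n)%N) (r : nat) (hr : (1 <= r)%N) (u : 'S_n) :
  sch u * qpower_sum sch k r =
  \sum_(y \in MN_intervals k r u)
     ((-1) ^+ (ht (u^-1 * y.2)%g).+1 * 'X_[y.1] : Zq n) *: sch y.2.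
Proof.
have kn : (k <= n)%N by case/andP: hk => _ /ltnW.
have actE v : act sch v (power_op n k r)
    = \sum_(a < n | (a < k)%N) act sch v (star_sum (@bruhat_op n) a [set~ a] r).
  exact: raddf_sum.
rewrite -(sum_act1_star_sum sch hr kn) -actE -(act_central hA (power_op_theta k r)) actE.
rewrite (sum_star_sums _ _ hr kn) -big_filter.
set ends := [seq y <- _ | _].
have endsP y : (y \in ends) = `[< MN_intervals k r u y >].
  rewrite mem_filter andb_idr => [|/asboolP /(chain_to_ends hr) //].
  by apply: asbool_equiv_eq; split=> [|]; rewrite MN_intervalsE.
rewrite (fsbigE ends); first last.
- move=> y yM /negP[]; suff : y \in ends by [].
  by rewrite endsP; apply/asboolP.
- by move=> y yin; apply/asboolP; rewrite -endsP; exact: yin.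
- exact/filter_uniq/undup_uniq.
rewrite big_seq_cond [RHS]big_mkcond [RHS]big_seq_cond /=; apply: eq_bigr => y; rewrite andbT => yin.
have yM : MN_intervals k r u y by apply/asboolP; rewrite -endsP; exact: yin.
rewrite mem_set // /end_class scalerA (chain_ht hr kn) //.
by apply/MN_intervalsE.
Qed.
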